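(* Let $d=\dim_{\mathbb C}H^0_{(2)}(X,L)\in\mathbb N\cup\{\infty\}$, $d\ge1$, let $S=\{S_j\}_{j=1}^d$ be an orthonormal basis of $H^0_{(2)}(X,L)$ and let $\eta=\{\eta_j\}_{j\in\mathbb N}$ be a sequence of i.i.d. centered real or complex Gaussian random variables. Then $$\psi^S_\eta(x)=\sum_{j=1}^d\eta_jS_j(x)$$ is almost surely a holomorphic section of $L$ on $X$ (that is, almost surely the series converges for all $x\in X$ and its sum is a holomorphic section of $L$).
   Context: $(X,J,\Theta)$ is a connected complex manifold without boundary of complex dimension $n$ with Hermitian form $\Theta$, $\mathrm{dV}=\Theta^n/n!$, and $(L,h_L)$ is a holomorphic line bundle on $X$ with smooth Hermitian metric. $H^0_{(2)}(X,L)$ is the separable Hilbert space of holomorphic sections $s$ of $L$ with $\int_X|s|^2_{h_L}\mathrm{dV}<\infty$, with inner product $\int_X\langle s_1,s_2\rangle_{h_L}\mathrm{dV}$. *)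

(* Defs.v *)
From HB Require Import structures.
From mathcomp Require Import all_boot all_order all_algebra all_fingroup.
From mathcomp Require Import all_classical all_reals all_analysis.
From mathcomp Require Import complex.

Set Implicit Arguments.
Unset Strict Implicit.
Unset Printing Implicit Defensive.

Import Order.TTheory GRing.Theory Num.Theory.
Import numFieldNormedType.Exports.

Local Open Scope classical_set_scope.
Local Open Scope complex_scope.
Local Open Scope ring_scope.

(* Declared as a numClosedFieldType so that MathComp-Analysis equips it, and
   'rV[cplx R]_n, with their topology and their normed module structure over
   cplx R.  In particular [differentiable f z], for f between such spaces, is
   complex differentiability, i.e. (on an open set) holomorphy. *)
Definition cplx (R : realType) : numClosedFieldType := R[i].

(* Real and imaginary parts with values in R (MathComp's 'Re and 'Im remain in
   the closed field). *)
Definition cre (R : realType) (z : cplx R) : R := complex.Re (z : R[i]).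
Definition cim (R : realType) (z : cplx R) : R := complex.Im (z : R[i]).
Definition mkc (R : realType) (x y : R) : cplx R := x +i* y.
(* The imaginary unit 0 + 1 i; the generic 'i of a closed field is specified only
   by being a square root of -1. *)
Definition ci (R : realType) : cplx R := mkc 0 1.

Notation borel T := (g_sigma_algebraType (@open T)).

(* [chart_inv i] is only meaningful on the open set [chart i @` chart_dom i]. *)
Record complex_manifold (R : realType) (n : nat) (X : ptopologicalType) := {
  chart_idx : Type;
  chart_dom : chart_idx -> set X;
  chart : chart_idx -> X -> 'rV[cplx R]_n;
  chart_inv : chart_idx -> 'rV[cplx R]_n -> X;
  mfd_hausdorff : hausdorff_space X;
  mfd_second_countable : @second_countable X;
  chart_dom_open : forall i, open (chart_dom i);
  chart_cover : forall x, exists i, chart_dom i x;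
  chart_image_open : forall i, open (chart i @` chart_dom i);
  chartK : forall i x, chart_dom i x -> chart_inv i (chart i x) = x;
  chart_continuous : forall i x, chart_dom i x -> {for x, continuous (chart i)};
  chart_inv_continuous : forall i z, (chart i @` chart_dom i) z ->
    {for z, continuous (chart_inv i)};
  chart_transition : forall i j z,
    (chart i @` (chart_dom i `&` chart_dom j)) z ->
    differentiable (chart j \o chart_inv i) z }.

Definition chart_change (R : realType) (n : nat) (X : ptopologicalType)
    (M : complex_manifold R n X) (i j : chart_idx M) :
    'rV[cplx R]_n -> 'rV[cplx R]_n :=
  chart j \o chart_inv i.

Definition along (R : realType) (n : nat) (f : 'rV[cplx R]_n -> R)
    (z v : 'rV[cplx R]_n) : R -> R :=
  fun t => f (z + mkc t 0 *: v).

Fixpoint Ck (R : realType) (n k : nat) (U : set 'rV[cplx R]_n)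
    (f : 'rV[cplx R]_n -> R) : Prop :=
  (forall z, U z -> {for z, continuous f}) /\
  match k with
  | 0 => True
  | k'.+1 => forall v,
      (forall z, U z -> derivable (along f z v) 0 1) /\
      Ck k' U (fun z => derive1 (along f z v) 0)
  end.

Definition smooth_on (R : realType) (n : nat) (U : set 'rV[cplx R]_n)
    (f : 'rV[cplx R]_n -> R) : Prop :=
  forall k, Ck k U f.

(* A smooth positive (1,1)-form, given by its expressions in the charts: through
   a chart the tangent space is C^n, and J is multiplication by [ci R].  The sign
   convention is that the associated metric is Theta(u, J v). *)
Record hermitian_form (R : realType) (n : nat) (X : ptopologicalType)
    (M : complex_manifold R n X) := {
  local_form : chart_idx M ->
    'rV[cplx R]_n -> 'rV[cplx R]_n -> 'rV[cplx R]_n -> R;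
  form_linear : forall i z, (chart i @` chart_dom i) z ->
    forall (a : R) u u' v,
      local_form i z (mkc a 0 *: u + u') v =
        a * local_form i z u v + local_form i z u' v;
  form_antisym : forall i z, (chart i @` chart_dom i) z ->
    forall u v, local_form i z u v = - local_form i z v u;
  form_type11 : forall i z, (chart i @` chart_dom i) z ->
    forall u v, local_form i z (ci R *: u) (ci R *: v) = local_form i z u v;
  form_positive : forall i z, (chart i @` chart_dom i) z ->
    forall u, u != 0 -> 0 < local_form i z u (ci R *: u);
  form_smooth : forall i u v,
    smooth_on (chart i @` chart_dom i) (fun z => local_form i z u v);
  form_change : forall i j z,
    (chart i @` (chart_dom i `&` chart_dom j)) z ->
    forall u v,
      local_form i z u v = local_form j (chart_change i j z)
                       ('d (chart_change i j) z u) ('d (chart_change i j) z v) }.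

(* (omega /\ ... /\ omega)(e_(0,0), e_(0,1), ..., e_(n-1,0), e_(n-1,1)), with n
   factors omega; [false] and [true] stand for 0 and 1 in the second index. *)
Definition wedge_power (R : realType) (n : nat) (V : Type) (omega : V -> V -> R)
    (e : 'I_n * bool -> V) : R :=
  (2 ^+ n)^-1 * \sum_(s : {perm ('I_n * bool)})
    (-1) ^+ (odd_perm s) *
    \prod_(i < n) omega (e (s (i, false))) (e (s (i, true))).

(* The real frame d/dx_1, d/dy_1, ..., d/dx_n, d/dy_n. *)
Definition real_frame (R : realType) (n : nat) (k : 'I_n * bool) :
    'rV[cplx R]_n :=
  (if k.2 then ci R else 1) *: delta_mx 0 k.1.

Definition vol_density (R : realType) (n : nat) (X : ptopologicalType)
    (M : complex_manifold R n X) (Theta : hermitian_form M) (i : chart_idx M)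
    (z : 'rV[cplx R]_n) : R :=
  wedge_power (local_form Theta i z) (@real_frame R n) / (n`!)%:R.

(* Lebesgue integral over C^n = R^2n of a nonnegative Borel function, as an
   iterated integral in x_1, y_1, ..., x_n, y_n (Tonelli). *)
Fixpoint cn_integral (R : realType) (n : nat) :
    ('rV[cplx R]_n -> \bar R) -> \bar R :=
  match n with
  | 0 => fun f => f 0
  | n'.+1 => fun f =>
      (\int[@lebesgue_measure R]_x \int[@lebesgue_measure R]_y
         cn_integral (fun w : 'rV[cplx R]_n' =>
           f (row_mx (mkc x y)%:M w : 'rV[cplx R]_(1 + n'))))%E
  end.

(* dV is the Borel measure on X defined by Theta^n / n!; by second countability
   these local formulas determine exactly one measure. *)
Definition is_volume_measure (R : realType) (n : nat) (X : ptopologicalType)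
    (M : complex_manifold R n X) (Theta : hermitian_form M)
    (dV : {measure set (borel X) -> \bar R}) : Prop :=
  forall (i : chart_idx M) (A : set (borel X)),
    measurable A -> A `<=` chart_dom i ->
    dV A = cn_integral (fun z =>
      (vol_density Theta i z * \1_(chart i @` A) z)%:E).

(* On [triv_dom a], [triv_frame a] is a nowhere vanishing local section, and
   [triv_coord a] is the local trivialization it defines. *)
Record line_bundle (R : realType) (n : nat) (X : ptopologicalType)
    (M : complex_manifold R n X) := {
  fiber : X -> lmodType (cplx R);
  triv_idx : Type;
  triv_dom : triv_idx -> set X;
  triv_frame : forall (a : triv_idx) (x : X), fiber x;
  triv_coord : forall (a : triv_idx) (x : X), fiber x -> cplx R;
  triv_dom_open : forall a, open (triv_dom a);
  triv_cover : forall x, exists a, triv_dom a x;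
  coord_frame : forall a x, triv_dom a x ->
    forall c : cplx R, triv_coord a (c *: triv_frame a x) = c;
  frame_coord : forall a x, triv_dom a x ->
    forall v : fiber x, v = triv_coord a v *: triv_frame a x;
  triv_transition : forall (i : chart_idx M) a b z,
    (chart i @` (chart_dom i `&` triv_dom a `&` triv_dom b)) z ->
    differentiable (fun w => triv_coord b (triv_frame a (chart_inv i w))) z }.

Definition bundle_section (R : realType) (n : nat) (X : ptopologicalType)
    (M : complex_manifold R n X) (L : line_bundle M) :=
  forall x : X, fiber L x.

Definition holomorphic_section (R : realType) (n : nat) (X : ptopologicalType)
    (M : complex_manifold R n X) (L : line_bundle M)
    (s : bundle_section L) : Prop :=
  forall (i : chart_idx M) (a : triv_idx L) z,
    (chart i @` (chart_dom i `&` triv_dom a)) z ->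
    differentiable (fun w => triv_coord a (s (chart_inv i w))) z.

Record hermitian_metric (R : realType) (n : nat) (X : ptopologicalType)
    (M : complex_manifold R n X) (L : line_bundle M) := {
  herm : forall x : X, fiber L x -> fiber L x -> cplx R;
  herm_linear : forall x (c : cplx R) (u u' v : fiber L x),
    herm (c *: u + u') v = c * herm u v + herm u' v;
  herm_conj : forall x (u v : fiber L x), herm u v = Num.conj (herm v u);
  herm_positive : forall x (v : fiber L x), v != 0 -> 0 < herm v v;
  herm_smooth : forall (i : chart_idx M) (a : triv_idx L),
    smooth_on (chart i @` (chart_dom i `&` triv_dom a))
      (fun z => cre (herm (triv_frame a (chart_inv i z))
                     (triv_frame a (chart_inv i z)))) }.

Definition sqnorm (R : realType) (n : nat) (X : ptopologicalType)
    (M : complex_manifold R n X) (L : line_bundle M) (h : hermitian_metric L)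
    (x : X) (v : fiber L x) : R :=
  cre (herm h v v).

Section L2.
Context (R : realType) (n : nat) (X : ptopologicalType)
  (M : complex_manifold R n X) (L : line_bundle M) (h : hermitian_metric L)
  (dV : {measure set (borel X) -> \bar R}).

Definition l2_sqnorm (s : bundle_section L) : \bar R :=
  (\int[dV]_x (sqnorm h (s x))%:E)%E.

Definition l2_holomorphic : set (bundle_section L) :=
  [set s | holomorphic_section s /\ (l2_sqnorm s < +oo)%E].

Definition l2_inner (s t : bundle_section L) : cplx R :=
  mkc (Rintegral dV setT (fun x => cre (herm h (s x) (t x))))
      (Rintegral dV setT (fun x => cim (herm h (s x) (t x)))).

(* The dimension d in N u {oo} is an [option nat], [None] standing for oo, and
   families S_1, ..., S_d are indexed from 0. *)
Definition in_range (d : option nat) (j : nat) : bool :=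
  if d is Some m then (j < m)%N else true.

Definition l2_dimension (d : option nat) : Prop :=
  match d with
  | Some m => exists T : 'I_m -> bundle_section L,
      (forall j, l2_holomorphic (T j)) /\
      forall s, l2_holomorphic s ->
        exists! c : {ffun 'I_m -> cplx R},
          forall x, s x = \sum_(j < m) c j *: T j x
  | None => forall m, exists T : 'I_m -> bundle_section L,
      (forall j, l2_holomorphic (T j)) /\
      forall c : 'I_m -> cplx R,
        (forall x, \sum_(j < m) c j *: T j x = 0) -> forall j, c j = 0
  end.

(* S_j, j < d, is an orthonormal family in H^0_(2)(X, L) with dense span; the
   values S_j with j >= d are irrelevant. *)
Definition l2_orthonormal_basis (d : option nat) (S : nat -> bundle_section L) :
    Prop :=
  [/\ forall j, in_range d j -> l2_holomorphic (S j),
      forall j k, in_range d j -> in_range d k ->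
        l2_inner (S j) (S k) = (j == k)%:R &
      forall s, l2_holomorphic s -> forall eps : R, 0 < eps ->
        exists (N : nat) (c : nat -> cplx R),
          (l2_sqnorm (fun x => s x - \sum_(j < N | in_range d j) c j *: S j x)%R
             < eps%:E)%E].

End L2.

Section Gaussian.
Context (R : realType) (dO : measure_display) (Omega : measurableType dO)
  (P : probability Omega R).

(* Z has law N(0, sigma^2).  The case sigma = 0 is treated apart because
   [normal_prob 0 0] is not the Dirac mass at 0 in the library. *)
Definition centered_normal (Z : Omega -> R) : Prop :=
  exists sigma : R, forall A : set R, measurable A ->
    P (Z @^-1` A) = if sigma == 0 then \d_(0 : R) A else normal_prob 0 sigma A.

Definition centered_real_gaussian (eta : Omega -> cplx R) : Prop :=
  (forall w, cim (eta w) = 0) /\ centered_normal (fun w => cre (eta w)).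

(* (Re eta, Im eta) is a centered Gaussian vector in R^2. *)
Definition centered_complex_gaussian (eta : Omega -> cplx R) : Prop :=
  forall a b : R,
    centered_normal (fun w => a * cre (eta w) + b * cim (eta w)).

Definition iid (eta : nat -> Omega -> cplx R) : Prop :=
  [/\ forall j, measurable_fun setT (eta j : Omega -> borel (cplx R)),
      forall j (A : set (borel (cplx R))), measurable A ->
        P (eta j @^-1` A) = P (eta 0%N @^-1` A) &
      forall (J : seq nat) (A : nat -> set (borel (cplx R))),
        uniq J -> (forall j, measurable (A j)) ->
        P (\bigcap_(j in [set` J]) (eta j @^-1` A j)) =
        (\prod_(j <- J) P (eta j @^-1` A j))%E].

End Gaussian.

(* The series sum_(j < d) c_j S_j converges to psi at the point x, in the fiber
   of L over x. *)
Definition series_converges_at (R : realType) (n : nat) (X : ptopologicalType)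
    (M : complex_manifold R n X) (L : line_bundle M) (h : hermitian_metric L)
    (d : option nat) (c : nat -> cplx R) (S : nat -> bundle_section L)
    (psi : bundle_section L) (x : X) : Prop :=
  (fun N : nat => Num.sqrt (sqnorm h
     (\sum_(j < N | in_range d j) c j *: S j x - psi x))) @ \oo --> (0 : R).

(* Main.v *)
(* Holomorphic sections obey a local sub-mean-value inequality
   sup_A' |s|^2 <= C int_A |s|^2 dV, because in a chart the density of dV and the
   weight of the metric are bounded below.  With Bessel's inequality it bounds the
   Bergman kernel sum_j |S_j(x)|^2 on a neighbourhood of A, hence the trace of the
   Gram matrix g_jk = Re int_A <S_j, S_k> dV.  For independent centered real xi_j of
   bounded variance, Kolmogorov's maximal inequality, in the form of optional
   stopping of the submartingale sum_(j,k <= n) xi_j xi_k g_jk, which is the square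
   of the norm of the partial sum in L^2(A), shows that the partial sums of
   sum_j xi_j S_j are almost surely Cauchy in L^2(A), hence uniformly on A'.  This
   applies to the real and to the imaginary parts of the eta_j; the two need not be
   independent of each other.  Countably many sets A' cover X, and a locally uniform
   limit of holomorphic sections is holomorphic by Cauchy's estimates. *)
Require Import Defs.
From HB Require Import structures.
From mathcomp Require Import all_boot all_order all_algebra all_fingroup.
From mathcomp Require Import all_classical all_reals all_analysis.
From mathcomp Require Import measurable_realfun.
From mathcomp Require Import complex.
From mathcomp Require Import ring lra.
Import Order.TTheory GRing.Theory Num.Theory.
Import numFieldNormedType.Exports.
Local Open Scope classical_set_scope.
Local Open Scope ring_scope.
Set Implicit Arguments.
Unset Strict Implicit.
Unset Printing Implicit Defensive.

(** * Complex numbers as pairs of reals *)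

Section Cplx.
Variable R : realType.
Implicit Types z w : cplx R.

(** Holomorphy is pointwise complex differentiability, with no continuity of the derivative, so the
    Cauchy theory has to start from Goursat's bisection. It is developed on rectangles with sides
    parallel to the axes: their boundary integrals run over real segments, and sides placed where
    the line integrals are below average lead straight to the iterated integrals of [cn_integral].
    The value [2 pi i] of the integral of the Cauchy kernel is never computed; a lower bound for its
    modulus is enough. The measure [dV] is tied to the charts through the measures of Borel sets
    only, so an integral of [|s|^2] is compared with Lebesgue measure by cutting the integrand into
    levels. That [dV] has positive density is linear algebra: a frame orthogonal for the form leaves
    only nonnegative terms in the wedge power. The almost sure statements never require the set of
    convergence to be measurable: its complement is covered by countable unions and intersections of
    events defined by finitely many partial sums. *)

Definition cmod z : R := Num.sqrt (cre z ^+ 2 + cim z ^+ 2).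

Lemma cplxP z w : cre z = cre w -> cim z = cim w -> z = w.
Proof. by case: z w => [a b] [c d]; rewrite /cre /cim /= => -> ->. Qed.

Lemma normcE z : `|z| = mkc (cmod z) 0.
Proof. exact: normc_def. Qed.

Lemma cmodE z : cmod z = cre `|z|. Proof. by rewrite normcE. Qed.

Lemma creD z w : cre (z + w) = cre z + cre w.
Proof. by case: z w => [a b] [c d]. Qed.
Lemma cimD z w : cim (z + w) = cim z + cim w.
Proof. by case: z w => [a b] [c d]. Qed.
Lemma creN z : cre (- z) = - cre z. Proof. by case: z. Qed.
Lemma cimN z : cim (- z) = - cim z. Proof. by case: z. Qed.
Lemma creB z w : cre (z - w) = cre z - cre w. Proof. by rewrite creD creN. Qed.
Lemma cimB z w : cim (z - w) = cim z - cim w. Proof. by rewrite cimD cimN. Qed.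
Lemma creM z w : cre (z * w) = cre z * cre w - cim z * cim w.
Proof. by case: z w => [a b] [c d]. Qed.
Lemma cimM z w : cim (z * w) = cre z * cim w + cim z * cre w.
Proof. by case: z w => [a b] [c d]. Qed.
Lemma cre0 : cre (0 : cplx R) = 0. Proof. by []. Qed.
Lemma cim0 : cim (0 : cplx R) = 0. Proof. by []. Qed.
Lemma cre1 : cre (1 : cplx R) = 1. Proof. by []. Qed.
Lemma cim1 : cim (1 : cplx R) = 0. Proof. by []. Qed.
Lemma creK (x y : R) : cre (mkc x y) = x. Proof. by []. Qed.
Lemma cimK (x y : R) : cim (mkc x y) = y. Proof. by []. Qed.
Lemma mkcK z : mkc (cre z) (cim z) = z. Proof. by case: z. Qed.
Lemma mkcD (a b c d : R) : mkc a b + mkc c d = mkc (a + c) (b + d).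
Proof. by []. Qed.

Lemma mkcM0 (a b : R) : mkc a 0 * mkc b 0 = mkc (a * b) 0.
Proof. by apply: cplxP; rewrite ?creM ?cimM /= ?mulr0 ?mul0r ?subr0 ?addr0. Qed.

Definition cplxE := (creD, cimD, creN, cimN, creM, cimM, creK, cimK, cre0, cim0,
  cre1, cim1).

Lemma cre_sum I (r : seq I) (P : pred I) (F : I -> cplx R) :
  cre (\sum_(i <- r | P i) F i) = \sum_(i <- r | P i) cre (F i).
Proof. exact: (big_morph _ creD cre0). Qed.
Lemma cim_sum I (r : seq I) (P : pred I) (F : I -> cplx R) :
  cim (\sum_(i <- r | P i) F i) = \sum_(i <- r | P i) cim (F i).
Proof. exact: (big_morph _ cimD cim0). Qed.

Lemma cmod_ge0 z : 0 <= cmod z. Proof. exact: sqrtr_ge0. Qed.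
Hint Resolve cmod_ge0 : core.

Lemma sqr_cmod z : cmod z ^+ 2 = cre z ^+ 2 + cim z ^+ 2.
Proof. by rewrite sqr_sqrtr// addr_ge0 ?sqr_ge0. Qed.

Lemma lec_mkc (x y : R) : (mkc x 0 <= mkc y 0) = (x <= y).
Proof. exact: lecR. Qed.
Lemma ltc_mkc (x y : R) : (mkc x 0 < mkc y 0) = (x < y).
Proof. exact: ltcR. Qed.

Lemma cmod0 : cmod 0 = 0. Proof. by rewrite cmodE normr0. Qed.
Lemma cmodN z : cmod (- z) = cmod z. Proof. by rewrite !cmodE normrN. Qed.
Lemma cmodB z w : cmod (z - w) = cmod (w - z). Proof. by rewrite -cmodN opprB. Qed.
Lemma cmodM z w : cmod (z * w) = cmod z * cmod w.
Proof. by rewrite [LHS]cmodE normrM !normcE !cplxE mulr0 subr0. Qed.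
Lemma cmodX z k : cmod (z ^+ k) = cmod z ^+ k.
Proof.
elim: k => [|k IH]; last by rewrite !exprS cmodM IH.
by rewrite !expr0 cmodE normr1.
Qed.
Lemma cmod1 : cmod 1 = 1. Proof. by rewrite cmodE normr1. Qed.
Lemma cmodD z w : cmod (z + w) <= cmod z + cmod w.
Proof. by have := ler_normD z w; rewrite !normcE mkcD addr0 lec_mkc. Qed.
Lemma cmod_eq0 z : (cmod z == 0) = (z == 0).
Proof.
rewrite -[RHS]normr_eq0 normcE; apply/eqP/eqP => [->//|].
by move=> /(congr1 (@cre R)).
Qed.
Lemma cmod_gt0 z : (0 < cmod z) = (z != 0).
Proof. by rewrite lt_def cmod_eq0 cmod_ge0 andbT. Qed.
Lemma cmodV z : cmod z^-1 = (cmod z)^-1.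
Proof.
have [->|z0] := eqVneq z 0; first by rewrite invr0 cmod0 invr0.
apply: (mulfI (x := cmod z)); first by rewrite cmod_eq0.
by rewrite -cmodM !divff ?cmod1 ?cmod_eq0.
Qed.
Lemma cmod_sum I (r : seq I) (P : pred I) (F : I -> cplx R) :
  cmod (\sum_(i <- r | P i) F i) <= \sum_(i <- r | P i) cmod (F i).
Proof.
elim/big_ind2: _ => //; first by rewrite cmod0.
by move=> a b c d h1 h2; exact: le_trans (cmodD _ _) (lerD h1 h2).
Qed.
Lemma ler_cre z : `|cre z| <= cmod z.
Proof. by rewrite -sqrtr_sqr ler_wsqrtr// lerDl sqr_ge0. Qed.
Lemma ler_cim z : `|cim z| <= cmod z.
Proof. by rewrite -sqrtr_sqr ler_wsqrtr// lerDr sqr_ge0. Qed.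
Lemma cmod_le z : cmod z <= `|cre z| + `|cim z|.
Proof.
rewrite -[leRHS]ger0_norm ?addr_ge0// -sqrtr_sqr ler_wsqrtr//.
rewrite sqrrD -[_ ^+ 2 + _](addrK 0) !real_normK ?num_real//.
by rewrite subr0 addr0 lerD2r lerDl mulrn_wge0 ?mulr_ge0.
Qed.
Lemma cmod_real (x : R) : cmod (mkc x 0) = `|x|.
Proof. by rewrite /cmod !cplxE expr0n addr0 sqrtr_sqr. Qed.
Lemma mkc0 : mkc 0 0 = 0 :> cplx R. Proof. by []. Qed.

Lemma cpos_mkc (e : cplx R) : 0 < e -> 0 < cre e /\ e = mkc (cre e) 0.
Proof.
case: e => [a b]; rewrite ltcE /= => /andP[/eqP bE a0].
by split => //; rewrite /mkc /= -bE.
Qed.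

End Cplx.
#[export] Hint Resolve cmod_ge0 : core.

(** * Neighbourhoods, continuity and differentiability through real-valued norms *)

Section Topo.
Variable R : realType.

(** The norm of a space over [cplx R] takes its values in [cplx R]. [vmod] is its real value, the
    imaginary part being zero by [vmodE], so that estimates stay in the ordered field [R]. *)
Definition vmod (V : normedModType (cplx R)) (v : V) : R := cre `|v|.

Lemma vmodE (V : normedModType (cplx R)) (v : V) : `|v| = mkc (vmod v) 0.
Proof.
rewrite /vmod; have : 0 <= `|v| by [].
by case: `|v| => a b; rewrite lecE /= => /andP[/eqP/= -> _].
Qed.

Lemma vmod_ge0 (V : normedModType (cplx R)) (v : V) : 0 <= vmod v.
Proof. by have : 0 <= `|v| by []; rewrite vmodE -mkc0 lec_mkc. Qed.

Lemma nbhs_vmod (V : normedModType (cplx R)) (x : V) (P : set V) :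
  nbhs x P <-> exists2 r : R, 0 < r & forall y, vmod (x - y) < r -> P y.
Proof.
split => [/nbhs_ballP[e e0]|[e e0 eP]]; last apply/nbhs_ballP.
  rewrite -ball_normE => eP.
  have [r0 eE] := cpos_mkc e0; exists (cre e) => // y xy; apply: eP => /=.
  by rewrite vmodE eE ltc_mkc.
exists (mkc e 0); first by rewrite /= -mkc0 ltc_mkc.
rewrite -ball_normE; by move=> y /=; rewrite vmodE ltc_mkc => /eP.
Qed.

Lemma vmod_row n (v : 'rV[cplx R]_n) (r : R) :
  0 <= r -> (vmod v <= r) <-> (forall j, cmod (v 0 j) <= r).
Proof.
move=> r0; have cr0 : 0 <= mkc r 0 by rewrite -mkc0 lec_mkc.
have -> : (vmod v <= r) = (`|v| <= mkc r 0) by rewrite vmodE lec_mkc.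
rewrite {1}/Num.Def.normr /= mx_normE; split.
  move=> vr j; rewrite -lec_mkc -normcE; apply: le_trans vr.
  rewrite -[leLHS]nngE num_le.
  exact: (@le_bigmax _ _ _ _ (fun i : 'I_1 * 'I_n => (`|v i.1 i.2|%:nng)%R) (0, j)).
move=> vr; pose r' := NngNum cr0.
have -> : mkc r 0 = r'%:num by [].
rewrite num_le; apply/bigmax_leP; split => [|[i j] _]; rewrite -num_le //=.
by rewrite ord1 normcE lec_mkc.
Qed.

Lemma vmodN (V : normedModType (cplx R)) (v : V) : vmod (- v) = vmod v.
Proof. by rewrite /vmod normrN. Qed.
Lemma vmodZ (V : normedModType (cplx R)) (a : cplx R) (v : V) :
  vmod (a *: v) = cmod a * vmod v.
Proof. by rewrite {1}/vmod normrZ normcE !vmodE !cplxE mulr0 subr0. Qed.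
Lemma vmod0 (V : normedModType (cplx R)) : vmod (0 : V) = 0.
Proof. by rewrite /vmod normr0. Qed.
Lemma vmod_cmod (z : cplx R) : vmod z = cmod z.
Proof. by rewrite cmodE. Qed.
Lemma cmod_entry n (v : 'rV[cplx R]_n) j : cmod (v 0 j) <= vmod v.
Proof. by apply (vmod_row _ (vmod_ge0 _)). Qed.

Lemma continuousE (V : normedModType (cplx R)) (f : V -> R) (x : V) :
  {for x, continuous f} <->
  forall e : R, 0 < e -> exists2 r : R, 0 < r &
    forall y, vmod (x - y) < r -> `|f x - f y| < e.
Proof.
split => [/cvgrPdist_lt fx e /fx /nbhs_vmod//|fx].
by apply/cvgrPdist_lt => e /fx; rewrite -nbhs_vmod.
Qed.

Lemma ccontinuousE (V W : normedModType (cplx R)) (f : V -> W) (x : V) :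
  {for x, continuous f} <->
  forall e : R, 0 < e -> exists2 r : R, 0 < r &
    forall y, vmod (x - y) < r -> vmod (f x - f y) < e.
Proof.
split => [/cvgrPdist_lt fx e e0|fx].
  have ce : 0 < mkc e 0 by rewrite -mkc0 ltc_mkc.
  have /nbhs_vmod[r r0 rP] := fx _ ce; exists r => // y /rP.
  by rewrite vmodE ltc_mkc.
apply/cvgrPdist_lt => e /cpos_mkc[e0 ->].
have [r r0 rP] := fx _ e0; apply/nbhs_vmod; exists r => // y /rP.
by rewrite vmodE ltc_mkc.
Qed.

Lemma continuous_cre : continuous (@cre R).
Proof.
move=> z; apply/(@continuousE (cplx R)) => e e0; exists e => // y.
by rewrite vmod_cmod -creB; apply: le_lt_trans; exact: ler_cre.
Qed.
Lemma continuous_cim : continuous (@cim R).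
Proof.
move=> z; apply/(@continuousE (cplx R)) => e e0; exists e => // y.
by rewrite vmod_cmod -cimB; apply: le_lt_trans; exact: ler_cim.
Qed.

Lemma differentiable_eps (V W : normedModType (cplx R)) (f : V -> W) (x : V) :
  differentiable f x -> forall e : R, 0 < e -> exists2 r : R, 0 < r &
    forall h, vmod h < r -> vmod (f (x + h) - f x - 'd f x h) <= e * vmod h.
Proof.
move=> /diff_locally /eqaddoP dfx e e0.
have ce : 0 < mkc e 0 by rewrite -mkc0 ltc_mkc.
have /nbhs_vmod[r r0 rP] := dfx _ ce; exists r => // h hr.
have := rP h; rewrite sub0r vmodN => /(_ hr).
rewrite !vmodE mkcM0 lec_mkc.
by rewrite !fctE /= opprD addrA [h + x]addrC.
Qed.

(** The differential ['d f x] is defined by a choice. An explicit candidate [df] is identified with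
    it by uniqueness of the differential, which asks that [df] be continuous; the bound [C] provides
    this. *)
Lemma eps_differentiable (V W : normedModType (cplx R)) (f : V -> W) (x : V)
    (df : {linear V -> W}) (C : R) :
  (forall h, vmod (df h) <= C * vmod h) ->
  (forall e : R, 0 < e -> exists2 r : R, 0 < r &
    forall h, vmod h < r -> vmod (f (x + h) - f x - df h) <= e * vmod h) ->
  differentiable f x.
Proof.
move=> dfC dfx.
have cdf : continuous df.
  move=> v; apply/ccontinuousE => e e0.
  have C0 : 0 < `|C| + 1 by rewrite ltr_pwDr.
  exists (e / (`|C| + 1)); first by rewrite divr_gt0.
  move=> y; rewrite ltr_pdivlMr// => vy; rewrite -linearB.
  apply: le_lt_trans (dfC _) (le_lt_trans _ vy); rewrite mulrC ler_wpM2l ?vmod_ge0//.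
  by rewrite (le_trans (ler_norm _))// lerDl.
have dfo : f \o shift x = cst (f x) + df +o_0 id.
  apply/eqaddoP => e /cpos_mkc[e0 ->]; have [r r0 rP] := dfx _ e0.
  apply/nbhs_vmod; exists r => // h; rewrite sub0r vmodN => /rP.
  rewrite !vmodE mkcM0 lec_mkc.
  by rewrite !fctE /= opprD addrA [h + x]addrC.
have E := diff_unique cdf dfo.
by apply/diff_locallyP; rewrite E.
Qed.

End Topo.

(** * Goursat's theorem *)

Section Segment.
Variable R : realType.
Local Notation mu := (@lebesgue_measure R).
Implicit Types (phi psi : R -> R) (a b c d : R).

Definition sint phi a b : R := Rintegral mu `[a, b]%classic phi.

(** Continuity as a function on [R] at every point of the segment, end points included: this is what
    a first-order expansion at each point gives along a line, and it is inherited by subsegments. *)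
Definition cts_on phi a b := forall x, a <= x <= b -> {for x, continuous phi}.

Lemma cts_on_sub phi a b a' b' :
  a <= a' -> b' <= b -> cts_on phi a b -> cts_on phi a' b'.
Proof.
move=> aa bb cp x /andP[x1 x2]; apply: cp.
by rewrite (le_trans aa x1) (le_trans x2 bb).
Qed.

Lemma cts_onB phi psi a b : cts_on phi a b -> cts_on psi a b ->
  cts_on (fun x => phi x - psi x) a b.
Proof. by move=> cp cq x xab; apply: cvgB; [exact: cp|exact: cq]. Qed.

Lemma cts_onD phi psi a b : cts_on phi a b -> cts_on psi a b ->
  cts_on (fun x => phi x + psi x) a b.
Proof. by move=> cp cq x xab; apply: cvgD; [exact: cp|exact: cq]. Qed.

Lemma cts_onM phi psi a b : cts_on phi a b -> cts_on psi a b ->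
  cts_on (fun x => phi x * psi x) a b.
Proof. by move=> cp cq x xab; apply: cvgM; [exact: cp|exact: cq]. Qed.

Lemma cts_on_cst (k : R) a b : cts_on (fun=> k) a b.
Proof. by move=> x xab; exact: cvg_cst. Qed.

Lemma cts_on_integrable phi a b : cts_on phi a b ->
  mu.-integrable `[a, b]%classic (EFin \o phi).
Proof.
move=> cp; apply: continuous_compact_integrable; first exact: segment_compact.
by apply: continuous_in_subspaceT => x; rewrite inE /= in_itv /= => /cp.
Qed.

Lemma sintB phi psi a b : cts_on phi a b -> cts_on psi a b ->
  sint (fun x => phi x - psi x) a b = sint phi a b - sint psi a b.
Proof. by move=> cp cq; apply: RintegralB => //; exact: cts_on_integrable. Qed.

Lemma sintD phi psi a b : cts_on phi a b -> cts_on psi a b ->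
  sint (fun x => phi x + psi x) a b = sint phi a b + sint psi a b.
Proof. by move=> cp cq; apply: RintegralD => //; exact: cts_on_integrable. Qed.

Lemma sintZ (k : R) phi a b : cts_on phi a b ->
  sint (fun x => k * phi x) a b = k * sint phi a b.
Proof. by move=> cp; apply: RintegralZl => //; exact: cts_on_integrable. Qed.

Lemma lebesgue_measure_segment a b : a <= b -> mu `[a, b]%classic = (b - a)%:E.
Proof.
move=> ab; rewrite lebesgue_measure_itv/= lte_fin.
by case: ltP => // ba; rewrite (@le_anti _ _ a b) ?subrr// ab.
Qed.

Lemma sint_cst (k : R) a b : a <= b -> sint (fun=> k) a b = k * (b - a).
Proof.
move=> ab; rewrite /sint Rintegral_cst//; congr (_ * _).
exact: (congr1 fine (lebesgue_measure_segment ab)).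
Qed.

Lemma eq_sint phi psi a b : (forall x, a <= x <= b -> phi x = psi x) ->
  sint phi a b = sint psi a b.
Proof.
by move=> e; apply: eq_Rintegral => x; rewrite inE /= in_itv /= => /e.
Qed.

Lemma sint_split c phi a b : a <= c <= b -> cts_on phi a b ->
  sint phi a b = sint phi a c + sint phi c b.
Proof.
move=> /andP[ac cb] cp; rewrite /sint.
have ip := cts_on_integrable cp.
have := @Rintegral_itvB R phi (BLeft a) (BRight b) c ip.
rewrite !bnd_simp => /(_ ac cb) /eqP; rewrite subr_eq => /eqP ->.
rewrite addrC; congr (_ + _); apply: Rintegral_itv_obnd_cbnd.
apply: integrableS ip => //.
by move=> x /=; rewrite !in_itv /= => /andP[x1 ->]; rewrite (le_trans ac (ltW x1)).
Qed.

Lemma sint_approx (k e : R) phi a b : a <= b -> cts_on phi a b ->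
  (forall x, a <= x <= b -> `|phi x - k| <= e) ->
  `|sint phi a b - k * (b - a)| <= e * (b - a).
Proof.
move=> ab cp pe; rewrite -sint_cst// -sintB//; last exact: cts_on_cst.
have cpk : cts_on (fun x => phi x - k) a b.
  by apply: cts_onB => //; exact: cts_on_cst.
apply: le_trans (le_normr_Rintegral _ _) _ => //; first exact: cts_on_integrable.
rewrite -[leRHS]sint_cst//; apply: le_Rintegral => //.
- apply: (@cts_on_integrable (fun x => `|phi x - k|)) => x xab.
  by apply: cvg_norm; exact: cpk.
- by apply: (@cts_on_integrable (fun=> e)); exact: cts_on_cst.
Qed.

Lemma sint_bound (e : R) phi a b : a <= b -> cts_on phi a b ->
  (forall x, a <= x <= b -> `|phi x| <= e) -> `|sint phi a b| <= e * (b - a).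
Proof.
move=> ab cp pe; have := @sint_approx 0 e phi a b ab cp.
by rewrite mul0r subr0; apply => x /pe; rewrite subr0.
Qed.

Lemma le_sint phi psi a b : cts_on phi a b -> cts_on psi a b ->
  (forall x, a <= x <= b -> phi x <= psi x) -> sint phi a b <= sint psi a b.
Proof.
move=> cp cq pq; apply: le_Rintegral => //; try exact: cts_on_integrable.
Qed.

End Segment.

Section Goursat.
Variable R : realType.
Implicit Types (P Q : R -> R -> R) (a b c d : R).

(** The integral of [P dx + Q dy] counterclockwise along the boundary of [[a, b] x [c, d]], with
    opposite sides paired. *)
Definition circ P Q a b c d : R :=
  sint (fun x => P x c - P x d) a b + sint (fun y => Q b y - Q a y) c d.

(* The two first-order expansions share the mixed coefficient m: P dx + Q dy is
   closed at (x, y). *)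
Definition closed_at P Q x y := exists p m q, forall e : R, 0 < e ->
  exists2 r : R, 0 < r & forall x' y', `|x' - x| < r -> `|y' - y| < r ->
   `|P x' y' - P x y - p * (x' - x) - m * (y' - y)| <= e * (`|x' - x| + `|y' - y|)
   /\
   `|Q x' y' - Q x y - m * (x' - x) - q * (y' - y)| <= e * (`|x' - x| + `|y' - y|).

Lemma rcontinuousE (f : R -> R) (x : R) : {for x, continuous f} <->
  forall e : R, 0 < e -> exists2 r : R, 0 < r &
    forall y, `|x - y| < r -> `|f x - f y| < e.
Proof.
split=> [/cvgrPdist_lt H e /H [r r0 rP]|H]; first by exists r.
by apply/cvgrPdist_lt => e /H [r r0 rP]; exists r.
Qed.

Lemma lin_approx_cts (f : R -> R) (x l : R) :
  (forall e : R, 0 < e -> exists2 r : R, 0 < r & forall x', `|x' - x| < r ->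
     `|f x' - f x - l * (x' - x)| <= e * `|x' - x|) -> {for x, continuous f}.
Proof.
move=> H; apply/rcontinuousE => e e0.
have [r r0 rP] := H 1 ltr01.
have l0 : 0 < `|l| + 1 by rewrite ltr_pwDr.
exists (Num.min r (e / (`|l| + 1))).
  by rewrite lt_min r0 divr_gt0.
move=> y; rewrite lt_min distrC ltr_pdivlMr// => /andP[yr ye].
have := rP _ yr; rewrite mul1r => h; rewrite mulrC mulrDl mul1r in ye.
apply: le_lt_trans ye.
rewrite (distrC (f x)) -[f y - f x](subrK (l * (y - x))).
by apply: le_trans (ler_normD _ _) _; rewrite addrC lerD// normrM.
Qed.

Lemma closed_at_ctsP1 P Q x y : closed_at P Q x y ->
  {for x, continuous (fun x => P x y)}.
Proof.
move=> [p [m [q H]]]; apply: (@lin_approx_cts _ _ p) => e /H[r r0 rP].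
exists r => // x' xr; have [] := rP x' y xr; first by rewrite subrr normr0.
by rewrite subrr mulr0 subr0 normr0 addr0.
Qed.
Lemma closed_at_ctsQ2 P Q x y : closed_at P Q x y ->
  {for y, continuous (fun y => Q x y)}.
Proof.
move=> [p [m [q H]]]; apply: (@lin_approx_cts _ _ q) => e /H[r r0 rP].
exists r => // y' yr; have [] := rP x y' _ yr; first by rewrite subrr normr0.
move=> _; by rewrite subrr mulr0 subr0 normr0 add0r.
Qed.

Definition closed_on P Q a b c d :=
  forall x y, a <= x <= b -> c <= y <= d -> closed_at P Q x y.

Definition bcts P Q a b c d :=
  (forall y, c <= y <= d -> cts_on (fun x => P x y) a b) /\
  (forall x, a <= x <= b -> cts_on (fun y => Q x y) c d).

Lemma closed_on_bcts P Q a b c d : closed_on P Q a b c d -> bcts P Q a b c d.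
Proof.
move=> H; split=> [y yP x xP|x xP y yP].
  exact: closed_at_ctsP1 (H _ _ xP yP).
exact: closed_at_ctsQ2 (H _ _ xP yP).
Qed.

Lemma closed_on_sub P Q a b c d a' b' c' d' :
  a <= a' -> b' <= b -> c <= c' -> d' <= d ->
  closed_on P Q a b c d -> closed_on P Q a' b' c' d'.
Proof.
move=> h1 h2 h3 h4 H x y /andP[x1 x2] /andP[y1 y2].
by apply: H; apply/andP; split;
  [exact: le_trans x1|exact: le_trans h2|exact: le_trans y1|exact: le_trans h4].
Qed.

Lemma circ_splitx e P Q a b c d : a <= e <= b ->
  (forall y, y = c \/ y = d -> cts_on (fun x => P x y) a b) ->
  (forall x, [\/ x = a, x = e | x = b] -> cts_on (fun y => Q x y) c d) ->
  circ P Q a b c d = circ P Q a e c d + circ P Q e b c d.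
Proof.
move=> aeb cP cQ; case/andP: (aeb) => ae eb; rewrite /circ.
have cB : cts_on (fun x => P x c - P x d) a b.
  by apply: cts_onB; apply: cP; [left|right].
rewrite (sint_split aeb cB).
have qa := cQ a (Or31 _ _ erefl); have qe := cQ e (Or32 _ _ erefl).
have qb := cQ b (Or33 _ _ erefl).
by rewrite (sintB qb qa) (sintB qe qa) (sintB qb qe); ring.
Qed.

Lemma circ_splity e P Q a b c d : c <= e <= d ->
  (forall y, [\/ y = c, y = e | y = d] -> cts_on (fun x => P x y) a b) ->
  (forall x, x = a \/ x = b -> cts_on (fun y => Q x y) c d) ->
  circ P Q a b c d = circ P Q a b c e + circ P Q a b e d.
Proof.
move=> ced cP cQ; rewrite /circ.
have cB : cts_on (fun y => Q b y - Q a y) c d.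
  by apply: cts_onB; apply: cQ; [right|left].
rewrite (sint_split ced cB).
have pc := cP c (Or31 _ _ erefl); have pe := cP e (Or32 _ _ erefl).
have pd := cP d (Or33 _ _ erefl).
by rewrite (sintB pc pd) (sintB pc pe) (sintB pe pd); ring.
Qed.

(** The affine parts of [P] and [Q] at [(x, y)] have no circulation, because the mixed coefficient
    is the same in both. What remains is an error of order [e * (w + h)] integrated along sides of
    lengths [w] and [h]. *)
Lemma circ_small P Q a b c d x y : a <= x <= b -> c <= y <= d ->
  closed_on P Q a b c d ->
  forall e : R, 0 < e -> exists2 r : R, 0 < r &
  forall a' b' c' d', a <= a' -> b' <= b -> c <= c' -> d' <= d ->
    a' <= x <= b' -> c' <= y <= d' -> b' - a' < r -> d' - c' < r ->
   `|circ P Q a' b' c' d'| <= e * ((b' - a') + (d' - c')) ^+ 2.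
Proof.
move=> xP yP H e e0; have [p [m [q HPQ]]] := H _ _ xP yP.
have [r r0 rP] := HPQ (e / 2) (divr_gt0 e0 (ltr0Sn _ _)).
exists r => // a' b' c' d' aa bb cc dd /andP[x1 x2] /andP[y1 y2] hb hd.
have [H1 H2] := closed_on_bcts (closed_on_sub aa bb cc dd H).
have ab := le_trans x1 x2; have cd := le_trans y1 y2.
have nx t : a' <= t <= b' -> `|t - x| <= b' - a'.
  by move=> /andP[t1 t2]; rewrite ler_norml; apply/andP; split; lra.
have ny t : c' <= t <= d' -> `|t - y| <= d' - c'.
  by move=> /andP[t1 t2]; rewrite ler_norml; apply/andP; split; lra.
have cP : c' <= c' <= d' by rewrite lexx cd.
have dP : c' <= d' <= d' by rewrite lexx cd.
have aP : a' <= a' <= b' by rewrite lexx ab.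
have bP : a' <= b' <= b' by rewrite lexx ab.
set w := b' - a'; set h := d' - c'.
have bound t s : a' <= t <= b' -> c' <= s <= d' ->
  `|P t s - P x y - p * (t - x) - m * (s - y)| <= e / 2 * (w + h) /\
  `|Q t s - Q x y - m * (t - x) - q * (s - y)| <= e / 2 * (w + h).
  move=> tP sP.
  have [] := rP t s (le_lt_trans (nx _ tP) hb) (le_lt_trans (ny _ sP) hd).
  have le1 : e / 2 * (`|t - x| + `|s - y|) <= e / 2 * (w + h).
    by rewrite ler_pM2l ?divr_gt0// lerD ?nx ?ny.
  by move=> b1 b2; split; [exact: le_trans b1 _|exact: le_trans b2 _].
(* In the difference of opposite sides the value at [(x, y)] and the term in [t - x] cancel; the
   constant [m * (c' - d')] is left, with an error [e / 2] from each side. The same happens in [B2]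
   with [m * (b' - a')], and the two main terms cancel each other. *)
have B1 : `|sint (fun t => P t c' - P t d') a' b' - (m * (c' - d')) * w|
    <= e * (w + h) * w.
  apply: sint_approx => //; first by apply: cts_onB; exact: H1.
  move=> t tP; have [+ _] := bound t _ tP cP; have [+ _] := bound t _ tP dP.
  by rewrite !ler_norml => /andP[? ?] /andP[? ?]; apply/andP; split; lra.
have B2 : `|sint (fun s => Q b' s - Q a' s) c' d' - (m * (b' - a')) * h|
    <= e * (w + h) * h.
  apply: sint_approx => //; first by apply: cts_onB; exact: H2.
  move=> s sP; have [_ +] := bound _ s bP sP; have [_ +] := bound _ s aP sP.
  by rewrite !ler_norml => /andP[? ?] /andP[? ?]; apply/andP; split; lra.
have -> : e * (w + h) ^+ 2 = e * (w + h) * w + e * (w + h) * h by ring.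
apply: le_trans (lerD B1 B2); apply: le_trans (ler_normD _ _).
rewrite le_eqVlt; apply/orP; left; apply/eqP; congr (`|_|).
by rewrite /circ /w /h; ring.
Qed.

Lemma geo_small (w r : R) : 0 <= w -> 0 < r ->
  exists k0, forall k, (k0 <= k)%N -> w * 2^-1 ^+ k < r.
Proof.
move=> w0 r0.
have : (fun k => w * 2^-1 ^+ k) @ \oo --> w * 0.
  by apply: cvgM; [exact: cvg_cst|apply: cvg_expr; rewrite gtr0_norm ?invf_lt1 ?ltr1n].
rewrite mulr0 => /cvgrPdist_lt /(_ r r0) [k0 _ H]; exists k0 => k /H /=.
by rewrite sub0r normrN; apply: le_lt_trans; exact: ler_norm.
Qed.

(** Quadrisection: some quarter of each rectangle carries at least a quarter of its circulation. At
    the common point of the nested rectangles the quadratic bound of [circ_small] compensates the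
    factor [4 ^+ k] exactly, up to an arbitrarily small constant. *)
Theorem goursat P Q a b c d : a <= b -> c <= d -> closed_on P Q a b c d ->
  circ P Q a b c d = 0.
Proof.
move=> ab cd H; apply/eqP; rewrite -normr_eq0; apply/eqP.
set del := `|circ P Q a b c d|.
apply/eqP; rewrite eq_le normr_ge0 andbT; apply/ler_addgt0Pr => eps eps0.
rewrite add0r.
pose w k := (b - a) * 2^-1 ^+ k; pose h k := (d - c) * 2^-1 ^+ k.
have w0 k : 0 <= w k by rewrite mulr_ge0 ?subr_ge0 ?exprn_ge0 ?invr_ge0.
have h0 k : 0 <= h k by rewrite mulr_ge0 ?subr_ge0 ?exprn_ge0 ?invr_ge0.
have wS k : w k = w k.+1 + w k.+1 by rewrite /w exprS; field.
have hS k : h k = h k.+1 + h k.+1 by rewrite /h exprS; field.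
(* The rectangle of stage [k] is given by its lower left corner [p]; its sides are those of the
   original one divided by [2 ^+ k]. *)
pose inv k (p : R * R) := [/\ a <= p.1, p.1 + w k <= b, c <= p.2, p.2 + h k <= d
  & del <= `|circ P Q p.1 (p.1 + w k) p.2 (p.2 + h k)| * 4 ^+ k].
(* The existential stands outside the implication, so that [choice] gives a selector defined for all
   [k] and [p]. *)
have step k p : exists p', inv k p ->
    [/\ inv k.+1 p', p.1 <= p'.1, p'.1 + w k.+1 <= p.1 + w k,
      p.2 <= p'.2 & p'.2 + h k.+1 <= p.2 + h k].
  have [ip|] := pselect (inv k p); last by exists p.
  case: p ip => x y /= [/= ax xb cy yd dk].
  have w1 := w0 k.+1; have h1 := h0 k.+1; have wk := wS k; have hk := hS k.
  pose x' := x + w k.+1; pose y' := y + h k.+1.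
  have xx : x + w k = x' + w k.+1 by rewrite wk addrA.
  have yy : y + h k = y' + h k.+1 by rewrite hk addrA.
  have x'P : x <= x' <= x' + w k.+1 by rewrite !lerDl w1.
  have y'P : y <= y' <= y' + h k.+1 by rewrite !lerDl h1.
  have sub u v u' v' : a <= u -> u' <= b -> c <= v -> v' <= d ->
    closed_on P Q u u' v v' by move=> *; exact: closed_on_sub H.
  have bb1 : x' <= b by rewrite /x'; lra.
  have bb2 : y' <= d by rewrite /y'; lra.
  have bb3 : a <= x' by rewrite /x'; lra.
  have bb4 : c <= y' by rewrite /y'; lra.
  have E : circ P Q x (x + w k) y (y + h k) =
      circ P Q x x' y y' + circ P Q x x' y' (y' + h k.+1) +
      (circ P Q x' (x' + w k.+1) y y' + circ P Q x' (x' + w k.+1) y' (y' + h k.+1)).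
    rewrite xx yy in xb yd *; have [cP cQ] := closed_on_bcts H.
    case/andP: (x'P) => xlx' x'w; case/andP: (y'P) => yly' y'w.
    have cP' v : y <= v <= y' + h k.+1 -> cts_on (fun u => P u v) x (x' + w k.+1).
      move=> /andP[v1 v2]; apply: cts_on_sub (cP v _) => //.
      by rewrite (le_trans cy v1) (le_trans v2).
    have cQ' u : x <= u <= x' + w k.+1 -> cts_on (fun v => Q u v) y (y' + h k.+1).
      move=> /andP[v1 v2]; apply: cts_on_sub (cQ u _) => //.
      by rewrite (le_trans ax v1) (le_trans v2).
    rewrite (circ_splitx x'P); first last.
    - by move=> u [] ->; apply: cQ'; rewrite ?lexx ?xlx' ?x'w ?(le_trans xlx').
    - by move=> v [] ->; apply: cP'; rewrite ?lexx ?yly' ?y'w ?(le_trans yly').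
    rewrite !(circ_splity y'P)//.
    - move=> v vP; apply: (@cts_on_sub _ _ x (x' + w k.+1)) => //; apply: cP'.
      by case: vP => ->; rewrite ?lexx ?yly' ?y'w ?(le_trans yly').
    - by move=> u [] ->; apply: cQ'; rewrite ?lexx ?xlx' ?x'w ?(le_trans xlx').
    - move=> v vP; apply: (@cts_on_sub _ _ x (x' + w k.+1)) => //; apply: cP'.
      by case: vP => ->; rewrite ?lexx ?yly' ?y'w ?(le_trans yly').
    - by move=> u [] ->; apply: cQ'; rewrite ?lexx ?xlx' ?x'w ?(le_trans xlx').
  set A1 := circ P Q x x' y y' in E; set A2 := circ P Q x x' y' _ in E.
  set A3 := circ P Q x' _ y y' in E; set A4 := circ P Q x' _ y' _ in E.
  have : [|| del <= `|A1| * 4 ^+ k.+1, del <= `|A2| * 4 ^+ k.+1,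
    del <= `|A3| * 4 ^+ k.+1 | del <= `|A4| * 4 ^+ k.+1].
    apply/negPn/negP; rewrite !negb_or -!ltNge => /and4P[B1 B2 B3 B4].
    have : del <= (`|A1| + `|A2| + (`|A3| + `|A4|)) * 4 ^+ k.
      apply: (le_trans dk); rewrite ler_wpM2r ?exprn_ge0// E.
      by apply: le_trans (ler_normD _ _) (lerD (ler_normD _ _) (ler_normD _ _)).
    move: B1 B2 B3 B4; rewrite !exprS; set F := 4 ^+ k.
    set a1 := `|A1|; set a2 := `|A2|; set a3 := `|A3|; set a4 := `|A4|; lra.
  have xb' : x' + w k.+1 <= b by rewrite -xx.
  have yd' : y' + h k.+1 <= d by rewrite -yy.
  have xw : x + w k.+1 <= x + w k by rewrite lerD2l wk lerDl.
  have yw : y + h k.+1 <= y + h k by rewrite lerD2l hk lerDl.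
  have xwb := le_trans xw xb; have ywd := le_trans yw yd.
  have xx' : x' + w k.+1 <= x + w k by rewrite xx.
  have yy' : y' + h k.+1 <= y + h k by rewrite yy.
  have xlx' : x <= x' by rewrite lerDl.
  have yly' : y <= y' by rewrite lerDl.
  move=> /or4P[] B; [exists (x, y)|exists (x, y')|exists (x', y)|exists (x', y')];
    by move=> _; rewrite /inv /= ?lexx; split => //; split.
have [f fP] := choice (fun kp : nat * (R * R) => step kp.1 kp.2).
pose p := fix p k := if k is k'.+1 then f (k', p k') else (a, c).
have ip k : inv k (p k).
  elim: k => [|k IH]; last by have [] := fP (k, p k) IH.
  by rewrite /inv /w /h /= !expr0 !mulr1 !subrKC !lexx.
have mono k j : (p k).1 <= (p (k + j)%N).1 /\ (p (k + j)%N).1 + w (k + j)%N <= (p k).1 + w k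
   /\ (p k).2 <= (p (k + j)%N).2 /\ (p (k + j)%N).2 + h (k + j)%N <= (p k).2 + h k.
  elim: j => [|j [h1 [h2 [h3 h4]]]]; first by rewrite addn0 !lexx.
  have [_ g1 g2 g3 g4] := fP (k + j, p (k + j))%N (ip _); rewrite addnS /=.
  rewrite (le_trans h1 g1) (le_trans g2 h2) (le_trans h3 g3).
  by split => //; split => //; split => //; exact: (le_trans g4 h4).
have cross1 k j : (p j).1 <= (p k).1 + w k.
  have [kj|/ltnW jk] := leqP k j.
    have [_ [+ _]] := mono k (j - k)%N; rewrite subnKC// => {}H1.
    by apply: le_trans H1; rewrite lerDl.
  have [+ _] := mono j (k - j)%N; rewrite subnKC// => {}H1.
  by apply: le_trans H1 _; rewrite lerDl.
have cross2 k j : (p j).2 <= (p k).2 + h k.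
  have [kj|/ltnW jk] := leqP k j.
    have [_ [_ [_ +]]] := mono k (j - k)%N; rewrite subnKC// => {}H1.
    by apply: le_trans H1; rewrite lerDl.
  have [_ [_ [+ _]]] := mono j (k - j)%N; rewrite subnKC// => {}H1.
  by apply: le_trans H1 _; rewrite lerDl.
(* The common point of the nested rectangles has as coordinates the suprema of the coordinates of
   the lower left corners; [cross1] and [cross2] bound them by the right and upper sides of every
   stage. *)
pose X := range (fun k => (p k).1); pose Y := range (fun k => (p k).2).
have Xs k : (p k).1 <= sup X <= (p k).1 + w k.
  apply/andP; split.
    apply: ub_le_sup; last by exists k.
    by exists ((p k).1 + w k) => _ [j _ <-]; exact: cross1.
  apply: ge_sup; first by exists (p 0).1; exists 0%N.
  by move=> _ [j _ <-]; exact: cross1.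
have Ys k : (p k).2 <= sup Y <= (p k).2 + h k.
  apply/andP; split.
    apply: ub_le_sup; last by exists k.
    by exists ((p k).2 + h k) => _ [j _ <-]; exact: cross2.
  apply: ge_sup; first by exists (p 0).2; exists 0%N.
  by move=> _ [j _ <-]; exact: cross2.
have Xab : a <= sup X <= b.
  by have := Xs 0%N; rewrite /w /= expr0 mulr1 subrKC.
have Ycd : c <= sup Y <= d.
  by have := Ys 0%N; rewrite /h /= expr0 mulr1 subrKC.
set K := ((b - a) + (d - c)) ^+ 2.
have K0 : 0 <= K by rewrite sqr_ge0.
(* [K] is the square of the half perimeter at stage [0]. At stage [k] it has shrunk by [4 ^+ k], so
   the final bound is [eps * K / (K + 1)]; adding [1] covers the degenerate rectangle with
   [K = 0]. *)
have e0 : 0 < eps / (K + 1) by rewrite divr_gt0// ltr_pwDr.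
have [r r0 rP] := circ_small Xab Ycd H e0.
have ba0 : 0 <= b - a by rewrite subr_ge0.
have dc0 : 0 <= d - c by rewrite subr_ge0.
have [k1 k1P] := geo_small ba0 r0; have [k2 k2P] := geo_small dc0 r0.
pose k := maxn k1 k2.
have [i1 i2 i3 i4 i5] := ip k.
have wr : (p k).1 + w k - (p k).1 < r by rewrite addrC addKr; apply: k1P; rewrite leq_maxl.
have hr : (p k).2 + h k - (p k).2 < r by rewrite addrC addKr; apply: k2P; rewrite leq_maxr.
have := rP _ _ _ _ i1 i2 i3 i4 (Xs k) (Ys k) wr hr.
rewrite [X in X - _ + _]addrC addrK [X in _ + (X - _)]addrC addrK => B.
apply: (le_trans i5); apply: (@le_trans _ _ (eps / (K + 1) * (w k + h k) ^+ 2 * 4 ^+ k)).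
  by rewrite ler_wpM2r ?exprn_ge0.
have -> : eps / (K + 1) * (w k + h k) ^+ 2 * 4 ^+ k = eps / (K + 1) * K.
  have -> : w k + h k = (b - a + (d - c)) * 2^-1 ^+ k by rewrite /w /h; ring.
  have E4 : (2^-1 ^+ k) ^+ 2 * 4 ^+ k = 1 :> R.
    rewrite -exprM mulnC exprM -exprMn.
    have -> : (2^-1 ^+ 2 * 4 : R) = 1 by field.
    by rewrite expr1n.
  by rewrite -[LHS]mulrA exprMn -[X in _ * X]mulrA E4 mulr1.
rewrite mulrAC ler_pdivrMr ?ltr_pwDr// ler_pM2l// lerDl//.
Qed.

End Goursat.

(** * Cauchy's formula on rectangles *)

Section Cauchy.
Variable R : realType.
Implicit Types (f g : cplx R -> cplx R) (a b c d : R) (z w : cplx R).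

Lemma circ_bound (P Q : R -> R -> R) a b c d (M : R) : a <= b -> c <= d ->
  (forall y, y = c \/ y = d -> cts_on (fun x => P x y) a b) ->
  (forall x, x = a \/ x = b -> cts_on (fun y => Q x y) c d) ->
  (forall x y, a <= x <= b -> y = c \/ y = d -> `|P x y| <= M) ->
  (forall x y, x = a \/ x = b -> c <= y <= d -> `|Q x y| <= M) ->
  `|circ P Q a b c d| <= 2 * M * ((b - a) + (d - c)).
Proof.
move=> ab cd cP cQ PM QM; rewrite /circ mulrDr.
apply: le_trans (ler_normD _ _) _; apply: lerD; apply: sint_bound => //.
- by apply: cts_onB; apply: cP; [left|right].
- move=> x xP; apply: le_trans (ler_normB _ _) _.
  by rewrite mulr2n mulrDl mul1r lerD// PM//; [left|right].
- by apply: cts_onB; apply: cQ; [right|left].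
- move=> y yP; apply: le_trans (ler_normB _ _) _.
  by rewrite mulr2n mulrDl mul1r lerD// QM//; [right|left].
Qed.

(** Two vertical cuts and then two horizontal ones peel off four rectangles avoiding [(x0, y0)],
    each without circulation by [goursat]. Nothing is assumed at [(x0, y0)] itself. *)
Lemma circ_hole (P Q : R -> R -> R) a b c d x0 y0 s : 0 < s ->
  a <= x0 - s -> x0 + s <= b -> c <= y0 - s -> y0 + s <= d ->
  (forall x y, a <= x <= b -> c <= y <= d -> (x, y) != (x0, y0) ->
     closed_at P Q x y) ->
  circ P Q a b c d = circ P Q (x0 - s) (x0 + s) (y0 - s) (y0 + s).
Proof.
move=> s0 ax xb cy yd H.
have ss : x0 - s <= x0 + s by lra.
have ss' : y0 - s <= y0 + s by lra.
have ab := le_trans ax (le_trans ss xb); have cd := le_trans cy (le_trans ss' yd).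
have P1 u u' v : a <= u -> u' <= b -> c <= v <= d -> v != y0 ->
    cts_on (fun x => P x v) u u'.
  move=> au ub vP vy x /andP[x1 x2]; apply: (@closed_at_ctsP1 _ _ Q).
  apply: H => //; first by rewrite (le_trans au) ?(le_trans x2).
  by rewrite xpair_eqE negb_and vy orbT.
have Q1 v v' u : c <= v -> v' <= d -> a <= u <= b -> u != x0 ->
    cts_on (fun y => Q u y) v v'.
  move=> cv vd uP ux y /andP[y1 y2]; apply: (@closed_at_ctsQ2 _ P).
  apply: H => //; first by rewrite (le_trans cv) ?(le_trans y2).
  by rewrite xpair_eqE negb_and ux.
have G u u' v v' : a <= u -> u <= u' -> u' <= b -> c <= v -> v <= v' -> v' <= d ->
    [|| u' < x0, x0 < u, v' < y0 | y0 < v] -> circ P Q u u' v v' = 0.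
  move=> au uu ub cv vv vd oor; apply: goursat => // x y /andP[x1 x2] /andP[y1 y2].
  apply: H; rewrite ?(le_trans au) ?(le_trans x2) ?(le_trans cv) ?(le_trans y2)//.
  rewrite xpair_eqE; apply/negP => /andP[/eqP xE /eqP yE]; move: oor.
  by rewrite !ltNge -xE -yE x1 x2 y1 y2.
have yc : c != y0 by apply/eqP; lra.
have yd' : d != y0 by apply/eqP; lra.
have x1n : x0 - s != x0 by apply/eqP; lra.
have x2n : x0 + s != x0 by apply/eqP; lra.
have y1n : y0 - s != y0 by apply/eqP; lra.
have y2n : y0 + s != y0 by apply/eqP; lra.
have an : a != x0 by apply/eqP; lra.
have bn : b != x0 by apply/eqP; lra.
have I1 : x0 - s <= x0 + s <= b by rewrite ss.
have I2 : a <= x0 - s <= b by rewrite ax (le_trans ss).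
have J1 : y0 - s <= y0 + s <= d by rewrite ss'.
have J2 : c <= y0 - s <= d by rewrite cy (le_trans ss').
have cC : c <= c <= d by rewrite lexx.
have dD : c <= d <= d by rewrite lexx cd.
have aA : a <= a <= b by rewrite lexx.
have bB : a <= b <= b by rewrite lexx ab.
have x2B : a <= x0 + s <= b by rewrite xb (le_trans ax).
have y2D : c <= y0 + s <= d by rewrite yd (le_trans cy).
have o1 : x0 - s < x0 by lra.
have o2 : x0 < x0 + s by lra.
have o3 : y0 - s < y0 by lra.
have o4 : y0 < y0 + s by lra.
have /andP[_ xs1] := I2; have /andP[_ ys1] := J2.
have /andP[xs2 _] := x2B; have /andP[ys2 _] := y2D.
rewrite (circ_splitx I2); first last.
- by move=> x [] ->; apply: Q1.
- by move=> y [] ->; apply: P1.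
rewrite (@G a (x0 - s) c d) ?o1// add0r (circ_splitx I1); first last.
- by move=> x [] ->; apply: Q1.
- by move=> y [] ->; apply: P1.
rewrite (@G (x0 + s) b c d) ?o2 ?orbT// addr0 (circ_splity J2); first last.
- by move=> x [] ->; apply: Q1.
- by move=> y [] ->; apply: P1.
rewrite (@G _ _ c (y0 - s)) ?o3 ?orbT// add0r (circ_splity J1); first last.
- by move=> x [] ->; apply: Q1.
- by move=> y [] ->; apply: P1.
by rewrite (@G _ _ (y0 + s) d) ?o4 ?orbT// addr0.
Qed.

Definition pint (p : R -> cplx R) a b : cplx R :=
  mkc (sint (fun t => cre (p t)) a b) (sint (fun t => cim (p t)) a b).

Definition ccts_on (p : R -> cplx R) a b :=
  cts_on (fun t => cre (p t)) a b /\ cts_on (fun t => cim (p t)) a b.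

Lemma pintD (p q : R -> cplx R) a b : ccts_on p a b -> ccts_on q a b ->
  pint (fun t => p t + q t) a b = pint p a b + pint q a b.
Proof.
move=> [p1 p2] [q1 q2]; rewrite /pint mkcD -!sintD//.
by congr mkc; apply: eq_sint => t _; rewrite cplxE.
Qed.

Lemma ccts_onZ (k : cplx R) (p : R -> cplx R) a b : ccts_on p a b ->
  ccts_on (fun t => k * p t) a b.
Proof.
move=> [p1 p2]; split.
  under eq_fun do rewrite creM.
  by apply: cts_onB; apply: cts_onM => //; exact: cts_on_cst.
under eq_fun do rewrite cimM.
by apply: cts_onD; apply: cts_onM => //; exact: cts_on_cst.
Qed.

Lemma pintZ (k : cplx R) (p : R -> cplx R) a b : ccts_on p a b ->
  pint (fun t => k * p t) a b = k * pint p a b.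
Proof.
move=> [p1 p2]; apply: cplxP; rewrite !cplxE.
  rewrite -!sintZ// -sintB; try exact: (cts_onM (@cts_on_cst _ _ _ _)).
  by apply: eq_sint => t _; rewrite cplxE.
rewrite -!sintZ// -sintD; try exact: (cts_onM (@cts_on_cst _ _ _ _)).
by apply: eq_sint => t _; rewrite cplxE.
Qed.

(** Cauchy-Schwarz against the constant [1]: integrate [(phi t - m) ^+ 2 >= 0], where [m] is the
    mean of [phi]. *)
Lemma sint_sqr (phi : R -> R) a b : a < b -> cts_on phi a b ->
  sint phi a b ^+ 2 <= (b - a) * sint (fun t => phi t ^+ 2) a b.
Proof.
move=> ab cp; have ba : 0 < b - a by rewrite subr_gt0.
set m := sint phi a b / (b - a).
have c2 : cts_on (fun t => phi t ^+ 2) a b by exact: cts_onM.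
have c3 : cts_on (fun t => (2 * m) * phi t - m ^+ 2) a b.
  by apply: cts_onB (@cts_on_cst _ _ _ _); apply: cts_onM => //; exact: cts_on_cst.
have : sint (fun t => (2 * m) * phi t - m ^+ 2) a b <= sint (fun t => phi t ^+ 2) a b.
  by apply: le_sint => // t _; have := sqr_ge0 (phi t - m); rewrite sqrrB; lra.
rewrite sintB; [|by apply: cts_onM => //; exact: cts_on_cst|exact: cts_on_cst].
rewrite sintZ// (sint_cst _ (ltW ab)).
have -> : sint phi a b = m * (b - a) by rewrite divfK// gt_eqF.
move=> H; have -> : (m * (b - a)) ^+ 2 = (b - a) * (2 * m * (m * (b - a)) - m ^+ 2 * (b - a)).
  by ring.
by rewrite ler_pM2l.
Qed.

Lemma pint_sqr (p : R -> cplx R) a b : a < b -> ccts_on p a b ->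
  cmod (pint p a b) ^+ 2 <= (b - a) * sint (fun t => cmod (p t) ^+ 2) a b.
Proof.
move=> ab [p1 p2]; rewrite sqr_cmod !cplxE.
apply: (@le_trans _ _ ((b - a) * sint (fun t => cre (p t) ^+ 2) a b +
  (b - a) * sint (fun t => cim (p t) ^+ 2) a b)); first by rewrite lerD ?sint_sqr.
rewrite -mulrDr -sintD; [|exact: cts_onM|exact: cts_onM].
by rewrite (@eq_sint _ _ (fun t => cmod (p t) ^+ 2))// => t _; rewrite sqr_cmod.
Qed.

(** The integral of [f dz] counterclockwise along the boundary of the rectangle; the factor [ci R]
    comes from [dz = i dy] on the vertical sides. *)
Definition ccirc f a b c d : cplx R :=
  pint (fun x => f (mkc x c)) a b - pint (fun x => f (mkc x d)) a b +
  ci R * (pint (fun y => f (mkc b y)) c d - pint (fun y => f (mkc a y)) c d).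

Definition on_bd f a b c d :=
  (forall y, y = c \/ y = d -> ccts_on (fun x => f (mkc x y)) a b) /\
  (forall x, x = a \/ x = b -> ccts_on (fun y => f (mkc x y)) c d).

Lemma ccircD f g a b c d : on_bd f a b c d -> on_bd g a b c d ->
  ccirc (fun z => f z + g z) a b c d = ccirc f a b c d + ccirc g a b c d.
Proof.
move=> [f1 f2] [g1 g2]; rewrite /ccirc.
have e1 := f1 c (or_introl erefl); have e2 := f1 d (or_intror erefl).
have e3 := f2 a (or_introl erefl); have e4 := f2 b (or_intror erefl).
have h1 := g1 c (or_introl erefl); have h2 := g1 d (or_intror erefl).
have h3 := g2 a (or_introl erefl); have h4 := g2 b (or_intror erefl).
by rewrite (pintD e1 h1) (pintD e2 h2) (pintD e3 h3) (pintD e4 h4); ring.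
Qed.

Lemma ccircZ k f a b c d : on_bd f a b c d ->
  ccirc (fun z => k * f z) a b c d = k * ccirc f a b c d.
Proof.
move=> [f1 f2]; rewrite /ccirc.
have e1 := f1 c (or_introl erefl); have e2 := f1 d (or_intror erefl).
have e3 := f2 a (or_introl erefl); have e4 := f2 b (or_intror erefl).
by rewrite (pintZ k e1) (pintZ k e2) (pintZ k e3) (pintZ k e4); ring.
Qed.

Lemma on_bdZ k f a b c d : on_bd f a b c d -> on_bd (fun z => k * f z) a b c d.
Proof.
by move=> [f1 f2]; split=> t /[dup] tP; [move/f1|move/f2] => h; exact: ccts_onZ h.
Qed.

Definition u_of f x y : R := cre (f (mkc x y)).
Definition v_of f x y : R := cim (f (mkc x y)).

(** With [f = u + i v], the form [f dz] is [(u dx - v dy) + i (v dx + u dy)]. *)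
Lemma circ_re f a b c d : on_bd f a b c d ->
  cre (ccirc f a b c d) = circ (u_of f) (fun x y => - v_of f x y) a b c d.
Proof.
move=> [f1 f2]; rewrite /ccirc /circ !cplxE mul0r mul1r sub0r.
have [e1 _] := f1 c (or_introl erefl); have [e2 _] := f1 d (or_intror erefl).
have [_ e3] := f2 a (or_introl erefl); have [_ e4] := f2 b (or_intror erefl).
rewrite -(sintB e1 e2) -(sintB e4 e3); congr (_ + _).
rewrite -mulN1r -sintZ; last exact: cts_onB.
by apply: eq_sint => t _; rewrite /v_of; ring.
Qed.

Lemma circ_im f a b c d : on_bd f a b c d ->
  cim (ccirc f a b c d) = circ (v_of f) (u_of f) a b c d.
Proof.
move=> [f1 f2]; rewrite /ccirc /circ !cplxE mul0r mul1r add0r.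
have [_ e1] := f1 c (or_introl erefl); have [_ e2] := f1 d (or_intror erefl).
have [e3 _] := f2 a (or_introl erefl); have [e4 _] := f2 b (or_intror erefl).
by rewrite -(sintB e1 e2) -(sintB e4 e3).
Qed.

Definition cdiff f z := exists l : cplx R, forall e : R, 0 < e ->
  exists2 r : R, 0 < r &
    forall h, cmod h < r -> cmod (f (z + h) - f z - l * h) <= e * cmod h.

Lemma cdiff_ccts f z : cdiff f z -> forall e : R, 0 < e ->
  exists2 r : R, 0 < r & forall h, cmod h < r -> cmod (f (z + h) - f z) < e.
Proof.
move=> [l H] e e0; have [r r0 rP] := H 1 ltr01.
have l0 : 0 < cmod l + 1 by rewrite ltr_pwDr// cmod_ge0.
exists (Num.min r (e / (cmod l + 1))); first by rewrite lt_min r0 divr_gt0.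
move=> h; rewrite lt_min ltr_pdivlMr// => /andP[/rP h1 h2].
apply: le_lt_trans h2; rewrite -[f _ - _](subrK (l * h)).
apply: le_trans (cmodD _ _) _; rewrite cmodM mulrDr mulr1 addrC.
by rewrite [cmod h * _]mulrC lerD// (le_trans h1)// mul1r.
Qed.

(** The Cauchy-Riemann equations: if [l] is the derivative, the mixed coefficient is [- cim l] for
    both components of [u dx - v dy] and [cre l] for both components of [v dx + u dy]. *)
Lemma cdiff_closed f x y : cdiff f (mkc x y) ->
  closed_at (u_of f) (fun x y => - v_of f x y) x y /\ closed_at (v_of f) (u_of f) x y.
Proof.
move=> [l H].
have K (e : R) : 0 < e -> exists2 r : R, 0 < r & forall x' y',
   `|x' - x| < r -> `|y' - y| < r ->
   `|u_of f x' y' - u_of f x y - cre l * (x' - x) + cim l * (y' - y)|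
      <= e * (`|x' - x| + `|y' - y|) /\
   `|v_of f x' y' - v_of f x y - cim l * (x' - x) - cre l * (y' - y)|
      <= e * (`|x' - x| + `|y' - y|).
  move=> e0; have [r r0 rP] := H e e0.
  exists (r / 2); first by rewrite divr_gt0.
  move=> x' y' hx hy; have := rP (mkc (x' - x) (y' - y)).
  have le1 := cmod_le (mkc (x' - x) (y' - y)); rewrite !cplxE in le1.
  have lt1 : cmod (mkc (x' - x) (y' - y)) < r.
    by apply: (le_lt_trans le1); rewrite [r]splitr ltrD.
  move=> /(_ lt1); rewrite mkcD !subrKC => h.
  have {h le1}h := le_trans h (ler_wpM2l (ltW e0) le1).
  split; apply: le_trans h; [apply: le_trans (ler_cre _)|apply: le_trans (ler_cim _)];
    rewrite le_eqVlt; apply/orP; left; apply/eqP; congr (`|_|);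
    by rewrite /u_of /v_of !cplxE; ring.
split.
  exists (cre l), (- cim l), (- cre l) => e /K[r r0 rP]; exists r => // x' y' hx hy.
  have [h1 h2] := rP _ _ hx hy; split.
    by rewrite mulNr opprK.
  rewrite -normrN; apply: le_trans h2; rewrite le_eqVlt; apply/orP; left; apply/eqP.
  by congr (`|_|); ring.
exists (cim l), (cre l), (- cim l) => e /K[r r0 rP]; exists r => // x' y' hx hy.
by have [h1 h2] := rP _ _ hx hy; rewrite mulNr opprK.
Qed.

Lemma cdiff_on_bd f a b c d : a <= b -> c <= d ->
  (forall x y, a <= x <= b -> c <= y <= d ->
     [\/ x = a, x = b | y = c \/ y = d] -> cdiff f (mkc x y)) ->
  on_bd f a b c d.
Proof.
move=> ab cd H.
have A x y : cdiff f (mkc x y) ->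
    {for x, continuous (u_of f ^~ y)} /\ {for x, continuous (v_of f ^~ y)}.
  by move=> /cdiff_closed[h1 h2]; split; [exact: closed_at_ctsP1 h1|
    exact: closed_at_ctsP1 h2].
have B x y : cdiff f (mkc x y) ->
    {for y, continuous (u_of f x)} /\ {for y, continuous (v_of f x)}.
  move=> /cdiff_closed[h1 h2]; split; first exact: closed_at_ctsQ2 h2.
  have h3 := closed_at_ctsQ2 h1.
  have -> : v_of f x = (fun y => - (- v_of f x y)).
    by apply/funext => t; rewrite opprK.
  exact: cvgN.
split=> t tP; split=> s sP.
- by apply: (A s t _).1; apply: H => //; [case: tP => ->; rewrite lexx ?cd|constructor 3].
- by apply: (A s t _).2; apply: H => //; [case: tP => ->; rewrite lexx ?cd|constructor 3].
- by apply: (B t s _).1; apply: H => //; [case: tP => ->; rewrite lexx ?ab|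
    case: tP => ->; [constructor 1|constructor 2]].
- by apply: (B t s _).2; apply: H => //; [case: tP => ->; rewrite lexx ?ab|
    case: tP => ->; [constructor 1|constructor 2]].
Qed.

End Cauchy.

Section CauchyFormula.
Variable R : realType.
Implicit Types (f g : cplx R -> cplx R) (a b c d : R) (z w : cplx R).

Definition rect a b c d : set (cplx R) :=
  [set z | a <= cre z <= b /\ c <= cim z <= d].

Lemma cdiff_cst (k z : cplx R) : cdiff (fun=> k) z.
Proof.
exists 0 => e e0; exists 1 => // h _.
by rewrite mul0r subrr subr0 cmod0 mulr_ge0 ?cmod_ge0// ltW.
Qed.

Lemma cdiff_subc g k z : cdiff g z -> cdiff (fun z => g z - k) z.
Proof.
move=> [l H]; exists l => e /H[r r0 rP]; exists r => // h /rP.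
by rewrite opprB addrA subrK.
Qed.

Lemma cdiff_pole g w z : cdiff g z -> z != w -> cdiff (fun z => g z / (z - w)) z.
Proof.
move=> [l H] zw; set u := z - w; have u0 : u != 0 by rewrite subr_eq0.
have m0 : 0 < cmod u by rewrite cmod_gt0.
set G := g z; exists (l / u - G / u ^+ 2) => e e0.
set B := cmod l / cmod u + cmod G / cmod u ^+ 2.
have B0 : 0 <= B by rewrite addr_ge0// divr_ge0 ?exprn_ge0 ?cmod_ge0.
have q0 : 0 < e * cmod u / 4 by rewrite divr_gt0// mulr_gt0.
have [r r0 rP] := H _ q0.
(* The three bounds on [h] control the remainder of [g], keep [z + h] at distance at least
   [cmod u / 2] from the pole, and make the term in [h ^+ 2] small. *)
exists (Num.min r (Num.min (cmod u / 2) (e * cmod u / 4 / (B + 1)))).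
  by rewrite !lt_min r0 !divr_gt0 ?ltr_pwDr ?mulr_gt0.
move=> h; rewrite !lt_min => /and3P[/rP]; rewrite -/G.
set rho := _ - l * h => hr hu; rewrite ltr_pdivlMr ?ltr_pwDr// => hB.
have u'm : cmod u / 2 <= cmod (u + h).
  have := cmodD (u + h) (- h); rewrite addrK cmodN; lra.
have u'0 : u + h != 0 by rewrite -cmod_gt0 (lt_le_trans _ u'm)// divr_gt0.
have -> : g (z + h) / (z + h - w) - G / u - (l / u - G / u ^+ 2) * h =
    (rho + h ^+ 2 * (- (l / u) + G / u ^+ 2)) / (u + h).
  have -> : z + h - w = u + h by rewrite /u addrAC.
  have -> : g (z + h) = rho + l * h + G by rewrite /rho; ring.
  by field; rewrite u0 u'0.
rewrite cmodM cmodV ler_pdivrMr ?(lt_le_trans _ u'm) ?divr_gt0//.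
apply: (@le_trans _ _ (e * cmod h * (cmod u / 2))); last first.
  by rewrite ler_wpM2l// mulr_ge0 ?cmod_ge0// ltW.
apply: le_trans (cmodD _ _) _; rewrite cmodM cmodX.
have hb : cmod (- (l / u) + G / u ^+ 2) <= B.
  by apply: le_trans (cmodD _ _) _; rewrite cmodN !cmodM !cmodV cmodX.
have h2 : cmod h ^+ 2 * cmod (- (l / u) + G / u ^+ 2) <= cmod h * (e * cmod u / 4).
  rewrite expr2 -mulrA ler_wpM2l ?cmod_ge0//; apply: (@le_trans _ _ (cmod h * B)).
    by rewrite ler_wpM2l ?cmod_ge0.
  by apply: le_trans (ltW hB); rewrite ler_wpM2l ?cmod_ge0// lerDl.
apply: (le_trans (lerD hr h2)); rewrite le_eqVlt; apply/orP; left; apply/eqP.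
by field.
Qed.

Lemma ccirc_hole f a b c d x0 y0 s : 0 < s ->
  a <= x0 - s -> x0 + s <= b -> c <= y0 - s -> y0 + s <= d ->
  (forall z, rect a b c d z -> z != mkc x0 y0 -> cdiff f z) ->
  ccirc f a b c d = ccirc f (x0 - s) (x0 + s) (y0 - s) (y0 + s).
Proof.
move=> s0 ax xb cy yd H.
have D x y : a <= x <= b -> c <= y <= d -> (x != x0) || (y != y0) ->
    cdiff f (mkc x y).
  move=> xP yP ne; apply: H => //; apply/eqP => /[dup] /(congr1 (@cre R)) xE.
  move=> /(congr1 (@cim R)) yE; rewrite !creK in xE; rewrite !cimK in yE.
  by rewrite xE yE !eqxx in ne.
have B : on_bd f a b c d.
  apply: cdiff_on_bd; [lra|lra|move=> x y xP yP bd]; apply: D => //.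
  by case: bd => [->|->|[->|->]]; apply/orP;
    [left|left|right|right]; apply/eqP; lra.
have B' : on_bd f (x0 - s) (x0 + s) (y0 - s) (y0 + s).
  apply: cdiff_on_bd; [lra|lra|move=> x y /andP[? ?] /andP[? ?] bd].
  apply: D => //; [by apply/andP; split; lra|by apply/andP; split; lra|].
  by case: bd => [->|->|[->|->]]; apply/orP;
    [left|left|right|right]; apply/eqP; lra.
apply: cplxP; [rewrite (circ_re B) (circ_re B')|rewrite (circ_im B) (circ_im B')];
  apply: circ_hole => // x y xP yP; rewrite xpair_eqE negb_and => /(D _ _ xP yP);
  by case/cdiff_closed.
Qed.

Lemma ccirc_le f a b c d (M : R) : a <= b -> c <= d -> on_bd f a b c d ->
  (forall x y, a <= x <= b -> c <= y <= d ->
     [\/ x = a, x = b | y = c \/ y = d] -> cmod (f (mkc x y)) <= M) ->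
  cmod (ccirc f a b c d) <= 4 * M * ((b - a) + (d - c)).
Proof.
move=> ab cd B H.
have U x y : a <= x <= b -> c <= y <= d -> [\/ x = a, x = b | y = c \/ y = d] ->
    `|u_of f x y| <= M /\ `|v_of f x y| <= M.
  move=> xP yP h; have := H _ _ xP yP h.
  by split; [apply: le_trans (ler_cre _) _|apply: le_trans (ler_cim _) _].
have [B1 B2] := B.
have -> : 4 * M * (b - a + (d - c)) = 2 * M * (b - a + (d - c)) + 2 * M * (b - a + (d - c)).
  by ring.
apply: le_trans (cmod_le _) _; rewrite (circ_re B) (circ_im B).
have aA : a <= a <= b by rewrite lexx.
have bB : a <= b <= b by rewrite lexx ab.
have cC : c <= c <= d by rewrite lexx.
have dD : c <= d <= d by rewrite lexx cd.
apply: lerD; apply: circ_bound => //.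
- by move=> y /B1[].
- by move=> x /B2[_ h] t /h; exact: cvgN.
- by move=> x y xP yP; apply: (U x y _ _ _).1 => //; [case: yP => ->|constructor 3].
- move=> x y xP yP; rewrite normrN; apply: (U x y _ _ _).2 => //; first by case: xP => ->.
  by case: xP => ->; [constructor 1|constructor 2].
- by move=> y /B1[].
- by move=> x /B2[].
- by move=> x y xP yP; apply: (U x y _ _ _).2 => //; [case: yP => ->|constructor 3].
- move=> x y xP yP; apply: (U x y _ _ _).1 => //; first by case: xP => ->.
  by case: xP => ->; [constructor 1|constructor 2].
Qed.

Lemma cmod_bd (x y x0 y0 s : R) : 0 < s ->
  [\/ x = x0 - s, x = x0 + s | y = y0 - s \/ y = y0 + s] ->
  s <= cmod (mkc x y - mkc x0 y0).
Proof.
move=> s0 bd.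
have [h|h] : `|x - x0| = s \/ `|y - y0| = s.
- case: bd => [->|->|[->|->]]; [left|left|right|right].
  + by rewrite addrAC subrr sub0r normrN gtr0_norm.
  + by rewrite addrAC subrr add0r gtr0_norm.
  + by rewrite addrAC subrr sub0r normrN gtr0_norm.
  + by rewrite addrAC subrr add0r gtr0_norm.
- by rewrite -[leLHS]h; exact: (ler_cre (mkc x y - mkc x0 y0)).
- by rewrite -[leLHS]h; exact: (ler_cim (mkc x y - mkc x0 y0)).
Qed.

Lemma small_eps0 (x C : R) : 0 < C -> (forall e, 0 < e -> x <= C * e) -> x <= 0.
Proof.
move=> C0 H; apply/ler_addgt0Pr => e e0; rewrite add0r.
by have := H _ (divr_gt0 e0 C0); rewrite mulrC divfK// gt_eqF.
Qed.

Lemma cmod_le0 z : cmod z <= 0 -> z = 0.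
Proof. by rewrite le_eqVlt ltNge cmod_ge0 orbF cmod_eq0 => /eqP. Qed.

Section Formula.
Variables (g : cplx R -> cplx R) (a b c d x0 y0 : R).
Hypotheses (ax : a < x0) (xb : x0 < b) (cy : c < y0) (yd : y0 < d).
Hypothesis dg : forall z, rect a b c d z -> cdiff g z.
Let w := mkc x0 y0.
Let bnds : [/\ a < x0, x0 < b, c < y0 & y0 < d]. Proof. by []. Qed.

Let onbd k : (forall z, rect a b c d z -> cdiff k z) ->
  on_bd (fun z => k z / (z - w)) a b c d.
Proof.
have [? ? ? ?] := bnds; move=> dk; apply: cdiff_on_bd; [lra|lra|move=> x y xP yP bd].
apply: cdiff_pole; first exact: dk.
apply/eqP => /[dup] /(congr1 (@cre R)) + /(congr1 (@cim R)); rewrite !cplxE => xE yE.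
by move: bd; rewrite xE yE => -[||[]]; lra.
Qed.

Lemma cauchy_diff : ccirc (fun z => (g z - g w) / (z - w)) a b c d = 0.
Proof.
have [? ? ? ?] := bnds; have wR : rect a b c d w by split; rewrite !cplxE; apply/andP; split; lra.
have dgw z : rect a b c d z -> cdiff (fun z => g z - g w) z.
  by move=> /dg; exact: cdiff_subc.
apply: cmod_le0; apply: (@small_eps0 _ 16) => // e e0.
have [r r0 rP] := cdiff_ccts (dg wR) e0.
pose s := Num.min (r / 4) (Num.min (Num.min (x0 - a) (b - x0)) (Num.min (y0 - c) (d - y0))).
have s0 : 0 < s by rewrite !lt_min !subr_gt0 ax xb cy yd divr_gt0.
have sr : s <= r / 4 by rewrite ge_min lexx.
have s1 : s <= x0 - a by rewrite !ge_min lexx !orbT.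
have s2 : s <= b - x0 by rewrite !ge_min lexx !orbT.
have s3 : s <= y0 - c by rewrite !ge_min lexx !orbT.
have s4 : s <= d - y0 by rewrite !ge_min lexx !orbT.
rewrite (@ccirc_hole _ _ _ _ _ x0 y0 s) //; [|lra|lra|lra|lra|]; last first.
  by move=> z zR zw; apply: cdiff_pole => //; exact: dgw.
have -> : 16 * e = 4 * (e / s) * ((x0 + s) - (x0 - s) + ((y0 + s) - (y0 - s))).
  by field; rewrite gt_eqF.
have sub x y : x0 - s <= x <= x0 + s -> y0 - s <= y <= y0 + s -> rect a b c d (mkc x y).
  by move=> /andP[? ?] /andP[? ?]; split; rewrite !cplxE; apply/andP; split; lra.
apply: ccirc_le; [lra|lra| |].
  apply: cdiff_on_bd; [lra|lra|move=> x y xP yP bd].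
  apply: cdiff_pole; first by apply: dgw; exact: sub.
  by rewrite -subr_eq0 -cmod_gt0 (lt_le_trans s0)// cmod_bd.
move=> x y xP yP bd; rewrite cmodM cmodV.
have sm := cmod_bd s0 bd.
have m0 : 0 < cmod (mkc x y - w) := lt_le_trans s0 sm.
rewrite ler_pdivrMr//; apply: (@le_trans _ _ (e / s * s)); last first.
  by rewrite ler_pM2l// divr_gt0.
rewrite divfK ?gt_eqF//; apply: ltW.
have := rP (mkc x y - w); rewrite (addrC w) subrK; apply.
apply: le_lt_trans (cmod_le _) _; rewrite !cplxE.
have h1 : `|x - x0| <= s.
  by move: xP => /andP[? ?]; rewrite ler_norml; apply/andP; split; lra.
have h2 : `|y - y0| <= s.
  by move: yP => /andP[? ?]; rewrite ler_norml; apply/andP; split; lra.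
by apply: le_lt_trans (lerD h1 h2) _; lra.
Qed.

(** The integral of [dz / (z - w)], classically [2 pi i]. It may stay an unknown factor depending on
    the rectangle and on [w]: the estimates only divide by its modulus, which [cK_ge] bounds
    below. *)
Definition cK : cplx R := ccirc (fun z => 1 / (z - w)) a b c d.

Lemma cauchy_formula : ccirc (fun z => g z / (z - w)) a b c d = g w * cK.
Proof.
have d1 z : rect a b c d z -> cdiff (fun=> 1 : cplx R) z.
  by move=> _; exact: cdiff_cst.
have dgw z : rect a b c d z -> cdiff (fun z => g z - g w) z.
  by move=> /dg; exact: cdiff_subc.
rewrite /cK -ccircZ; last exact: onbd.
rewrite -[RHS]add0r -cauchy_diff -ccircD; [|exact: onbd|exact/on_bdZ/onbd].
apply: (congr1 (fun f => ccirc f a b c d)); apply/funext => z.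
by rewrite div1r mulrBl subrK.
Qed.

(** On a square of half side [s] centred at [w], the imaginary part pairs opposite sides into the
    integrand [2 * s / (t ^+ 2 + s ^+ 2)], which is at least [s^-1] for [|t| <= s]. Each pair
    contributes at least [2]. *)
Lemma cK_ge : 4 <= cmod cK.
Proof.
have [? ? ? ?] := bnds; pose s := Num.min (Num.min (x0 - a) (b - x0)) (Num.min (y0 - c) (d - y0)).
have s0 : 0 < s by rewrite !lt_min !subr_gt0 ax xb cy yd.
have s1 : s <= x0 - a by rewrite !ge_min lexx.
have s2 : s <= b - x0 by rewrite !ge_min lexx !orbT.
have s3 : s <= y0 - c by rewrite !ge_min lexx !orbT.
have s4 : s <= d - y0 by rewrite !ge_min lexx !orbT.
rewrite /cK (@ccirc_hole _ _ _ _ _ x0 y0 s) //; [|lra|lra|lra|lra|]; last first.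
  by move=> z zR zw; apply: cdiff_pole => //; exact: cdiff_cst.
have B : on_bd (fun z => 1 / (z - w)) (x0 - s) (x0 + s) (y0 - s) (y0 + s).
  apply: cdiff_on_bd; [lra|lra|move=> x y xP yP bd].
  apply: cdiff_pole; first exact: cdiff_cst.
  by rewrite -subr_eq0 -cmod_gt0 (lt_le_trans s0)// cmod_bd.
apply: le_trans (ler_cim _); apply: le_trans (ler_norm _); rewrite (circ_im B).
have E x y : 1 / (mkc x y - w) = mkc ((x - x0) / ((x - x0) ^+ 2 + (y - y0) ^+ 2))
    (- ((y - y0) / ((x - x0) ^+ 2 + (y - y0) ^+ 2))).
  by rewrite div1r.
have [B1 B2] := B.
rewrite /circ.
have -> : 4 = s^-1 * ((x0 + s) - (x0 - s)) + s^-1 * ((y0 + s) - (y0 - s)) :> R.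
  by field; rewrite gt_eqF.
have sq (t u : R) : u - s <= t <= u + s -> 0 < (t - u) ^+ 2 + s ^+ 2 <= 2 * s ^+ 2.
  move=> /andP[t1 t2]; apply/andP; split; first by rewrite ltr_wpDl ?sqr_ge0// exprn_gt0.
  have -> : 2 * s ^+ 2 = s ^+ 2 + s ^+ 2 by ring.
  rewrite lerD2r -ler_sqrt ?sqr_ge0// !sqrtr_sqr (gtr0_norm s0) ler_norml.
  by apply/andP; split; lra.
have key (t u : R) : u - s <= t <= u + s -> s^-1 <= s / ((t - u) ^+ 2 + s ^+ 2) *+ 2.
  move=> /sq/andP[q0 q1]; rewrite -mulrnAl ler_pdivlMr// mulrC ler_pdivrMr//.
  by apply: (le_trans q1); rewrite le_eqVlt; apply/orP; left; apply/eqP; ring.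
apply: lerD; rewrite -(@sint_cst R s^-1); try lra; apply: le_sint;
  try exact: cts_on_cst.
- by apply: cts_onB; apply: (B1 _ _).2; [left|right].
- move=> x xP; apply: (le_trans (key _ _ xP)); rewrite /v_of !E !cimK.
  have -> : y0 - s - y0 = - s by ring.
  have -> : y0 + s - y0 = s by ring.
  by rewrite sqrrN mulNr !opprK mulr2n.
- by apply: cts_onB; apply: (B2 _ _).1; [right|left].
- move=> y yP; apply: (le_trans (key _ _ yP)); rewrite /u_of !E !creK.
  have -> : x0 - s - x0 = - s by ring.
  have -> : x0 + s - x0 = s by ring.
  by rewrite sqrrN mulNr opprK mulr2n [s ^+ 2 + _]addrC.
Qed.

End Formula.
End CauchyFormula.

(** * Mean value inequalities *)

Section Plots.
Variable R : realType.

(* Borel sets and functions on C^n are tested on all measurable families of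
   points, which spares comparing the Borel sets of C^n with product sets. *)
Definition mplot d (U : measurableType d) n (Z : U -> 'rV[cplx R]_n) :=
  forall j, measurable_fun setT (fun u => cre (Z u 0 j)) /\
            measurable_fun setT (fun u => cim (Z u 0 j)).

Definition pset n (B : set 'rV[cplx R]_n) :=
  forall d (U : measurableType d) (Z : U -> 'rV[cplx R]_n),
    mplot Z -> measurable (Z @^-1` B).

Definition pfun n (f : 'rV[cplx R]_n -> \bar R) :=
  forall d (U : measurableType d) (Z : U -> 'rV[cplx R]_n),
    mplot Z -> measurable_fun setT (fun u => f (Z u)).

(** A closed cube in the [2 n] real coordinates and not a ball of the norm: its slices in each
    complex coordinate are squares, on which Cauchy's formula for rectangles applies. *)
Definition box n (z : 'rV[cplx R]_n) (r : R) : set 'rV[cplx R]_n :=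
  [set v | forall j, `|cre (v 0 j) - cre (z 0 j)| <= r /\
                     `|cim (v 0 j) - cim (z 0 j)| <= r].

Lemma box_sub n (z w v : 'rV[cplx R]_n) r s : box z r w -> box w s v ->
  box z (r + s) v.
Proof.
move=> h1 h2 j; have [a1 a2] := h1 j; have [b1 b2] := h2 j.
by split; apply: le_trans (ler_distD _ _ _) _; rewrite [r + s]addrC;
  [exact: lerD b1 a1|exact: lerD b2 a2].
Qed.

Lemma box_le n (z : 'rV[cplx R]_n) r s : r <= s -> box z r `<=` box z s.
Proof. by move=> rs v H j; have [a b] := H j; split; [apply: le_trans rs|apply: le_trans rs]. Qed.

Lemma box_vmod n (z v : 'rV[cplx R]_n) r : 0 <= r -> box z r v -> vmod (z - v) <= 2 * r.
Proof.
move=> r0 H; apply/vmod_row; first by rewrite mulr_ge0.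
move=> j; have [a b] := H j; rewrite !mxE; apply: le_trans (cmod_le _) _.
by rewrite !cplxE mulr2n mulrDl mul1r lerD// distrC.
Qed.

Lemma vmod_box n (z v : 'rV[cplx R]_n) r : vmod (z - v) <= r -> box z r v.
Proof.
move=> H j; have := le_trans (cmod_entry (z - v) j) H; rewrite !mxE => {}H.
rewrite !(distrC _ (cre (z 0 j))) !(distrC _ (cim (z 0 j))).
by split; [rewrite -creB; apply: le_trans (ler_cre _) _|
  rewrite -cimB; apply: le_trans (ler_cim _) _].
Qed.

Lemma nbhs_box n (z : 'rV[cplx R]_n) (P : set 'rV[cplx R]_n) :
  nbhs z P <-> exists2 r, 0 < r & box z r `<=` P.
Proof.
rewrite nbhs_vmod; split=> -[r r0 H].
  exists (r / 4); first by rewrite divr_gt0.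
  move=> v /(box_vmod (ltW (divr_gt0 r0 (ltr0Sn _ _)))) h; apply: H.
  by apply: le_lt_trans h _; lra.
by exists r => // y /ltW/vmod_box; exact: H.
Qed.

Lemma pset_box n (z : 'rV[cplx R]_n) r : pset (box z r).
Proof.
move=> d U Z mZ.
have -> : Z @^-1` box z r = \bigcap_(j in [set: 'I_n])
   ([set u | `|cre (Z u 0 j) - cre (z 0 j)| <= r] `&`
    [set u | `|cim (Z u 0 j) - cim (z 0 j)| <= r]).
  apply/seteqP; split=> u /= h j; first by move=> _; have [] := h j.
  by have [] := h j I.
apply: fin_bigcap_measurable => // j _; have [m1 m2] := mZ j.
apply: measurableI; rewrite -[X in measurable X]setTI.
  have := @measurable_fun_le _ _ R setT (fun u => `|cre (Z u 0 j) - cre (z 0 j)|) (fun=> r).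
  by apply => //; apply: measurableT_comp => //; exact: measurable_funB.
have := @measurable_fun_le _ _ R setT (fun u => `|cim (Z u 0 j) - cim (z 0 j)|) (fun=> r).
by apply => //; apply: measurableT_comp => //; exact: measurable_funB.
Qed.

Lemma psetI n (A B : set 'rV[cplx R]_n) : pset A -> pset B -> pset (A `&` B).
Proof. by move=> hA hB d U Z mZ; rewrite preimage_setI; apply: measurableI; [exact: hA|exact: hB]. Qed.

(** An open set is the union of the boxes with rational centre and radius [k.+1%:R^-1] that it
    contains, and these are countably many. *)
Lemma pset_open n (O : set 'rV[cplx R]_n) : open O -> pset O.
Proof.
move=> oO d U Z mZ.
pose I : countType := ('rV[rat * rat]_n * nat)%type.
pose c (i : I) : 'rV[cplx R]_n := \row_j mkc (ratr (i.1 0 j).1) (ratr (i.1 0 j).2).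
pose B (i : I) : set 'rV[cplx R]_n :=
  if `[< box (c i) i.2.+1%:R^-1 `<=` O >] then box (c i) i.2.+1%:R^-1 else set0.
have -> : O = \bigcup_i B i.
  apply/seteqP; split=> z; last first.
    by move=> [i _]; rewrite /B; case: asboolP => // h /h.
  rewrite openE in oO; move=> /oO /nbhs_box[r r0 rO].
  (* A rational centre is taken within [k.+1%:R^-1] of [z]; the box of that radius about it then
     lies within twice this distance of [z], hence the doubled term. *)
  have [k kr] : exists k : nat, k.+1%:R^-1 + k.+1%:R^-1 < r.
    have r20 : 0 < r / 2 by rewrite divr_gt0.
    have [k hk] := ltr_add_invr r20; exists k.
    by move: hk; rewrite add0r => hk; rewrite [r]splitr ltrD.
  have k0 : 0 < k.+1%:R^-1 :> R by rewrite invr_gt0.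
  have app (x : R) : exists q : rat, `|x - ratr q| <= k.+1%:R^-1.
    move: (k.+1%:R^-1) k0 => e e0.
    have [|q] := @rat_in_itvoo R (x - e) (x + e); first by lra.
    rewrite in_itv /= => /andP[q1 q2]; exists q; rewrite ler_norml.
    by apply/andP; split; lra.
  have [q qP] := choice app.
  pose i : I := (\row_j (q (cre (z 0 j)), q (cim (z 0 j))), k).
  have zi : box (c i) k.+1%:R^-1 z by move=> j; rewrite !mxE !cplxE.
  exists i => //; rewrite /B; case: asboolP => // -[] v hv; apply: rO.
  apply: box_le (ltW kr) _ _; apply: box_sub hv => j.
  by rewrite (distrC (cre (c i 0 j))) (distrC (cim (c i 0 j))); exact: zi.
rewrite preimage_bigcup; apply: countable_bigcupT_measurable => // i.
by rewrite /B; case: asboolP => // h; [exact: pset_box|rewrite preimage_set0].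
Qed.

(** Nothing is known of [f] outside [O], so superlevel sets are intersected with [O], where they are
    open; the indicator of [D] discards the other values. *)
Lemma pfun_open n (O D : set 'rV[cplx R]_n) (f : 'rV[cplx R]_n -> R) :
  open O -> D `<=` O -> pset D -> (forall z, O z -> {for z, continuous f}) ->
  pfun (fun z => (f z * \1_D z)%:E).
Proof.
move=> oO DO pD cf d U Z mZ; apply/measurable_EFinP.
have oB a : open [set z | O z /\ a < f z].
  rewrite openE => z [Oz az]; rewrite /interior.
  apply: filterI; first exact: open_nbhs_nbhs.
  by apply: (cf z Oz [set y | a < y]); exact: lt_nbhsr.
have -> : (fun u => f (Z u) * \1_D (Z u)) = (fun u => f (Z u)) \_ (Z @^-1` D).
  apply/funext => u; rewrite patchE indicE; case: ifPn; rewrite ?inE => h.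
    by rewrite mem_set// mulr1.
  by rewrite memNset ?mulr0// => h'; move: h; rewrite notin_setE; apply.
apply/(measurable_restrictT (fun u => f (Z u))); first exact: pD.
apply: (measurability (@RGenOInfty.G R)); first exact: RGenOInfty.measurableE.
move=> _ [_ [a ->] <-].
have -> : Z @^-1` D `&` (fun u => f (Z u)) @^-1` `]a, +oo[%classic =
  Z @^-1` D `&` Z @^-1` [set z | O z /\ a < f z].
  apply/seteqP; split=> u /= [Du]; rewrite ?in_itv /= ?andbT.
    by move=> au; split=> //; split=> //; exact: DO.
  by move=> [_ au]; split=> //; rewrite in_itv /= andbT.
by apply: measurableI; [exact: pD|exact: pset_open].
Qed.

End Plots.

Section MeanValue.
Variable R : realType.
Implicit Types (g : cplx R -> cplx R) (a b c d r : R) (z w : cplx R).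
Local Notation mu := (@lebesgue_measure R).

Lemma pole_on_bd g a b c d x0 y0 : a < x0 -> x0 < b -> c < y0 -> y0 < d ->
  (forall z, rect a b c d z -> cdiff g z) ->
  on_bd (fun z => g z / (z - mkc x0 y0)) a b c d.
Proof.
move=> ? ? ? ? dk; apply: cdiff_on_bd; [lra|lra|move=> x y xP yP bd].
apply: cdiff_pole; first exact: dk.
apply/eqP => /[dup] /(congr1 (@cre R)) + /(congr1 (@cim R)); rewrite !cplxE => xE yE.
by move: bd; rewrite xE yE => -[||[]]; lra.
Qed.

Lemma cmod_bd0 (x y r : R) : 0 < r ->
  [\/ x = - r, x = r | y = - r \/ y = r] -> r <= cmod (mkc x y).
Proof.
move=> r0 bd; have := @cmod_bd R x y 0 0 r r0.
by rewrite !sub0r !add0r subr0; apply.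
Qed.

(* Both Cauchy integrals are taken along the same square, so that
   (g t - g 0) K_0 is the integral of (g z - g t) (1/(z - t) - 1/z). *)
Lemma cauchy_lipschitz g r (M : R) t : 0 < r ->
  (forall z, rect (- r) r (- r) r z -> cdiff g z /\ cmod (g z) <= M) ->
  cmod t <= r / 2 -> cmod (g t - g 0) <= 32 * M * cmod t / r.
Proof.
move=> r0 H tr.
have M0 : 0 <= M.
  have [|_ ] := H 0; last by apply: le_trans; exact: cmod_ge0.
  by split; rewrite !cplxE; apply/andP; split; lra.
have dg z : rect (- r) r (- r) r z -> cdiff g z by move=> /H[].
have d1 z : rect (- r) r (- r) r z -> cdiff (fun=> 1) z by move=> _; exact: cdiff_cst.
have := le_trans (ler_cre t) tr; rewrite ler_norml => /andP[x1 x2].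
have := le_trans (ler_cim t) tr; rewrite ler_norml => /andP[y1 y2].
have [tx1 tx2 ty1 ty2] : [/\ - r < cre t, cre t < r, - r < cim t & cim t < r].
  by split; lra.
have n0 : - r < 0 by lra.
have Ft := cauchy_formula tx1 tx2 ty1 ty2 dg.
have F0 := cauchy_formula n0 r0 n0 r0 dg.
have Bt := pole_on_bd tx1 tx2 ty1 ty2 dg.
have B0 := pole_on_bd n0 r0 n0 r0 dg.
have Bt1 := pole_on_bd tx1 tx2 ty1 ty2 d1.
have B01 := pole_on_bd n0 r0 n0 r0 d1.
have K0 := cK_ge n0 r0 n0 r0.
rewrite mkcK in Ft Bt Bt1; rewrite mkc0 in F0 B0 B01.
move: Ft F0 K0; rewrite /cK mkcK mkc0.
set Kt := ccirc (fun z => 1 / (z - t)) _ _ _ _.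
set K0 := ccirc (fun z => 1 / (z - 0)) _ _ _ _ => Ft F0 K04.
pose F z := (g z / (z - t) + (-1) * (g z / (z - 0))) +
  ((- g t) * (1 / (z - t)) + g t * (1 / (z - 0))).
have bD (p q : cplx R -> cplx R) : on_bd p (- r) r (- r) r -> on_bd q (- r) r (- r) r ->
    on_bd (fun z => p z + q z) (- r) r (- r) r.
  move=> [p1 p2] [q1 q2]; split=> s sP.
    have [a1 a2] := p1 s sP; have [b1 b2] := q1 s sP; split.
      by under eq_fun do rewrite creD; exact: cts_onD.
    by under eq_fun do rewrite cimD; exact: cts_onD.
  have [a1 a2] := p2 s sP; have [b1 b2] := q2 s sP; split.
    by under eq_fun do rewrite creD; exact: cts_onD.
  by under eq_fun do rewrite cimD; exact: cts_onD.
have BF1 : on_bd (fun z => g z / (z - t) + (-1) * (g z / (z - 0))) (- r) r (- r) r.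
  by apply: bD => //; exact: on_bdZ.
have BF2 : on_bd (fun z => (- g t) * (1 / (z - t)) + g t * (1 / (z - 0))) (- r) r (- r) r.
  by apply: bD; exact: on_bdZ.
have BF : on_bd F (- r) r (- r) r by exact: bD.
have E : ccirc F (- r) r (- r) r = (g t - g 0) * K0.
  rewrite /F (ccircD BF1 BF2) ccircD; [|exact: Bt|exact: on_bdZ].
  rewrite ccircD; [|exact: on_bdZ|exact: on_bdZ].
  by rewrite Ft (ccircZ (-1) B0) (ccircZ (- g t) Bt1) (ccircZ (g t) B01) F0 -/Kt -/K0; ring.
have bound : cmod (ccirc F (- r) r (- r) r) <=
    4 * (2 * M * (cmod t / (r * (r / 2)))) * ((r - - r) + (r - - r)).
  apply: ccirc_le; [lra|lra|exact: BF|move=> x y xP yP bd].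
  set z := mkc x y.
  have zr : r <= cmod z by exact: cmod_bd0.
  have z0 : z != 0 by rewrite -cmod_gt0; lra.
  have ztr : r / 2 <= cmod (z - t).
    by have := cmodD (z - t) t; rewrite subrK; lra.
  have zt0 : z - t != 0 by rewrite -cmod_gt0; lra.
  have -> : F z = (g z - g t) * (t / (z * (z - t))).
    by rewrite /F subr0; field; rewrite z0 zt0.
  rewrite cmodM; apply: ler_pM; rewrite ?cmod_ge0//.
    apply: le_trans (cmodD _ _) _; rewrite cmodN mulr2n mulrDl mul1r.
    apply: lerD; first by apply: (H z _).2; split.
    by apply: (H t _).2; split; apply/andP; split; lra.
  rewrite cmodM cmodV cmodM ler_wpM2l ?cmod_ge0// lef_pV2 ?posrE.
  - by apply: ler_pM => //; lra.
  - by rewrite mulr_gt0//; lra.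
  - by rewrite mulr_gt0//; lra.
rewrite E cmodM in bound.
have : cmod (g t - g 0) * 4 <= cmod (g t - g 0) * cmod K0.
  by rewrite ler_wpM2l ?cmod_ge0.
move=> /le_trans /(_ bound).
have -> : 4 * (2 * M * (cmod t / (r * (r / 2)))) * ((r - - r) + (r - - r)) =
   (16 * M * cmod t / r) * 4 by field; rewrite gt_eqF.
rewrite ler_pM2r// => /le_trans; apply.
have : 0 <= M * cmod t / r by rewrite divr_ge0 ?mulr_ge0 ?cmod_ge0// ltW.
by rewrite -!mulrA; set A := M * _; lra.
Qed.

(** Cauchy-Schwarz on one side of the contour: the length is at most [2 * r] and the squared kernel
    at most [4 / r ^+ 2], whose product is [8 / r]. *)
Lemma side_le g (x0 y0 r : R) (p : R -> cplx R) a b : 0 < r -> a < b -> b - a <= 2 * r ->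
  ccts_on (fun t => g (p t) / (p t - mkc x0 y0)) a b ->
  cts_on (fun t => cmod (g (p t)) ^+ 2) a b ->
  (forall t, a <= t <= b -> r / 2 <= cmod (p t - mkc x0 y0)) ->
  cmod (pint (fun t => g (p t) / (p t - mkc x0 y0)) a b) ^+ 2 <=
  (8 / r) * sint (fun t => cmod (g (p t)) ^+ 2) a b.
Proof.
move=> r0 ab br c1 c2 far.
apply: le_trans (pint_sqr ab c1) _.
have sge0 : 0 <= sint (fun t => cmod (g (p t)) ^+ 2) a b.
  by apply: Rintegral_ge0 => t _; exact: sqr_ge0.
have c3 : cts_on (fun t => cmod (g (p t) / (p t - mkc x0 y0)) ^+ 2) a b.
  under eq_fun do rewrite sqr_cmod.
  by apply: cts_onD; apply: cts_onM; case: c1.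
apply: (@le_trans _ _ ((b - a) * ((4 / r ^+ 2) * sint (fun t => cmod (g (p t)) ^+ 2) a b))).
  rewrite ler_wpM2l ?subr_ge0 ?(ltW ab)// -sintZ//.
  apply: le_sint => //; first by apply: cts_onM => //; exact: cts_on_cst.
  move=> t /far ft; rewrite cmodM exprMn mulrC ler_wpM2r ?sqr_ge0//.
  rewrite cmodV exprVn.
  have -> : 4 / r ^+ 2 = ((r / 2) ^+ 2)^-1 by field; rewrite gt_eqF.
  have h0 : 0 < r / 2 by rewrite divr_gt0.
  rewrite lef_pV2 ?posrE ?exprn_gt0// ?(lt_le_trans h0)//.
  by rewrite ler_pXn2r// ?nnegrE ?cmod_ge0// ltW.
rewrite mulrA ler_wpM2r//.
apply: (@le_trans _ _ (2 * r * (4 / r ^+ 2))).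
  by rewrite ler_wpM2r// divr_ge0// sqr_ge0.
by rewrite le_eqVlt; apply/orP; left; apply/eqP; field; rewrite gt_eqF.
Qed.

(** The four sides are left free within bands of width [r / 2], at distance at least [r / 2] from
    the centre, so that each can later be placed where its line integral is small. Since [cK] has
    modulus at least [4] and the square of a sum of four terms is at most four times the sum of the
    squares, [side_le] gives the constant [4 * (8 / r) / 16 = 2 / r]. *)
Lemma cauchy_sqr g (x0 y0 r : R) a b c d : 0 < r ->
  x0 - r <= a <= x0 - r / 2 -> x0 + r / 2 <= b <= x0 + r ->
  y0 - r <= c <= y0 - r / 2 -> y0 + r / 2 <= d <= y0 + r ->
  (forall z, rect (x0 - r) (x0 + r) (y0 - r) (y0 + r) z -> cdiff g z) ->
  let G := fun x y => cmod (g (mkc x y)) ^+ 2 in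
  [/\ cts_on (fun x => G x c) a b, cts_on (fun x => G x d) a b,
      cts_on (fun y => G b y) c d, cts_on (fun y => G a y) c d &
  cmod (g (mkc x0 y0)) ^+ 2 <=
    (2 / r) * (sint (fun x => G x c) a b + sint (fun x => G x d) a b +
             (sint (fun y => G b y) c d + sint (fun y => G a y) c d))].
Proof.
move=> r0 /andP[a1 a2] /andP[b1 b2] /andP[c1 c2] /andP[d1 d2] H G.
have dg z : rect a b c d z -> cdiff g z.
  by move=> [/andP[? ?] /andP[? ?]]; apply: H; split; apply/andP; split; lra.
have ax : a < x0 by lra.
have xb : x0 < b by lra.
have cy : c < y0 by lra.
have yd : y0 < d by lra.
have F := cauchy_formula ax xb cy yd dg.
have K4 := cK_ge ax xb cy yd.
have [B1 B2] := pole_on_bd ax xb cy yd dg.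
have ab : a < b by lra.
have cd : c < d by lra.
have [D1 D2] : on_bd g a b c d.
  apply: cdiff_on_bd; [lra|lra|move=> x y xP yP _]; apply: dg; split => //.
have cG (p : R -> cplx R) s t : ccts_on (fun u => g (p u)) s t ->
    cts_on (fun u => cmod (g (p u)) ^+ 2) s t.
  move=> [h1 h2]; under eq_fun do rewrite sqr_cmod.
  by apply: cts_onD; exact: cts_onM.
have g1 := cG _ _ _ (D1 c (or_introl erefl)).
have g2 := cG _ _ _ (D1 d (or_intror erefl)).
have g3 := cG _ _ _ (D2 b (or_intror erefl)).
have g4 := cG _ _ _ (D2 a (or_introl erefl)).
split => //.
have farx x y : r / 2 <= `|x - x0| -> r / 2 <= cmod (mkc x y - mkc x0 y0).
  by move/le_trans; apply; exact: (ler_cre (mkc x y - mkc x0 y0)).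
have fary x y : r / 2 <= `|y - y0| -> r / 2 <= cmod (mkc x y - mkc x0 y0).
  by move/le_trans; apply; exact: (ler_cim (mkc x y - mkc x0 y0)).
have lba : b - a <= 2 * r by lra.
have ldc : d - c <= 2 * r by lra.
have S1 := side_le r0 ab lba (B1 c (or_introl erefl)) g1.
have S2 := side_le r0 ab lba (B1 d (or_intror erefl)) g2.
have S3 := side_le r0 cd ldc (B2 b (or_intror erefl)) g3.
have S4 := side_le r0 cd ldc (B2 a (or_introl erefl)) g4.
have {}S1 : _ := S1 (fun t _ => fary t c _).
have {}S2 : _ := S2 (fun t _ => fary t d _).
have {}S3 : _ := S3 (fun t _ => farx b t _).
have {}S4 : _ := S4 (fun t _ => farx a t _).
move: S1 S2 S3 S4.
have h1 : r / 2 <= `|c - y0| by rewrite distrC; apply: le_trans (ler_norm _); lra.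
have h2 : r / 2 <= `|d - y0| by apply: le_trans (ler_norm _); lra.
have h3 : r / 2 <= `|b - x0| by apply: le_trans (ler_norm _); lra.
have h4 : r / 2 <= `|a - x0| by rewrite distrC; apply: le_trans (ler_norm _); lra.
move=> /(_ h1) S1 /(_ h2) S2 /(_ h3) S3 /(_ h4) S4.
rewrite -/G in S1 S2 S3 S4.
set I1 := sint (fun x => G x c) a b in S1 *; set I2 := sint (fun x => G x d) a b in S2 *.
set I3 := sint (fun y => G b y) c d in S3 *; set I4 := sint (fun y => G a y) c d in S4 *.
move: F; rewrite /ccirc.
set p1 := pint _ a b in S1 *; set p2 := pint _ a b in S2 *.
set p3 := pint _ c d in S3 *; set p4 := pint _ c d in S4 * => F.
have le1 : 4 * cmod (g (mkc x0 y0)) <= cmod p1 + cmod p2 + (cmod p3 + cmod p4).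
  apply: (@le_trans _ _ (cmod (g (mkc x0 y0) * cK a b c d x0 y0))).
    by rewrite cmodM mulrC ler_wpM2l ?cmod_ge0.
  rewrite -F; apply: le_trans (cmodD _ _) _; apply: lerD.
    by apply: le_trans (cmodD _ _) _; rewrite cmodN.
  rewrite cmodM.
  have -> : cmod (ci R) = 1 by rewrite /cmod !cplxE expr0n expr1n add0r sqrtr1.
  by rewrite mul1r; apply: le_trans (cmodD _ _) _; rewrite cmodN.
have G0 := cmod_ge0 (g (mkc x0 y0)).
have sq4 (u v s t : R) : (u + v + (s + t)) ^+ 2 <= 4 * (u ^+ 2 + v ^+ 2 + (s ^+ 2 + t ^+ 2)).
  rewrite -subr_ge0.
  have -> : 4 * (u ^+ 2 + v ^+ 2 + (s ^+ 2 + t ^+ 2)) - (u + v + (s + t)) ^+ 2 =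
    (u - v) ^+ 2 + (u - s) ^+ 2 + (u - t) ^+ 2 + ((v - s) ^+ 2 + (v - t) ^+ 2 + (s - t) ^+ 2).
    by ring.
  by rewrite !addr_ge0 ?sqr_ge0.
have le2 : 16 * cmod (g (mkc x0 y0)) ^+ 2 <= 4 * ((8 / r) * (I1 + I2 + (I3 + I4))).
  have -> : 16 * cmod (g (mkc x0 y0)) ^+ 2 = (4 * cmod (g (mkc x0 y0))) ^+ 2 by ring.
  apply: (@le_trans _ _ ((cmod p1 + cmod p2 + (cmod p3 + cmod p4)) ^+ 2)).
    by rewrite ler_pXn2r// nnegrE ?addr_ge0 ?cmod_ge0// mulr_ge0.
  apply: le_trans (sq4 _ _ _ _) _; rewrite ler_pM2l// !mulrDr.
  by apply: lerD; apply: lerD.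
have -> : 2 / r * (I1 + I2 + (I3 + I4)) = 4 * (8 / r * (I1 + I2 + (I3 + I4))) / 16 by field;
  rewrite gt_eqF.
by rewrite ler_pdivlMr// mulrC.
Qed.

End MeanValue.

(** * The mean value inequality in one variable *)

Section LineIntegrals.
Variable R : realType.
Local Notation mu := (@lebesgue_measure R).
Local Notation mR := (measurableTypeR R).
Local Open Scope ereal_scope.

Lemma sint_le_integral (phi : R -> R) (T : mR -> \bar R) (a b : R) :
  cts_on phi a b -> measurable_fun setT T -> (forall x, 0 <= T x) ->
  (forall x, (a <= x <= b)%R -> (0 <= phi x)%R) ->
  (forall x, (a <= x <= b)%R -> (phi x)%:E <= T x) ->
  (sint phi a b)%:E <= \int[mu]_x T x.
Proof.
move=> cp mT T0 p0 pT.
have ip := cts_on_integrable cp.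
rewrite /sint /Rintegral fineK; last exact: integrable_fin_num.
apply: (@le_trans _ _ (\int[mu]_(x in `[a, b]%classic) T x)).
  apply: ge0_le_integral => //.
  - by case/integrableP: ip.
  - exact: measurable_funTS.
by apply: ge0_subset_integral => //; exact: measurable_itv.
Qed.

(** Otherwise [T] would exceed [(I + delta) / (q - p)] on all of [[p, q]] and its integral would be
    at least [I + delta]. The margin [delta] makes this contradict the value [I] although only large
    inequalities survive integration. *)
Lemma integral_good_point (T : mR -> \bar R) (p q I delta : R) : (p < q)%R ->
  measurable_fun setT T -> (forall x, 0 <= T x) ->
  \int[mu]_x T x = I%:E -> (0 < delta)%R ->
  exists2 c, (p <= c <= q)%R & T c <= ((I + delta) / (q - p))%:E.
Proof.
move=> pq mT T0 TI d0; apply: contrapT => H.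
have qp : (0 < q - p)%R by rewrite subr_gt0.
have I0 : (0 <= I)%R by rewrite -lee_fin -TI; exact: integral_ge0.
have : (I + delta)%:E <= \int[mu]_x T x.
  have -> : (I + delta)%:E = \int[mu]_(x in `[p, q]%classic) ((I + delta) / (q - p))%:E.
    rewrite integral_cst//=.
    rewrite -[X in _ = _ * X]/(mu `[p, q]%classic) (lebesgue_measure_segment (ltW pq)).
    by rewrite -EFinM divfK// gt_eqF.
  apply: (@le_trans _ _ (\int[mu]_(x in `[p, q]%classic) T x)).
    apply: ge0_le_integral => //.
    - by move=> x _; rewrite lee_fin (divr_ge0 (addr_ge0 I0 (ltW d0)) (ltW qp)).
    - exact: measurable_funTS.
    - move=> x; rewrite /= in_itv /= => xpq; apply: ltW; rewrite ltNge; apply/negP => h.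
      by apply: H; exists x.
  by apply: ge0_subset_integral => //; exact: measurable_itv.
by rewrite TI lee_fin gerDl leNgt d0.
Qed.

(** By Tonelli the slice integrals in both directions have the same total [I], so each side of the
    contour can be placed in its band with line integral at most [(2 / r) * (I + delta)]. Four such
    sides in [cauchy_sqr] give [(2 / r) * 4 * (2 / r) = 16 / r ^+ 2]. *)
Lemma mean_value1 (g : cplx R -> cplx R) (E : mR * mR -> \bar R) (x0 y0 r : R) : (0 < r)%R ->
  measurable_fun setT E -> (forall p, 0 <= E p) ->
  (forall x y, rect (x0 - r) (x0 + r) (y0 - r) (y0 + r) (mkc x y) ->
     E (x, y) = (cmod (g (mkc x y)) ^+ 2)%:E) ->
  (forall z, rect (x0 - r) (x0 + r) (y0 - r) (y0 + r) z -> cdiff g z) ->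
  (cmod (g (mkc x0 y0)) ^+ 2)%:E <=
    (16 / r ^+ 2)%:E * \int[mu]_x \int[mu]_y E (x, y).
Proof.
move=> r0 mE E0 EE H.
have mF := @measurable_fun_fubini_tonelli_F _ _ _ _ _ mu E mE E0.
have mG := @measurable_fun_fubini_tonelli_G _ _ _ _ _ mu E mE E0.
have FG := @fubini_tonelli _ _ _ _ _ mu mu E mE E0.
set F := fubini_F mu E in mF; set G := fubini_G mu E in mG.
have F0 x : 0 <= F x by exact: integral_ge0.
have G0 x : 0 <= G x by exact: integral_ge0.
have Iint : \int[mu]_x \int[mu]_y E (x, y) = \int[mu]_x F x by [].
have Jint : \int[mu]_x F x = \int[mu]_y G y := FG.
rewrite Iint.
have C0 : (0 < 16 / r ^+ 2)%R := divr_gt0 (ltr0Sn _ _) (exprn_gt0 2 r0).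
have [->|Ify] := eqVneq (\int[mu]_x F x) +oo.
  by rewrite gt0_muley ?lte_fin ?leey.
have [I FI] : exists I : R, \int[mu]_x F x = I%:E.
  exists (fine (\int[mu]_x F x)); rewrite fineK// ge0_fin_numE ?ltey//.
  by apply: integral_ge0 => x _; exact: F0.
rewrite FI -EFinM lee_fin; apply/ler_addgt0Pr => e e0.
(* Chosen so that [16 / r ^+ 2 * delta = e]. *)
pose delta := (e * r ^+ 2 / 16)%R.
have d0 : (0 < delta)%R by rewrite divr_gt0 ?mulr_gt0 ?exprn_gt0.
have GI : \int[mu]_y G y = I%:E by rewrite -Jint.
have h1 : (x0 - r < x0 - r / 2)%R by lra.
have h2 : (x0 + r / 2 < x0 + r)%R by lra.
have h3 : (y0 - r < y0 - r / 2)%R by lra.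
have h4 : (y0 + r / 2 < y0 + r)%R by lra.
have [a aP Fa] := integral_good_point h1 mF F0 FI d0.
have [b bP Fb] := integral_good_point h2 mF F0 FI d0.
have [c cP Gc] := integral_good_point h3 mG G0 GI d0.
have [d dP Gd] := integral_good_point h4 mG G0 GI d0.
have [cc cd cb ca le1] := cauchy_sqr r0 aP bP cP dP H.
have inr x y : (x0 - r <= x <= x0 + r)%R -> (y0 - r <= y <= y0 + r)%R ->
    E (x, y) = (cmod (g (mkc x y)) ^+ 2)%:E.
  by move=> xP yP; apply: EE.
move: aP bP cP dP => /andP[a1 a2] /andP[b1 b2] /andP[c1 c2] /andP[d1 d2].
have aI : (x0 - r <= a <= x0 + r)%R by clear -r0 a1 a2; apply/andP; split; lra.
have bI : (x0 - r <= b <= x0 + r)%R by clear -r0 b1 b2; apply/andP; split; lra.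
have cI : (y0 - r <= c <= y0 + r)%R by clear -r0 c1 c2; apply/andP; split; lra.
have dI : (y0 - r <= d <= y0 + r)%R by clear -r0 d1 d2; apply/andP; split; lra.
have q2 : ((I + delta) / (r / 2) = (2 / r) * (I + delta))%R.
  by field; rewrite gt_eqF.
have bound1 y : (y0 - r <= y <= y0 + r)%R -> G y <= ((2 / r) * (I + delta))%:E ->
    cts_on (fun x => (cmod (g (mkc x y)) ^+ 2)%R) a b ->
    (sint (fun x => (cmod (g (mkc x y)) ^+ 2)%R) a b <= (2 / r) * (I + delta))%R.
  move=> yP Gy cy; rewrite -lee_fin; apply: le_trans Gy; rewrite /G /fubini_G.
  apply: sint_le_integral => //.
  - by apply: measurableT_comp => //; exact: measurable_pair2.
  - by move=> x _; exact: sqr_ge0.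
  - move=> x /andP[x1 x2]; rewrite inr//.
    by clear -r0 x1 x2 a1 b2; apply/andP; split; lra.
have bound2 x : (x0 - r <= x <= x0 + r)%R -> F x <= ((2 / r) * (I + delta))%:E ->
    cts_on (fun y => (cmod (g (mkc x y)) ^+ 2)%R) c d ->
    (sint (fun y => (cmod (g (mkc x y)) ^+ 2)%R) c d <= (2 / r) * (I + delta))%R.
  move=> xP Fx cx; rewrite -lee_fin; apply: le_trans Fx; rewrite /F /fubini_F.
  apply: sint_le_integral => //.
  - by apply: measurableT_comp => //; exact: measurable_pair1.
  - by move=> y _; exact: sqr_ge0.
  - move=> y /andP[y1 y2]; rewrite inr//.
    by clear -r0 y1 y2 c1 d2; apply/andP; split; lra.
have e1 : (x0 - r / 2 - (x0 - r) = r / 2)%R by field.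
have e2 : (x0 + r - (x0 + r / 2) = r / 2)%R by field.
have e3 : (y0 - r / 2 - (y0 - r) = r / 2)%R by field.
have e4 : (y0 + r - (y0 + r / 2) = r / 2)%R by field.
rewrite e1 q2 in Fa; rewrite e2 q2 in Fb; rewrite e3 q2 in Gc; rewrite e4 q2 in Gd.
have {}Gc := bound1 c cI Gc cc; have {}Gd := bound1 d dI Gd cd.
have {}Fa := bound2 a aI Fa ca; have {}Fb := bound2 b bI Fb cb.
apply: (le_trans le1).
have -> : (16 / r ^+ 2 * I + e = 2 / r * (4 * (2 / r * (I + delta))))%R.
  by rewrite /delta; field; rewrite gt_eqF.
rewrite ler_pM2l ?divr_gt0//.
set A := (2 / r * (I + delta))%R in Gc Gd Fa Fb *.
by clear -Gc Gd Fa Fb; lra.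
Qed.

End LineIntegrals.

(** * The iterated integral over C^n and the mean value inequality in several variables *)

Section CnIntegral.
Variable R : realType.
Local Notation mu := (@lebesgue_measure R).
Local Notation mR := (measurableTypeR R).
(** The vector that [cn_integral] builds from two real variables and the remaining coordinates,
    retyped with [n.+1] columns in place of [1 + n]. *)
Definition rowc n (x y : R) (w : 'rV[cplx R]_n) : 'rV[cplx R]_n.+1 :=
  (row_mx (mkc x y)%:M w : 'rV[cplx R]_(1 + n)).

Lemma rowc0 n x y (w : 'rV[cplx R]_n) : rowc x y w 0 ord0 = mkc x y.
Proof.
rewrite /rowc (_ : ord0 = lshift n (ord0 : 'I_1)); last exact: val_inj.
by apply: etrans (row_mxEl _ _ _ _) _; rewrite mxE.
Qed.

Lemma rowcS n x y (w : 'rV[cplx R]_n) j : rowc x y w 0 (lift ord0 j) = w 0 j.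
Proof.
rewrite /rowc (_ : lift ord0 j = rshift 1 j); last exact: val_inj.
exact: (@row_mxEr _ 1 1 n (mkc x y)%:M w ord0 j).
Qed.

Lemma rowcK n (z : 'rV[cplx R]_n.+1) : exists w : 'rV[cplx R]_n,
  z = rowc (cre (z 0 ord0)) (cim (z 0 ord0)) w.
Proof.
exists (\row_j z 0 (lift ord0 j)); apply/rowP => j.
by case: (unliftP ord0 j) => [k ->|->]; rewrite ?rowcS ?rowc0 ?mxE ?mkcK.
Qed.

Local Open Scope ereal_scope.

Lemma mplot_rowc d (U : measurableType d) n (X Y : U -> R) (W : U -> 'rV[cplx R]_n) :
  measurable_fun setT X -> measurable_fun setT Y -> mplot W ->
  mplot (fun u => rowc (X u) (Y u) (W u)).
Proof.
move=> mX mY mW j; case: (unliftP ord0 j) => [k ->|->].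
  by have [m1 m2] := mW k; split; under eq_fun do rewrite rowcS.
by split; under eq_fun do rewrite rowc0.
Qed.

Definition pfun2 d (T : measurableType d) n (G : T -> 'rV[cplx R]_n -> \bar R) :=
  forall d' (U : measurableType d') (tau : U -> T) (Z : U -> 'rV[cplx R]_n),
    measurable_fun setT tau -> mplot Z -> measurable_fun setT (fun u => G (tau u) (Z u)).

Lemma cn_ge0 n (f : 'rV[cplx R]_n -> \bar R) : (forall z, 0 <= f z) -> 0 <= cn_integral f.
Proof.
elim: n f => [f f0|n IH f f0] /=; first exact: f0.
by apply: integral_ge0 => x _; apply: integral_ge0 => y _; apply: IH => w; exact: f0.
Qed.

(** The parameter space [T] is generalized in the induction: the two outermost variables of
    integration join the parameter, and Tonelli then integrates them out one after the other. *)
Lemma cn_measurable n d (T : measurableType d) (G : T -> 'rV[cplx R]_n -> \bar R) :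
  pfun2 G -> (forall t z, 0 <= G t z) -> measurable_fun setT (fun t => cn_integral (G t)).
Proof.
elim: n d T G => [|n IH] d T G mG G0 /=.
  by apply: (mG _ T id (fun=> 0%R)).
pose K (p : T * mR * mR) := cn_integral (fun w => G p.1.1 (rowc p.1.2 p.2 w)).
have K0 p : 0 <= K p by exact: cn_ge0.
have mK : measurable_fun setT K.
  apply: (IH _ _ (fun (p : T * mR * mR) w => G p.1.1 (rowc p.1.2 p.2 w))) => //.
  move=> d' U tau Z mtau mZ.
  apply: (mG _ U (fun u => (tau u).1.1) (fun u => rowc (tau u).1.2 (tau u).2 (Z u))).
    by apply: measurableT_comp => //; apply: measurableT_comp => //.
  apply: mplot_rowc => //; last by apply: measurableT_comp.
  by apply: measurableT_comp => //; apply: measurableT_comp.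
have m1 := @measurable_fun_fubini_tonelli_F _ _ _ _ _ mu K mK K0.
have m10 p : 0 <= fubini_F mu K p by exact: integral_ge0.
exact: (@measurable_fun_fubini_tonelli_F _ _ _ _ _ mu _ m1 m10).
Qed.

Lemma pfun_slice n (f : 'rV[cplx R]_n.+1 -> \bar R) x y : pfun f ->
  pfun (fun w : 'rV[cplx R]_n => f (rowc x y w)).
Proof.
move=> mf d U Z mZ; apply: (mf _ U (fun u => rowc x y (Z u))).
by apply: mplot_rowc => //; exact: measurable_cst.
Qed.

Lemma cn_slice n (f : 'rV[cplx R]_n.+1 -> \bar R) : pfun f -> (forall z, 0 <= f z) ->
  [/\ measurable_fun setT (fun p : mR * mR => cn_integral (fun w => f (rowc p.1 p.2 w))),
     forall x, measurable_fun setT (fun y : mR => cn_integral (fun w => f (rowc x y w))) &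
     measurable_fun setT (fun x : mR => \int[mu]_y cn_integral (fun w => f (rowc x y w)))].
Proof.
move=> mf f0.
pose K (p : mR * mR) := cn_integral (fun w => f (rowc p.1 p.2 w)).
have mK : measurable_fun setT K.
  apply: (@cn_measurable _ _ _ (fun (p : mR * mR) w => f (rowc p.1 p.2 w))) => //.
  move=> d' U tau Z mtau mZ; apply: (mf _ U (fun u => rowc (tau u).1 (tau u).2 (Z u))).
  by apply: mplot_rowc => //; apply: measurableT_comp.
have K0 p : 0 <= K p by exact: cn_ge0.
split => //.
  by move=> x; exact: (measurableT_comp mK (measurable_pair1 x)).
exact: (@measurable_fun_fubini_tonelli_F _ _ _ _ _ mu K mK K0).
Qed.

Lemma cn_le n (f g : 'rV[cplx R]_n -> \bar R) : pfun f -> pfun g ->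
  (forall z, 0 <= f z) -> (forall z, f z <= g z) -> cn_integral f <= cn_integral g.
Proof.
elim: n f g => [|n IH] f g mf mg f0 fg /=; first exact: fg.
have g0 z : 0 <= g z by exact: le_trans (fg z).
have [_ f1 f2] := cn_slice mf f0; have [_ g1 g2] := cn_slice mg g0.
apply: ge0_le_integral => //.
  by move=> x _; apply: integral_ge0 => y _; exact: cn_ge0.
move=> x _; apply: ge0_le_integral => //.
- by move=> y _; exact: cn_ge0.
- exact: f1.
- exact: g1.
by move=> y _; apply: IH => //; exact: pfun_slice.
Qed.

Lemma cnD n (f g : 'rV[cplx R]_n -> \bar R) : pfun f -> pfun g ->
  (forall z, 0 <= f z) -> (forall z, 0 <= g z) ->
  cn_integral (fun z => f z + g z) = cn_integral f + cn_integral g.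
Proof.
elim: n f g => [|n IH] f g mf mg f0 g0 //=.
have [_ f1 f2] := cn_slice mf f0; have [_ g1 g2] := cn_slice mg g0.
rewrite -ge0_integralD//.
- apply: eq_integral => x _; rewrite -ge0_integralD//.
  + by apply: eq_integral => y _; apply: IH => //; exact: pfun_slice.
  + by move=> y _; exact: cn_ge0.
  + exact: f1.
  + by move=> y _; exact: cn_ge0.
  + exact: g1.
- by move=> x _; apply: integral_ge0 => y _; exact: cn_ge0.
- by move=> x _; apply: integral_ge0 => y _; exact: cn_ge0.
Qed.

Lemma cnZ n (k : R) (f : 'rV[cplx R]_n -> \bar R) : (0 <= k)%R -> pfun f ->
  (forall z, 0 <= f z) -> cn_integral (fun z => k%:E * f z) = k%:E * cn_integral f.
Proof.
move=> k0; elim: n f => [|n IH] f mf f0 //=.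
have [_ f1 f2] := cn_slice mf f0.
rewrite -ge0_integralZl//.
- apply: eq_integral => x _; rewrite -ge0_integralZl//.
  + by apply: eq_integral => y _; apply: IH => //; exact: pfun_slice.
  + exact: f1.
  + by move=> y _; exact: cn_ge0.
- by move=> x _; apply: integral_ge0 => y _; exact: cn_ge0.
Qed.

Lemma box_rowc n x y (w : 'rV[cplx R]_n) x' y' w' r :
  box (rowc x y w) r (rowc x' y' w') <->
  rect (x - r) (x + r) (y - r) (y + r) (mkc x' y') /\ box w r w'.
Proof.
have E (u v : R) : (`|u - v| <= r)%R = (v - r <= u <= v + r)%R.
  exact: ler_distl.
split=> [H|[[h1 h2] H] j].
  split; last by move=> j; have := H (lift ord0 j); rewrite !rowcS.
  by have := H ord0; rewrite !rowc0 !E.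
case: (unliftP ord0 j) => [k ->|->]; first by rewrite !rowcS.
by rewrite !rowc0 !E.
Qed.

Lemma indic_box_rowc n x y (w : 'rV[cplx R]_n) x' y' w' r :
  \1_(box (rowc x y w) r) (rowc x' y' w') =
  (\1_(rect (x - r) (x + r) (y - r) (y + r)) (mkc x' y') * \1_(box w r) w' :> R)%R.
Proof.
rewrite !indicE -natrM mulnb; congr (_%:R)%R; apply/congr1.
by apply/idP/andP; rewrite !inE => h; [case/box_rowc: h|exact/box_rowc].
Qed.

(** The box has volume [(2 * r) ^+ (2 * n)], and [f] is at most [k] on it and vanishes outside. *)
Lemma cn_box_le n (z : 'rV[cplx R]_n) (r k : R) (f : 'rV[cplx R]_n -> \bar R) :
  (0 <= r)%R -> (0 <= k)%R -> pfun f -> (forall w, 0 <= f w) ->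
  (forall w, f w <= (k * \1_(box z r) w)%:E) ->
  cn_integral f <= (k * (4 * r ^+ 2) ^+ n)%:E.
Proof.
move=> r0; elim: n z k f => [|n IH] z k f k0 mf f0 fk /=.
  rewrite expr0 mulr1; apply: (le_trans (fk _)); rewrite lee_fin ler_piMr//.
have [w zE] := rowcK z; move: zE; set x0 := cre _; set y0 := cim _ => zE.
have [_ f1 f2] := cn_slice mf f0.
set I := `[(x0 - r)%R, (x0 + r)%R]%classic; set J := `[(y0 - r)%R, (y0 + r)%R]%classic.
have inn x y : cn_integral (fun v => f (rowc x y v)) <=
    (k * (4 * r ^+ 2) ^+ n * \1_I x * \1_J y)%:E.
  have [xyR|xyR] := pselect (rect (x0 - r) (x0 + r) (y0 - r) (y0 + r) (mkc x y)).
    have Ix : I x by case: xyR => h _; rewrite /I /= in_itv.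
    have Jy : J y by case: xyR => _ h; rewrite /J /= in_itv.
    have -> : (\1_I x = 1 :> R)%R by rewrite indicE mem_set.
    have -> : (\1_J y = 1 :> R)%R by rewrite indicE mem_set.
    rewrite !mulr1; apply: (IH w) => //; first exact: pfun_slice.
    move=> v; apply: (le_trans (fk _)); rewrite zE indic_box_rowc.
    by rewrite [\1_(rect _ _ _ _) _]indicE mem_set// mul1r.
  (* Outside the square the slice of [f] vanishes, so the induction hypothesis is applied with
     [k = 0]. *)
  apply: (@le_trans _ _ (0 * (4 * r ^+ 2) ^+ n)%:E).
    apply: (IH w) => //; first exact: pfun_slice.
    move=> v; apply: (le_trans (fk _)); rewrite zE indic_box_rowc.
    by rewrite [\1_(rect _ _ _ _) _]indicE memNset// !mul0r mulr0.
  by rewrite mul0r lee_fin !mulr_ge0 ?exprn_ge0 ?mulr_ge0 ?sqr_ge0.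
have mI : measurable I by exact: measurable_itv.
have mJ : measurable J by exact: measurable_itv.
have len (u : R) : mu `[(u - r)%R, (u + r)%R]%classic = (2 * r)%:E.
  rewrite lebesgue_measure_segment; last by lra.
  by congr (_%:E); lra.
have K0 : (0 <= k * (4 * r ^+ 2) ^+ n)%R.
  by rewrite !mulr_ge0 ?exprn_ge0 ?mulr_ge0 ?sqr_ge0.
have step (c : R) (A : set mR) : (0 <= c)%R -> measurable A -> mu A = (2 * r)%:E ->
    \int[mu]_x (c * \1_A x)%:E = (c * (2 * r))%:E.
  move=> c0 mA Ar; under eq_integral do rewrite EFinM.
  rewrite ge0_integralZl//; last by apply/measurable_EFinP.
  have -> : \int[mu]_x (\1_A x)%:E = (2 * r)%:E by rewrite integral_indic// setIT.
  by [].
apply: (@le_trans _ _ (\int[mu]_x (k * (4 * r ^+ 2) ^+ n * (2 * r) * \1_I x)%:E)).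
  apply: ge0_le_integral => //.
  - by move=> x _; apply: integral_ge0 => y _; exact: cn_ge0.
  - by apply/measurable_EFinP; apply: measurable_funM => //; exact: measurable_cst.
  move=> x _; apply: (@le_trans _ _ (\int[mu]_y (k * (4 * r ^+ 2) ^+ n * \1_I x * \1_J y)%:E)).
    apply: ge0_le_integral => //.
    + by move=> y _; exact: cn_ge0.
    + exact: f1.
    + by apply/measurable_EFinP; apply: measurable_funM => //; exact: measurable_cst.
    by move=> y _; exact: inn.
  have c0 : (0 <= k * (4 * r ^+ 2) ^+ n * \1_I x)%R by rewrite mulr_ge0// indicE.
  rewrite (step _ _ c0 mJ (len y0)).
  by rewrite lee_fin mulrAC.
have c0 : (0 <= k * (4 * r ^+ 2) ^+ n * (2 * r))%R by rewrite !mulr_ge0 ?exprn_ge0 ?mulr_ge0 ?sqr_ge0.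
rewrite (step _ _ c0 mI (len x0)).
rewrite lee_fin [((4 * r ^+ 2) ^+ n.+1)%R]exprS le_eqVlt; apply/orP; left; apply/eqP; ring.
Qed.

(* Homogeneity of the approximating map suffices to restrict f to complex lines. *)
Definition hom_diff n (f : 'rV[cplx R]_n -> cplx R) z :=
  exists2 A : 'rV[cplx R]_n -> cplx R, (forall c v, A (c *: v) = c * A v)%R &
  forall e : R, (0 < e)%R -> exists2 r : R, (0 < r)%R &
    forall h, (vmod h < r -> cmod (f (z + h) - f z - A h) <= e * vmod h)%R.

Lemma hom_diff_line n (f : 'rV[cplx R]_n -> cplx R) (z v : 'rV[cplx R]_n) (t : cplx R) :
  hom_diff f (z + t *: v)%R -> cdiff (fun s => f (z + s *: v)%R) t.
Proof.
move=> [A AZ H]; exists (A v) => e e0.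
have v0 : (0 < vmod v + 1)%R by rewrite ltr_pwDr// vmod_ge0.
have [r r0 rP] := H _ (divr_gt0 e0 v0).
exists (r / (vmod v + 1))%R; first by rewrite divr_gt0.
move=> h; rewrite ltr_pdivlMr// => hr.
have le1 : (vmod (h *: v) <= cmod h * (vmod v + 1))%R.
  by rewrite vmodZ ler_wpM2l ?cmod_ge0// lerDl.
have := rP (h *: v)%R (le_lt_trans le1 hr).
rewrite AZ scalerDl addrA mulrC => /le_trans; rewrite [(A v * h)%R]mulrC; apply.
apply: (@le_trans _ _ (e / (vmod v + 1) * (cmod h * (vmod v + 1)))%R).
  by rewrite ler_wpM2l// divr_ge0 ?ltW.
by rewrite le_eqVlt; apply/orP; left; apply/eqP; field; rewrite gt_eqF.
Qed.

Lemma rowcD n x y x' y' (w w' : 'rV[cplx R]_n) :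
  (rowc x y w + rowc x' y' w' = rowc (x + x') (y + y') (w + w'))%R.
Proof.
apply/rowP => j; case: (unliftP ord0 j) => [k ->|->].
  by rewrite [LHS]mxE !rowcS [RHS]mxE.
by rewrite [LHS]mxE !rowc0.
Qed.

Lemma rowc_line n (w : 'rV[cplx R]_n) (s : cplx R) :
  (rowc 0 0 w + s *: rowc 1 0 0 = rowc (cre s) (cim s) w)%R.
Proof.
apply/rowP => j; rewrite [LHS]mxE [X in (_ + X)%R]mxE.
case: (unliftP ord0 j) => [k ->|->].
  by rewrite !rowcS [X in (_ * X)%R]mxE mulr0 addr0.
by rewrite !rowc0 mkcK mkc0 add0r mulr1.
Qed.

Lemma vmod_rowc0 n (h : 'rV[cplx R]_n) : (vmod (rowc 0 0 h) <= vmod h)%R.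
Proof.
apply/vmod_row; first exact: vmod_ge0.
move=> j; case: (unliftP ord0 j) => [k ->|->]; first by rewrite rowcS cmod_entry.
by rewrite rowc0 mkc0 cmod0 vmod_ge0.
Qed.

Lemma hom_diff_slice n (f : 'rV[cplx R]_n.+1 -> cplx R) x y w :
  hom_diff f (rowc x y w) -> hom_diff (fun w => f (rowc x y w)) w.
Proof.
move=> [A AZ H]; exists (fun h => A (rowc 0 0 h)).
  move=> c v; rewrite -AZ; congr A; apply/rowP => j.
  case: (unliftP ord0 j) => [k ->|->].
    by rewrite rowcS [RHS]mxE [LHS]mxE rowcS.
  by rewrite [RHS]mxE !rowc0 mkc0 mulr0.
move=> e e0; have [r r0 rP] := H _ e0; exists r => // h hr.
have hh := vmod_rowc0 h.
have := rP _ (le_lt_trans hh hr); rewrite rowcD !addr0 => /le_trans; apply.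
by rewrite ler_wpM2l// ltW.
Qed.

(** One complex coordinate at a time: [mean_value1] in the first one, the others being kept at the
    centre, and then the induction hypothesis under the integral, on the slices through the points
    of the square. Each step costs a factor [16 / r ^+ 2]. *)
Lemma mean_value n (f : 'rV[cplx R]_n -> cplx R) (z : 'rV[cplx R]_n) (r : R) :
  (0 < r)%R -> (forall v, box z r v -> hom_diff f v) ->
  pfun (fun v => (cmod (f v) ^+ 2 * \1_(box z r) v)%:E) ->
  (cmod (f z) ^+ 2)%:E <= ((16 / r ^+ 2) ^+ n)%:E *
    cn_integral (fun v => (cmod (f v) ^+ 2 * \1_(box z r) v)%:E).
Proof.
move=> r0; elim: n f z => [|n IH] f z H mf /=.
  rewrite mul1e (_ : 0%R = z); last by apply/rowP => -[].
  by rewrite indicE mem_set ?mulr1//; case.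
have [w zE] := rowcK z; move: zE; set x0 := cre _; set y0 := cim _ => zE.
set rct := rect (x0 - r) (x0 + r) (y0 - r) (y0 + r).
pose g (t : cplx R) : cplx R := f (rowc (cre t) (cim t) w).
have ww : box w r w by move=> j; rewrite !subrr normr0 ltW.
pose Ef v : \bar R := (cmod (f v) ^+ 2 * \1_(box z r) v)%:E.
have Ef0 v : 0 <= Ef v by rewrite lee_fin mulr_ge0 ?sqr_ge0// indicE.
have [c1 c2 c3] := cn_slice mf Ef0.
set C : R := (16 / r ^+ 2)%R.
have C0 : (0 <= C)%R by rewrite divr_ge0// sqr_ge0.
have gE v : g v = f (rowc (cre v) (cim v) w) by [].
pose E (p : mR * mR) : \bar R := (cmod (g (mkc p.1 p.2)) ^+ 2 * \1_rct (mkc p.1 p.2))%:E.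
have EE p : E p = Ef (rowc p.1 p.2 w).
  rewrite /E /Ef zE indic_box_rowc gE /= [\1_(box w r) w]indicE mem_set// mulr1.
  by [].
have mE : measurable_fun setT E.
  rewrite (_ : E = fun p => Ef (rowc p.1 p.2 w)); last exact/funext.
  apply: (mf _ _ (fun p : mR * mR => rowc p.1 p.2 w)).
  by apply: mplot_rowc => // j; split; exact: measurable_cst.
have Hg t : rct t -> cdiff g t.
  move=> rt.
  pose v0 : 'rV[cplx R]_n.+1 := rowc 1 0 0.
  have -> : g = (fun s => f (rowc 0 0 w + s *: v0)%R).
    by apply/funext => s; rewrite rowc_line.
  by apply: hom_diff_line; rewrite rowc_line; apply: H; rewrite zE; apply/box_rowc; rewrite mkcK.
have E0 p : 0 <= E p by rewrite EE.
have E1 x y : rct (mkc x y) -> E (x, y) = (cmod (g (mkc x y)) ^+ 2)%:E.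
  by move=> h; rewrite /E /= indicE mem_set// mulr1.
have := mean_value1 r0 mE E0 E1 Hg.
rewrite gE !cplxE -zE => /le_trans; apply; rewrite -/C.
have CE : 0 <= C%:E by rewrite lee_fin.
rewrite [(C ^+ n.+1)%R]exprS [(C * C ^+ n)%:E]EFinM -[leRHS]muleA.
apply: (lee_wpmul2l CE).
have Cn0 : (0 <= C ^+ n)%R by rewrite exprn_ge0.
rewrite -ge0_integralZl//; last first.
  by move=> x _; apply: integral_ge0 => y _; apply: cn_ge0 => v; exact: Ef0.
have mEF := @measurable_fun_fubini_tonelli_F _ _ _ _ _ mu E mE E0.
apply: ge0_le_integral => //.
- by move=> x _; exact: integral_ge0.
- by apply: measurable_funeM; exact: c3.
move=> x _; rewrite -ge0_integralZl//; last 2 first.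
  - exact: c2.
  - by move=> y _; apply: cn_ge0 => v; exact: Ef0.
apply: ge0_le_integral => //.
- by apply: (measurableT_comp mE); exact: measurable_pair1.
- by apply: measurable_funeM; exact: c2.
move=> y _; rewrite EE /=.
(* Outside the square the left-hand side vanishes; inside it, the slice of the box is the box about
   [w], and the induction hypothesis applies to the slice of [f]. *)
have [xyR|xyR] := pselect (rct (mkc x y)); last first.
  apply: (@le_trans _ _ 0); last first.
    by apply: mule_ge0; [rewrite lee_fin|apply: cn_ge0 => v; exact: Ef0].
  by rewrite /Ef zE indic_box_rowc [\1_(rect _ _ _ _) _]indicE memNset// mul0r mulr0.
have sl v : Ef (rowc x y v) = (cmod (f (rowc x y v)) ^+ 2 * \1_(box w r) v)%:E.
  by rewrite /Ef zE indic_box_rowc [\1_(rect _ _ _ _) _]indicE mem_set// mul1r.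
under [X in _ <= _ * cn_integral X]eq_fun do rewrite -/(Ef _) sl.
apply: le_trans (IH (fun v => f (rowc x y v)) w _ _); first last.
- by under eq_fun do rewrite -sl; exact: pfun_slice mf.
- by move=> v vb; apply: hom_diff_slice; apply: H; rewrite zE; apply/box_rowc.
by rewrite sl indicE mem_set// mulr1.
Qed.

End CnIntegral.

(** * Positivity of the volume form *)

Section PairPerm.
Variables (n : nat).
Local Notation I := ('I_n * bool)%type.
(** The permutations that carry each pair [(i, false), (i, true)] onto a pair: they index the terms
    of the wedge power that survive in an orthogonal frame. *)
Definition pair_perm (s : {perm I}) := forall i, (s (i, true)).1 = (s (i, false)).1.

Lemma pair_perm_inj s : pair_perm s -> injective (fun i => (s (i, false)).1).
Proof.
move=> sP i k /= ik.
have sij j b : s (k, false) = s (j, b) -> k = j by move=> /perm_inj[].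
have pairE (p q : I) : p.1 = q.1 -> p.2 = q.2 -> p = q.
  by case: p q => [? ?] [? ?] /= -> ->.
have [e2|n2] := eqVneq (s (k, false)).2 (s (i, false)).2.
  by rewrite (sij i false)//; apply: (pairE).
rewrite (sij i true)//; apply: (pairE); first by rewrite sP.
have : (s (i, true)).2 != (s (i, false)).2.
  apply/eqP => h; have := pairE _ _ (sP i) h; by move=> /perm_inj[].
by move: n2; case: (s (k, false)).2; case: (s (i, false)).2; case: (s (i, true)).2.
Qed.

(** Such a permutation moves the pairs as blocks, which is even because a swap of two blocks is a
    product of two transpositions, and then exchanges the members of some pairs. Its parity is that
    of the number of exchanges. *)
Lemma odd_perm_pairs (s : {perm I}) : pair_perm s ->
  odd_perm s = \big[addb/false]_(i < n) (s (i, false)).2.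
Proof.
(* The first sum counts the displaced pairs and the second also the exchanged ones. Putting a block
   in place decreases the first without increasing the second; an exchange within a pair in place
   decreases the second and leaves the first. *)
pose mu (s : {perm I}) := 
  (\sum_(i < n) ((s (i, false)).1 != i) + \sum_(i < n) (s (i, false) != (i, false)))%N.
have [m] := ubnP (mu s); elim: m s => // m IH s; rewrite ltnS => sm sP.
have pinj := pair_perm_inj sP.
case: (pickP [pred i | (s (i, false)).1 != i]) => [i /=|fix1].
  set j := (s (i, false)).1 => ji.
  (* Swaps the blocks [i] and [j], so it is even and keeps the second components. *)
  pose t : {perm I} := (tperm (i, false) (j, false) * tperm (i, true) (j, true))%g.
  have tt (b : bool) k : tperm (i, b) (j, b) (k, b) = (tperm i j k, b).
    case: (tpermP i j k) => [->|->|/eqP n1 /eqP n2]; rewrite ?tpermL ?tpermR// tpermD//.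
      by rewrite xpair_eqE eqxx andbT eq_sym.
    by rewrite xpair_eqE eqxx andbT eq_sym.
  have tn (b c : bool) k : b != c -> tperm (i, b) (j, b) (k, c) = (k, c).
    by move=> bc; rewrite tpermD// xpair_eqE (negbTE bc) andbF.
  have tE k b : t (k, b) = (tperm i j k, b).
    by rewrite permM; case: b; [rewrite (tn false true)// (tt true)|rewrite (tt false) (tn true false)].
  have stE k b : (s * t)%g (k, b) = (tperm i j (s (k, b)).1, (s (k, b)).2).
    by rewrite permM {1}[s (k, b)]surjective_pairing tE.
  have odd_t : odd_perm t = false.
    by rewrite odd_permM !odd_tperm !xpair_eqE !eqxx !andbT addbb.
  have keep k : (s (k, false)).1 = k -> (s * t)%g (k, false) = s (k, false).
    move=> sk; rewrite stE [RHS]surjective_pairing sk; congr (_, _); apply: tpermD.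
      by apply/eqP => ik; move: sk ji; rewrite -ik -/j => ->; rewrite eqxx.
    apply/eqP => jk; have := pinj i k; rewrite sk -jk => /(_ erefl) ij.
    by move: ji; rewrite ij eqxx.
  have := IH (s * t)%g; rewrite odd_permM odd_t addbF => ->.
  - by apply: eq_bigr => k _; rewrite stE.
  - apply: leq_trans sm; rewrite /mu -addSn leq_add//.
      rewrite (bigD1 i)//= [X in (_ <= X)%N](bigD1 i)//= ji stE -/j tpermR eqxx add0n add1n ltnS.
      apply: leq_sum => k _; have [sk|] := eqVneq (s (k, false)).1 k; last by rewrite leq_b1.
      by rewrite keep// sk eqxx.
    apply: leq_sum => k _; have [sk|] := eqVneq (s (k, false)) (k, false).
      by rewrite keep ?sk//= eqxx.
    by rewrite leq_b1.
  - by move=> k; rewrite !stE sP.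
have fixi i : (s (i, false)).1 = i by apply/eqP; have := fix1 i => /= /negbFE.
case: (pickP [pred i | (s (i, false)).2]) => [i /= bi|fix2].
  (* Every pair is now in place; [t] exchanges the members of pair [i] and changes both parities. *)
  pose t : {perm I} := tperm (i, false) (i, true).
  have sif : s (i, false) = (i, true).
    by rewrite [LHS]surjective_pairing fixi bi.
  have fixb k b : (s (k, b)).1 = k by case: b; rewrite ?sP fixi.
  have keep k b : k != i -> (s * t)%g (k, b) = s (k, b).
    move=> ki; rewrite permM; have := fixb k b; case: (s (k, b)) => [a c] /= ->.
    by rewrite tpermD// xpair_eqE eq_sym (negbTE ki).
  have sti : (s * t)%g (i, false) = (i, false) by rewrite permM sif tpermR.
  have stP b : ((s * t)%g (i, b)).1 = i.
    rewrite permM; have := fixb i b; case: (s (i, b)) => [a c] /= ->.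
    by case: c; rewrite ?tpermR ?tpermL.
  have := IH (s * t)%g; rewrite odd_permM odd_tperm xpair_eqE andbF addbT => h; rewrite -[LHS]negbK h.
  - rewrite (bigD1 i)//= [RHS](bigD1 i)//= sti bi addTb addFb; congr (~~ _).
    by apply: eq_bigr => k ki; rewrite keep.
  - apply: leq_trans sm; rewrite /mu -addnS leq_add//.
      by apply: leq_sum => k _; rewrite fixi eqxx; have [->|ki] := eqVneq k i;
        rewrite ?sti ?keep ?fixi//= eqxx.
    rewrite [X in (_ <= X)%N](bigD1 i)//= (bigD1 i)//= sti eqxx sif xpair_eqE andbF add0n add1n ltnS.
    by apply: leq_sum => k ki; rewrite keep.
  - by move=> k; have [->|ki] := eqVneq k i; rewrite ?stP// !keep.
have -> : s = 1%g.
  apply/permP => -[i b]; rewrite perm1.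
  have sf : s (i, false) = (i, false).
    by rewrite [LHS]surjective_pairing fixi; have := fix2 i => /= ->.
  case: b => //; have := sP i; rewrite sf /=.
  case E1 : (s (i, true)) => [a []] /= ai; first by rewrite ai.
  by move: E1; rewrite ai -sf => /perm_inj.
rewrite odd_perm1 big1// => i _; by rewrite perm1.
Qed.
End PairPerm.

(** * The top wedge power of a positive (1,1)-form *)

Section WedgePower.
Variables (R : realType) (n : nat).
Local Notation V := 'rV[cplx R]_n.
Local Notation I := ('I_n * bool)%type.
Variable om : V -> V -> R.
Hypothesis om_linear : forall (a : R) u u' v,
  om (mkc a 0 *: u + u') v = a * om u v + om u' v.
Hypothesis om_antisym : forall u v, om u v = - om v u.
Hypothesis om_type11 : forall u v, om (ci R *: u) (ci R *: v) = om u v.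
Hypothesis om_positive : forall u, u != 0 -> 0 < om u (ci R *: u).

Lemma omDl u u' v : om (u + u') v = om u v + om u' v.
Proof. by have := om_linear 1 u u' v; rewrite mul1r; have -> : mkc 1 0 *: u = u by exact: scale1r. Qed.
Lemma om0l v : om 0 v = 0.
Proof. by have := omDl 0 0 v; rewrite addr0 => /eqP;
  rewrite -subr_eq0 opprD addrA subrr sub0r oppr_eq0 => /eqP. Qed.
Lemma omZl (a : R) u v : om (mkc a 0 *: u) v = a * om u v.
Proof. by have := om_linear a u 0 v; rewrite addr0 om0l addr0. Qed.
Lemma omDr u v v' : om u (v + v') = om u v + om u v'.
Proof. by rewrite om_antisym omDl opprD -!om_antisym. Qed.
Lemma omZr (a : R) u v : om u (mkc a 0 *: v) = a * om u v.
Proof. by rewrite om_antisym omZl -mulrN -om_antisym. Qed.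

Lemma ci2 : ci R * ci R = -1.
Proof. by apply: cplxP; rewrite !cplxE; ring. Qed.

Lemma om_ci u v : om (ci R *: u) v = - om u (ci R *: v).
Proof.
rewrite -[LHS]om_type11 scalerA ci2.
have -> : (-1 : cplx R) = mkc (-1) 0 by apply: cplxP; rewrite !cplxE ?oppr0.
by rewrite omZl mulN1r.
Qed.

Local Notation W := (wedge_power om).

Definition upd (e : I -> V) (k : I) (v : V) : I -> V := fun l => if l == k then v else e l.

Definition term (e : I -> V) (s : {perm I}) : R :=
  (-1) ^+ (odd_perm s) * \prod_(i < n) om (e (s (i, false))) (e (s (i, true))).

(** A permutation uses the index [k] in exactly one of the factors, so each term is linear in the
    argument at [k]: [f] is that factor, and [c] collects the sign and the other factors. *)
Lemma prod_term (e : I -> V) (s : {perm I}) (k : I) :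
  exists c : R, exists2 f : V -> R, (forall v v', f (v + v') = f v + f v') /\
    (forall (a : R) v, f (mkc a 0 *: v) = a * f v) &
    forall v, term (upd e k v) s = c * f v.
Proof.
have [[i b] sE] : exists j, s j = k by exists (s^-1%g k); rewrite permKV.
exists ((-1) ^+ (odd_perm s) * \prod_(j < n | j != i) om (e (s (j, false))) (e (s (j, true)))).
have nk j c : j != i -> (s (j, c) == k) = false.
  by move=> ji; rewrite -sE (inj_eq perm_inj) xpair_eqE (negbTE ji).
have nb : (s (i, ~~ b) == k) = false.
  by rewrite -sE (inj_eq perm_inj) xpair_eqE eqxx /=; case: b sE.
exists (fun v => if b then om (e (s (i, false))) v else om v (e (s (i, true)))).
  by split => [v v'|a v]; case: b sE nb => *; rewrite ?omDl ?omDr ?omZl ?omZr.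
move=> v; rewrite /term (bigD1 i)//= mulrCA mulrC; congr (_ * _ * _).
  by apply: eq_bigr => j ji; rewrite /upd !nk.
by case: b sE nb => sE nb; rewrite /upd sE eqxx nb.
Qed.

Lemma wedgeE e : W e = (2 ^+ n)^-1 * \sum_(s : {perm I}) term e s.
Proof. by []. Qed.

Lemma wedge_updD e k v v' : W (upd e k (v + v')) = W (upd e k v) + W (upd e k v').
Proof.
rewrite !wedgeE -mulrDr -big_split; congr (_ * _); apply: eq_bigr => s _ /=.
by have [c [f [fD _] tE]] := prod_term e s k; rewrite !tE fD mulrDr.
Qed.

Lemma wedge_updZ e k (a : R) v : W (upd e k (mkc a 0 *: v)) = a * W (upd e k v).
Proof.
rewrite !wedgeE [RHS]mulrCA; congr (_ * _); rewrite mulr_sumr; apply: eq_bigr => s _ /=.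
by have [c [f [_ fZ] tE]] := prod_term e s k; rewrite !tE fZ mulrCA.
Qed.

(** Composition with the transposition of [k] and [l] permutes the terms, keeps their factors and
    reverses their signs. *)
Lemma wedge_alt (e : I -> V) (k l : I) : k != l -> e k = e l -> W e = 0.
Proof.
move=> kl ekl; rewrite wedgeE.
have : \sum_(s : {perm I}) term e s = - \sum_(s : {perm I}) term e s.
  rewrite {1}(reindex_inj (mulIg (tperm k l))) /= -sumrN; apply: eq_bigr => s _.
  rewrite /term odd_permM odd_tperm kl addbT.
  have -> : ((-1) ^+ (~~ odd_perm s) : R) = - (-1) ^+ (odd_perm s).
    by case: (odd_perm s); rewrite ?expr1 ?expr0 ?opprK.
  rewrite mulNr; congr (- (_ * _)); apply: eq_bigr => i _.
  have et x : e (tperm k l x) = e x by case: tpermP => // ->.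
  by rewrite !permM !et.
move=> /eqP; rewrite -subr_eq0 opprK -mulr2n mulrn_eq0 /= => /eqP ->.
by rewrite mulr0.
Qed.

Lemma upd_id e k : upd e k (e k) = e.
Proof. by apply/funext => l; rewrite /upd; case: eqVneq => // ->. Qed.

Lemma wedge_add e k l (a : R) : k != l -> W (upd e k (e k + mkc a 0 *: e l)) = W e.
Proof.
move=> kl; rewrite wedge_updD upd_id wedge_updZ (@wedge_alt (upd e k (e l)) k l kl) ?mulr0 ?addr0//.
by rewrite /upd eqxx eq_sym (negbTE kl).
Qed.

Definition cframe (v : 'I_n -> V) (k : I) : V := if k.2 then ci R *: v k.1 else v k.1.

Definition vupd (v : 'I_n -> V) k x : 'I_n -> V := fun l => if l == k then x else v l.

(** Adding [c v_l] to [v_k] is the composite of four real column operations on the frame, two on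
    [v_k] and two on [i v_k], all by multiples of [v_l] and [i v_l]; [wedge_add] applies to each. *)
Lemma wedge_cadd (v : 'I_n -> V) k l (c : cplx R) : k != l ->
  W (cframe (vupd v k (v k + c *: v l))) = W (cframe v).
Proof.
move=> kl; pose e0 := cframe v.
pose e1 := upd e0 (k, false) (e0 (k, false) + mkc (cre c) 0 *: e0 (l, false)).
pose e2 := upd e1 (k, false) (e1 (k, false) + mkc (cim c) 0 *: e1 (l, true)).
pose e3 := upd e2 (k, true) (e2 (k, true) + mkc (cre c) 0 *: e2 (l, true)).
pose e4 := upd e3 (k, true) (e3 (k, true) + mkc (- cim c) 0 *: e3 (l, false)).
have -> : cframe (vupd v k (v k + c *: v l)) = e4.
  apply/funext => -[j b]; rewrite /e4 /e3 /e2 /e1 /e0 /upd /cframe /vupd /=.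
  rewrite !xpair_eqE !eqxx /= (eq_sym l k) (negbTE kl) /=.
  have [->|jk] := eqVneq j k; case: b => //=; last first.
    rewrite -!addrA; congr (_ + _); rewrite !scalerA -scalerDl; congr (_ *: _).
    by apply: cplxP; rewrite !cplxE; ring.
  rewrite scalerDr -!addrA; congr (_ + _); rewrite !scalerA -scalerDl; congr (_ *: _).
  by apply: cplxP; rewrite !cplxE; ring.
have n1 b b' : (k, b) != (l, b') :> I by rewrite xpair_eqE (negbTE kl).
by rewrite /e4 wedge_add// /e3 wedge_add// /e2 wedge_add// /e1 wedge_add.
Qed.

Lemma vupd_vupd v k x y : vupd (vupd v k x) k y = vupd v k y.
Proof. by apply/funext => l; rewrite /vupd; case: (l == k). Qed.

Lemma wedge_csum (v : 'I_n -> V) k (c : 'I_n -> cplx R) (r : seq 'I_n) : k \notin r ->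
  W (cframe (vupd v k (v k + \sum_(l <- r) c l *: v l))) = W (cframe v).
Proof.
elim: r => [_|l r IH].
  rewrite big_nil addr0; congr (W (cframe _)).
  by apply/funext => j; rewrite /vupd; case: eqVneq => // ->.
rewrite inE negb_or => /andP[kl kr]; rewrite -(IH kr).
pose v' := vupd v k (v k + \sum_(j <- r) c j *: v j).
rewrite -[RHS](wedge_cadd v' (c l) kl) /v' vupd_vupd big_cons.
by congr (W (cframe (vupd v k _))); rewrite /vupd eqxx eq_sym (negbTE kl) addrCA addrC.
Qed.

(** Orthogonality for the Hermitian inner product whose real and imaginary parts are, up to sign,
    [om u (ci R *: v)] and [om u v]. *)
Definition orth u v := om u v = 0 /\ om u (ci R *: v) = 0.

Lemma om_cscale (c : cplx R) u v :
  om (c *: u) v = cre c * om u v + cim c * om (ci R *: u) v.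
Proof.
have -> : c *: u = mkc (cre c) 0 *: u + mkc (cim c) 0 *: (ci R *: u).
  by rewrite scalerA -scalerDl; congr (_ *: _); apply: cplxP; rewrite !cplxE; ring.
by rewrite omDl !omZl.
Qed.

Lemma orth_sym u v : orth u v -> orth v u.
Proof.
move=> [h1 h2]; split; first by rewrite om_antisym h1 oppr0.
by rewrite om_antisym om_ci h2 !oppr0.
Qed.

Lemma om_self u : om u u = 0.
Proof.
have := om_antisym u u => /eqP; rewrite -subr_eq0 opprK -mulr2n mulrn_eq0 /=.
by move=> /eqP.
Qed.

(* The change of basis is unitriangular, hence preserves the wedge power. *)
Lemma gram_schmidt (m : nat) : (m <= n)%N -> exists v : 'I_n -> V,
  [/\ W (cframe v) = W (cframe (fun i => delta_mx 0 i)),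
      forall i : 'I_n, (m <= i)%N -> v i = delta_mx 0 i,
      forall i j : 'I_n, (i < j)%N -> v i 0 j = 0,
      forall i : 'I_n, v i 0 i = 1 &
      forall i j : 'I_n, (i < m)%N -> (j < m)%N -> i != j -> orth (v i) (v j)].
Proof.
elim: m => [_|m IH mn].
  exists (fun i => delta_mx 0 i); split => //.
    by move=> i j ij; rewrite mxE eqxx /= -(inj_eq val_inj) /= gtn_eqF.
  by move=> i; rewrite mxE !eqxx.
have [v [vW vm vtri v1 vorth]] := IH (ltnW mn).
pose k := Ordinal mn.
pose lam (j : 'I_n) := om (v j) (ci R *: v j).
have lam0 j : 0 < lam j.
  apply: om_positive; apply/eqP => /(congr1 (fun w : V => w 0 j)).
  by rewrite v1 mxE => /eqP; rewrite oner_eq0.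
(* Solves both equations of [orth]: [om (c *: v j) (v j)] is [- cim c * lam j], and
   [om (c *: v j) (ci R *: v j)] is [cre c * lam j]. *)
pose c (j : 'I_n) := mkc (- (om (v k) (ci R *: v j) / lam j)) (om (v k) (v j) / lam j).
pose r : seq 'I_n := seq.filter (fun j : 'I_n => (j < m)%N) (index_enum _).
have rP j : (j \in r) = (j < m)%N by rewrite mem_filter mem_index_enum andbT.
have ur : uniq r by rewrite filter_uniq// index_enum_uniq.
have kr : k \notin r by rewrite rP /= ltnn.
exists (vupd v k (v k + \sum_(l <- r) c l *: v l)); split.
- by rewrite wedge_csum.
- by move=> i mi; rewrite /vupd ifN ?vm// ?(ltnW mi)//; apply/eqP => ik; rewrite ik /= ltnn in mi.
- move=> i j ij; rewrite /vupd; case: eqVneq => [ik|_]; last exact: vtri.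
  rewrite mxE vtri -?ik// add0r summxE big1_seq// => l /andP[_]; rewrite rP => lm.
  by rewrite mxE vtri ?mulr0//; apply: ltn_trans ij; rewrite ik.
- move=> i; rewrite /vupd; case: eqVneq => [->|_]; last exact: v1.
  rewrite mxE v1 summxE big1_seq ?addr0// => l /andP[_]; rewrite rP => lm.
  by rewrite mxE vtri ?mulr0.
have ok (j : 'I_n) : (j < m)%N -> orth (v k + \sum_(l <- r) c l *: v l) (v j).
  move=> jm.
  have sumE w : om (\sum_(l <- r) c l *: v l) w = \sum_(l <- r) om (c l *: v l) w.
    exact: (big_morph (fun u => om u w) (fun a b => omDl a b w) (om0l w)).
  have jr : j \in r by rewrite rP.
  have other l : l \in r -> l != j -> orth (v l) (v j).
    by rewrite rP => lm lj; exact: vorth.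
  have lj0 : lam j != 0 by rewrite gt_eqF.
  split.
    rewrite omDl sumE (bigD1_seq j)//= big1_seq ?addr0; last first.
      move=> l /andP[lj lr]; have [h1 h2] := other _ lr lj.
      by rewrite om_cscale om_ci h1 h2 oppr0 !mulr0 addr0.
    by rewrite om_cscale om_ci om_self -/(lam j) !cplxE; field.
  rewrite omDl sumE (bigD1_seq j)//= big1_seq ?addr0; last first.
    move=> l /andP[lj lr]; have [h1 h2] := other _ lr lj.
    by rewrite om_cscale om_type11 h1 h2 !mulr0 addr0.
  by rewrite om_cscale om_type11 om_self -/(lam j) !cplxE; field.
move=> i j; rewrite !ltnS /vupd => im jm ij.
have [ik|ik] := eqVneq i k; have [jk|jk] := eqVneq j k.
- by rewrite ik jk eqxx in ij.
- by apply: ok; rewrite ltn_neqAle jm andbT.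
- by apply: orth_sym; apply: ok; rewrite ltn_neqAle im andbT.
- by apply: vorth => //; rewrite ltn_neqAle ?im ?jm andbT.
Qed.

Lemma cframe_orth v (p q : I) :
  (forall i j, i != j -> orth (v i) (v j)) -> p.1 != q.1 ->
  om (cframe v p) (cframe v q) = 0.
Proof.
case: p q => [i b] [j c] o /= /(o i j)[h1 h2].
by case: b; case: c; rewrite /cframe /= ?om_type11 ?om_ci ?h1 ?h2 ?oppr0.
Qed.

(** In an orthogonal frame a term vanishes unless its permutation preserves the pairs. In the other
    terms each exchanged pair contributes a factor [-1], and these signs cancel the sign of the
    permutation by [odd_perm_pairs]. The identity gives a positive term. *)
Lemma wedge_orth_gt0 v : (forall i, v i != 0) ->
  (forall i j, i != j -> orth (v i) (v j)) -> 0 < W (cframe v).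
Proof.
move=> v0 vo; pose lam i := om (v i) (ci R *: v i).
have lam0 i : 0 < lam i by exact: om_positive.
rewrite wedgeE; apply: mulr_gt0; first by rewrite invr_gt0 exprn_gt0.
have t0 s : 0 <= term (cframe v) s.
  have [/forallP sP|] := boolP [forall i, (s (i, true)).1 == (s (i, false)).1]; last first.
    rewrite negb_forall => /existsP[i si]; rewrite /term (bigD1 i)//= cframe_orth ?mul0r ?mulr0//.
    by rewrite eq_sym.
  have {}sP : pair_perm s by move=> i; apply/eqP.
  rewrite /term (odd_perm_pairs sP).
  have -> : \prod_(i < n) om (cframe v (s (i, false))) (cframe v (s (i, true))) =
      (-1) ^+ (\big[addb/false]_(i < n) (s (i, false)).2) * \prod_(i < n) lam (s (i, false)).1.
    rewrite (big_morph (fun b : bool => (-1) ^+ b : R) (@signr_addb _) (erefl _)) -big_split.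
    apply: eq_bigr => i _ /=; have := sP i; have := @perm_inj _ s (i, true) (i, false).
    case: (s (i, false)) (s (i, true)) => [a b] [a' b'] h /= aa; rewrite aa in h *.
    have {h} : b' != b by apply/eqP => bb; move: h; rewrite bb => /(_ erefl).
    case: b; case: b' => //= _; rewrite /cframe /= ?expr0 ?mul1r// expr1 mulN1r.
    by rewrite om_antisym.
  by rewrite mulrA -signr_addb addbb expr0 mul1r prodr_ge0// => i _; apply: ltW.
rewrite (bigD1 1%g)//= ltr_pwDl//; last exact: sumr_ge0.
rewrite /term odd_perm1 expr0 mul1r prodr_gt0// => i _; rewrite !perm1 /cframe /=; exact: lam0.
Qed.

Lemma wedge_power_gt0 : 0 < W (@real_frame R n).
Proof.
have [v [vW _ _ v1 vo]] := gram_schmidt (leqnn n).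
have -> : @real_frame R n = cframe (fun i => delta_mx 0 i).
  by apply/funext => -[i b]; rewrite /real_frame /cframe /=; case: b; rewrite ?scale1r.
rewrite -vW; apply: wedge_orth_gt0 => [i|i j]; last exact: vo.
by apply/eqP => /(congr1 (fun w : V => w 0 i)) /eqP; rewrite v1 mxE oner_eq0.
Qed.

End WedgePower.

(** * Locally uniform limits of holomorphic functions *)

Section UniformLimits.
Variable R : realType.
Implicit Type n : nat.

Lemma cplx_cauchy (u : nat -> cplx R) :
  (forall e : R, 0 < e -> exists m, forall k l, (m <= k)%N -> (m <= l)%N -> cmod (u k - u l) <= e) ->
  exists l, forall e : R, 0 < e -> exists m, forall k, (m <= k)%N -> cmod (u k - l) <= e.
Proof.
move=> H.
have real (v : nat -> R) : (forall k l, `|v k - v l| <= cmod (u k - u l)) ->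
    exists l, forall e : R, 0 < e -> exists m, forall k, (m <= k)%N -> `|v k - l| <= e.
  move=> vu; have /cauchy_cvgP cv : cauchy (v @ \oo).
    apply: cauchy_exP => e e0; have [m mP] := H _ (divr_gt0 e0 (ltr0Sn _ 1)).
    exists (v m); exists m => // k /= mk; rewrite /ball /= (le_lt_trans (vu _ _))//.
    by apply: (le_lt_trans (mP m k _ mk)) => //; rewrite ltr_pdivrMr// ltr_pMr// ltr1n.
  exists (lim (v @ \oo)) => e e0; have /cvgrPdist_le/(_ e e0)[m _ mP] := cv.
  by exists m => k mk; rewrite distrC; exact: mP.
have [|a aP] := real (fun k => cre (u k)); first by move=> k l; rewrite -creB; exact: ler_cre.
have [|b bP] := real (fun k => cim (u k)); first by move=> k l; rewrite -cimB; exact: ler_cim.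
exists (mkc a b) => e e0; have e20 : 0 < e / 2 by rewrite divr_gt0.
have [m1 h1] := aP _ e20; have [m2 h2] := bP _ e20; exists (maxn m1 m2) => k.
rewrite geq_max => /andP[/h1{}h1 /h2{}h2]; apply: (le_trans (cmod_le _)).
by rewrite !cplxE (splitr e) lerD.
Qed.

Definition linrow n (a : 'I_n -> cplx R) (h : 'rV[cplx R]_n) : cplx R :=
  \sum_j h 0 j * a j.

Lemma linrow_linear n (a : 'I_n -> cplx R) : linear (linrow a).
Proof.
move=> c v w; rewrite /linrow scaler_sumr -big_split; apply: eq_bigr => j _ /=.
by rewrite !mxE mulrDl -mulrA.
Qed.
HB.instance Definition _ n (a : 'I_n -> cplx R) :=
  GRing.isLinear.Build (cplx R) 'rV[cplx R]_n (cplx R) _ (linrow a) (linrow_linear a).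

Lemma linrow_le n (a : 'I_n -> cplx R) (h : 'rV[cplx R]_n) (C : R) :
  (forall j, cmod (a j) <= C) -> cmod (linrow a h) <= n%:R * C * vmod h.
Proof.
move=> aC; apply: (le_trans (cmod_sum _ _ _)).
have -> : n%:R * C * vmod h = \sum_(j < n) C * vmod h.
  by rewrite sumr_const card_ord -[RHS]mulr_natl mulrA.
by apply: ler_sum => j _; rewrite cmodM mulrC ler_pM ?cmod_ge0 ?cmod_entry.
Qed.

(** The derivative is recorded by its coefficients [a], so that a limit of derivatives can be taken
    entry by entry. *)
Definition holo n (f : 'rV[cplx R]_n -> cplx R) z :=
  exists a : 'I_n -> cplx R, forall e : R, 0 < e -> exists2 r : R, 0 < r &
    forall h, vmod h < r -> cmod (f (z + h) - f z - linrow a h) <= e * vmod h.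

Lemma holoP n (f : 'rV[cplx R]_n -> cplx R) z : differentiable f z <-> holo f z.
Proof.
split=> [df|[a aP]].
  exists (fun j => 'd f z (delta_mx 0 j)) => e e0.
  have [r r0 rP] := differentiable_eps df e0; exists r => // h /rP.
  rewrite vmod_cmod; congr (cmod (_ - _) <= _).
  rewrite {1}[h]row_sum_delta linear_sum; apply: eq_bigr => j _.
  by rewrite linearZ.
apply: (@eps_differentiable R _ _ f z (linrow a) (n%:R * (\sum_j cmod (a j)))) => [h|e /aP[r r0 rP]].
  rewrite vmod_cmod; apply: linrow_le => j.
  by rewrite (bigD1 j)//= lerDl sumr_ge0// => i _; exact: cmod_ge0.
by exists r => // h /rP; rewrite vmod_cmod.
Qed.

Lemma holo_hom_diff n (f : 'rV[cplx R]_n -> cplx R) z : holo f z -> hom_diff f z.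
Proof. by move=> [a aP]; exists (linrow a) => // c v; rewrite linearZ. Qed.

Lemma holo_cst n (c : cplx R) (z : 'rV[cplx R]_n) : holo (fun=> c) z.
Proof.
exists (fun=> 0) => e e0; exists 1 => // h _.
by rewrite subrr /linrow big1 ?subr0 ?cmod0 ?mulr_ge0 ?vmod_ge0 ?ltW// => j _; rewrite mulr0.
Qed.

Lemma holo_addZ n (c : cplx R) (f g : 'rV[cplx R]_n -> cplx R) z :
  holo f z -> holo g z -> holo (fun v => f v + c * g v) z.
Proof.
move=> [a aP] [b bP]; exists (fun j => a j + c * b j) => e e0.
have c0 : 0 < 2 * (cmod c + 1) by rewrite mulr_gt0// ltr_pwDr// cmod_ge0.
have [r r0 rP] := aP _ (divr_gt0 e0 (ltr0Sn _ 1)).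
have [s s0 sP] := bP _ (divr_gt0 e0 c0).
exists (Num.min r s); first by rewrite lt_min r0.
move=> h; rewrite lt_min => /andP[/rP h1 /sP h2].
have -> : linrow (fun j => a j + c * b j) h = linrow a h + c * linrow b h.
  by rewrite /linrow mulr_sumr -big_split; apply: eq_bigr => j _ /=; ring.
have -> : f (z + h) + c * g (z + h) - (f z + c * g z) - (linrow a h + c * linrow b h) =
  (f (z + h) - f z - linrow a h) + c * (g (z + h) - g z - linrow b h) by ring.
apply: (le_trans (cmodD _ _)); rewrite cmodM (splitr e) mulrDl lerD//.
apply: (le_trans (ler_wpM2l (cmod_ge0 c) h2)).
rewrite mulrA ler_wpM2r ?vmod_ge0// mulrCA ler_wpM2l ?(ltW e0)//.
rewrite invfM mulrCA ger_pMr// ler_pdivrMr ?mul1r ?lerDl// ltr_pwDr//.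
exact: cmod_ge0.
Qed.

Lemma holo_sum n (m : nat) (P : pred nat) (c : nat -> cplx R) (f : nat -> 'rV[cplx R]_n -> cplx R) z :
  (forall j, P j -> holo (f j) z) -> holo (fun v => \sum_(j < m | P j) c j * f j v) z.
Proof.
move=> fP; elim: m => [|m IH].
  under [X in holo X]eq_fun do rewrite big_ord0.
  exact: holo_cst.
under [X in holo X]eq_fun do rewrite big_mkcond big_ord_recr -big_mkcond /=.
have [/fP Pm|nP] := boolP (P m); first exact: holo_addZ.
by under [X in holo X]eq_fun do rewrite addr0.
Qed.

Lemma box_refl n (z : 'rV[cplx R]_n) (r : R) : 0 <= r -> box z r z.
Proof. by move=> r0 j; rewrite !subrr normr0. Qed.

(** [cauchy_lipschitz] on the complex line through [z] in the direction of [h], normalized to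
    [vmod u = 1]. The square of half side [r / 2] in the parameter stays in the box, whence the
    constant [32 / (r / 2) = 64 / r]. *)
Lemma holo_lipschitz n (f : 'rV[cplx R]_n -> cplx R) z (r e : R) : 0 < r ->
  (forall v, box z r v -> holo f v /\ cmod (f v) <= e) ->
  forall h, vmod h <= r / 4 -> cmod (f (z + h) - f z) <= 64 * e / r * vmod h.
Proof.
move=> r0 H h hr.
have [h0|h0] := eqVneq (vmod h) 0.
  have -> : h = 0.
    apply/rowP => j; apply/eqP; rewrite mxE -cmod_eq0 eq_le cmod_ge0 andbT -h0.
    exact: cmod_entry.
  by rewrite addr0 subrr cmod0 vmod0 mulr0.
have {}h0 : 0 < vmod h by rewrite lt_def h0 vmod_ge0.
pose u := mkc (vmod h)^-1 0 *: h.
have u1 : vmod u = 1 by rewrite vmodZ cmod_real gtr0_norm ?invr_gt0// mulVf ?gt_eqF.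
have hu : h = mkc (vmod h) 0 *: u.
  by rewrite scalerA mkcM0 divff ?gt_eqF//; exact/esym/scale1r.
have tr : cmod (mkc (vmod h) 0) <= r / 2 / 2 by rewrite cmod_real gtr0_norm//; lra.
have := @cauchy_lipschitz R (fun t => f (z + t *: u)) (r / 2) e _ (divr_gt0 r0 (ltr0Sn _ 1)) _ tr.
rewrite -hu scale0r addr0 cmod_real gtr0_norm// => E.
have -> : 64 * e / r * vmod h = 32 * e * vmod h / (r / 2).
  by move: r0; clear; move=> r0; field; rewrite gt_eqF.
apply: E => t [/andP[t1 t2] /andP[t3 t4]].
have bt : box z r (z + t *: u).
  apply: vmod_box; rewrite opprD addrA subrr sub0r vmodN vmodZ u1 mulr1.
  apply: (le_trans (cmod_le _)); rewrite (splitr r) lerD// ler_norml; apply/andP; split=> //.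
have [hf hM] := H _ bt; split => //.
by apply: hom_diff_line; exact: holo_hom_diff.
Qed.

(** Cauchy's estimate is applied to the differences [F k - F l]: near [z] their Lipschitz constants
    tend to [0]. So the derivatives at [z] form a Cauchy sequence, and the first-order expansion
    passes to the limit with an error proportional to [vmod h]. *)
Lemma holo_limit n (F : nat -> 'rV[cplx R]_n -> cplx R) (G : 'rV[cplx R]_n -> cplx R) z (r : R) :
  0 < r -> (forall k v, box z r v -> holo (F k) v) ->
  (forall e : R, 0 < e -> exists m, forall k v, (m <= k)%N -> box z r v ->
     cmod (F k v - G v) <= e) ->
  holo G z.
Proof.
move=> r0 hF FG.
have r4 : 0 < r / 4 by rewrite divr_gt0.
have bz h : vmod h <= r / 4 -> box z r (z + h).
  move=> hr; apply: vmod_box; rewrite opprD addrA subrr sub0r vmodN; apply: le_trans hr _; lra.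
have FF (e : R) : 0 < e -> exists m, forall k l v, (m <= k)%N -> (m <= l)%N -> box z r v ->
    cmod (F k v - F l v) <= e.
  move=> e0; have [m mP] := FG _ (divr_gt0 e0 (ltr0Sn _ 1)); exists m => k l v mk ml zv.
  have -> : F k v - F l v = (F k v - G v) + (G v - F l v) by ring.
  by apply: (le_trans (cmodD _ _)); rewrite (splitr e) lerD ?mP// cmodB mP.
have lip (e : R) : 0 < e -> exists m, forall k l h, (m <= k)%N -> (m <= l)%N -> vmod h <= r / 4 ->
    cmod ((F k (z + h) - F l (z + h)) - (F k z - F l z)) <= e * vmod h.
  move=> e0; have e1 : 0 < e * r / 64 by rewrite divr_gt0 ?mulr_gt0.
  have [m mP] := FF _ e1; exists m => k l h mk ml hr.
  have -> : e = 64 * (e * r / 64) / r by move: r0; clear; move=> r0; field; rewrite gt_eqF.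
  apply: (@holo_lipschitz _ (fun v => F k v - F l v) z r (e * r / 64)) => // v zv.
  split; last exact: mP.
  have -> : (fun v => F k v - F l v) = (fun v => F k v + (- 1) * F l v).
    by apply/funext => w; rewrite mulN1r.
  by apply: holo_addZ; exact: hF.
have [a aP] := choice (fun k => hF k z (box_refl z (ltW r0))).
have aC (e : R) : 0 < e -> exists m, forall k l h, (m <= k)%N -> (m <= l)%N ->
    cmod (linrow (a k) h - linrow (a l) h) <= e * vmod h.
  move=> e0; have [m mP] := lip _ (divr_gt0 e0 (ltr0Sn _ 1)); exists m => k l h mk ml.
  have e4 : 0 < e / 2 / 2 by rewrite !divr_gt0.
  have [s s0 sP] := aP k _ e4; have [s' s'0 s'P] := aP l _ e4.
  have v1 : 0 < vmod h + 1 by rewrite ltr_pwDr// vmod_ge0.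
  (* The radii [s] and [s'] of the expansions of [F k] and [F l] depend on [k] and [l]. Hence [h] is
     scaled into all of them by [t], and linearity of [linrow] scales the inequality back. *)
  pose w := Num.min (Num.min s s') (r / 4).
  have w0 : 0 < w by rewrite !lt_min s0 s'0.
  pose t := w / (vmod h + 1); have t0 : 0 < t by rewrite divr_gt0.
  have th : vmod (mkc t 0 *: h) = t * vmod h by rewrite vmodZ cmod_real gtr0_norm.
  have : vmod (mkc t 0 *: h) < w.
    by rewrite th /t mulrAC ltr_pdivrMr// ltr_pM2l// ltrDl.
  rewrite !lt_min => /andP[/andP[/sP h1 /s'P h2] /ltW /(mP k l _ mk ml) h3].
  rewrite -(ler_pM2l t0) -{1}(gtr0_norm t0) -cmod_real -cmodM mulrBr mulrCA -th.
  rewrite -[_ * linrow (a k) h]linearZ -[_ * linrow (a l) h]linearZ.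
  move: h1 h2 h3; set u := mkc t 0 *: h => h1 h2 h3.
  have -> : linrow (a k) u - linrow (a l) u =
    (F k (z + u) - F l (z + u) - (F k z - F l z)) +
    ((F l (z + u) - F l z - linrow (a l) u) - (F k (z + u) - F k z - linrow (a k) u)) by ring.
  apply: (le_trans (cmodD _ _)); rewrite (splitr e) mulrDl; apply: lerD => //.
  apply: (le_trans (cmodD _ _)); rewrite cmodN (splitr (e / 2)) mulrDl; exact: lerD.
have [b bP] : exists b, forall e : R, 0 < e -> exists m, forall k h, (m <= k)%N ->
    cmod (linrow (a k) h - linrow b h) <= e * vmod h.
  have ex (j : 'I_n) : exists b : cplx R, forall e : R, 0 < e -> exists m, forall k, (m <= k)%N ->
      cmod (a k j - b) <= e.
    apply: (@cplx_cauchy (fun k => a k j)) => e e0; have [m mP] := aC _ e0; exists m => k l mk ml.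
    have := mP k l (delta_mx 0 j) mk ml.
    have dj c : linrow c (delta_mx 0 j) = c j.
      rewrite /linrow (bigD1 j)//= big1 ?addr0 ?mxE ?eqxx ?mul1r// => i /negbTE ij.
      by rewrite mxE ij andbF mul0r.
    have d1 : vmod (delta_mx 0 j : 'rV[cplx R]_n) <= 1.
      by apply/vmod_row => // i; rewrite mxE /=; case: (_ == _); rewrite ?cmod1 ?cmod0.
    rewrite !dj => /le_trans; apply; rewrite (ger_pMr _ e0); exact: d1.
  have [b bP] := choice ex.
  exists b => e e0.
  have n0 : 0 < n.+1%:R :> R by [].
  have [m mP] := choice (fun j => bP j _ (divr_gt0 e0 n0)).
  exists (\max_j m j)%N => k h mk.
  have -> : linrow (a k) h - linrow b h = linrow (fun j => a k j - b j) h.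
    by rewrite /linrow -sumrB; apply: eq_bigr => j _; rewrite mulrBr.
  apply: (le_trans (@linrow_le _ _ _ (e / n.+1%:R) _)) => [j|].
    by apply: mP; apply: leq_trans mk; exact: leq_bigmax.
  rewrite ler_wpM2r ?vmod_ge0// mulrCA ger_pMr// ler_pdivrMr// mul1r ler_nat.
  exact: leqnSn.
exists b => e e0; have e3 : 0 < e / 3 by rewrite divr_gt0.
have [m1 h1] := lip _ e3; have [m2 h2] := bP _ e3.
pose k := maxn m1 m2.
have [s s0 sP] := aP k _ e3.
exists (Num.min s (r / 4)); first by rewrite lt_min s0.
move=> h; rewrite lt_min => /andP[hs /ltW hr].
have -> : G (z + h) - G z - linrow b h =
  ((G (z + h) - F k (z + h)) - (G z - F k z)) + (F k (z + h) - F k z - linrow (a k) h) +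
  (linrow (a k) h - linrow b h) by ring.
have -> : e * vmod h = e / 3 * vmod h + e / 3 * vmod h + e / 3 * vmod h by lra.
apply: (le_trans (cmodD _ _)); apply: lerD; last by apply: h2; rewrite leq_maxr.
apply: (le_trans (cmodD _ _)); apply: lerD; last exact: sP.
(* Replacing [G] by some [F l] causes an error not proportional to [vmod h]; it is absorbed in an
   arbitrary [d], and [l] may then depend on [d]. *)
apply/ler_addgt0Pr => d d0; have [m3 h3] := FG _ (divr_gt0 d0 (ltr0Sn _ 1)).
pose l := maxn k m3.
have -> : (G (z + h) - F k (z + h)) - (G z - F k z) =
  ((F l (z + h) - F k (z + h)) - (F l z - F k z)) +
  ((G (z + h) - F l (z + h)) + (F l z - G z)) by ring.
apply: (le_trans (cmodD _ _)); apply: lerD.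
  by apply: h1 => //; rewrite ?leq_maxl// leq_max leq_maxl.
apply: (le_trans (cmodD _ _)); rewrite (splitr d); apply: lerD.
  by rewrite cmodB; apply: h3; rewrite ?leq_maxr//; exact: bz.
by apply: h3; rewrite ?leq_maxr//; exact: box_refl (ltW r0).
Qed.

End UniformLimits.

(** * Local estimates for holomorphic sections *)

Section Fibers.
Context (R : realType) (n : nat) (X : ptopologicalType) (M : complex_manifold R n X)
  (L : line_bundle M) (h : hermitian_metric L).
Implicit Types (a : triv_idx L) (x : X).

Lemma creJ (z : cplx R) : cre (Num.conj z) = cre z.
Proof. by case: z. Qed.
Lemma cimJ (z : cplx R) : cim (Num.conj z) = - cim z.
Proof. by case: z. Qed.
Lemma cre_mulJ (z : cplx R) : cre (z * Num.conj z) = cmod z ^+ 2.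
Proof. by rewrite sqr_cmod !cplxE creJ cimJ; ring. Qed.

Lemma coordD a x (u v : fiber L x) : triv_dom a x ->
  triv_coord a (u + v) = triv_coord a u + triv_coord a v.
Proof.
by move=> ax; rewrite [in LHS](frame_coord ax u) [in LHS](frame_coord ax v) -scalerDl coord_frame.
Qed.
Lemma coordZ a x (c : cplx R) (u : fiber L x) : triv_dom a x ->
  triv_coord a (c *: u) = c * triv_coord a u.
Proof. by move=> ax; rewrite [in LHS](frame_coord ax u) scalerA coord_frame. Qed.
Lemma coord0 a x : triv_dom a x -> triv_coord a (0 : fiber L x) = 0.
Proof. by move=> ax; rewrite -(scale0r (0 : fiber L x)) coordZ// mul0r. Qed.
Lemma coordB a x (u v : fiber L x) : triv_dom a x ->
  triv_coord a (u - v) = triv_coord a u - triv_coord a v.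
Proof. by move=> ax; rewrite coordD// -scaleN1r coordZ// mulN1r. Qed.
Lemma coord_sum a x I (r : seq I) (P : pred I) (F : I -> fiber L x) : triv_dom a x ->
  triv_coord a (\sum_(i <- r | P i) F i) = \sum_(i <- r | P i) triv_coord a (F i).
Proof. by move=> ax; apply: (big_morph _ (fun u v => coordD u v ax) (coord0 ax)). Qed.

Lemma hermDl x (u v w : fiber L x) : herm h (u + v) w = herm h u w + herm h v w.
Proof. by have := herm_linear h 1 u v w; rewrite scale1r mul1r. Qed.
Lemma herm0l x (w : fiber L x) : herm h 0 w = 0.
Proof. by apply: (addIr (herm h 0 w)); rewrite -hermDl addr0 add0r. Qed.
Lemma hermZl x c (u w : fiber L x) : herm h (c *: u) w = c * herm h u w.
Proof. by have := herm_linear h c u 0 w; rewrite addr0 herm0l addr0. Qed.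
Lemma hermDr x (u v w : fiber L x) : herm h w (u + v) = herm h w u + herm h w v.
Proof. by rewrite (herm_conj h w) hermDl (herm_conj h w u) (herm_conj h w v); exact: rmorphD. Qed.
Lemma hermZr x c (u w : fiber L x) : herm h u (c *: w) = Num.conj c * herm h u w.
Proof. by rewrite (herm_conj h u) hermZl (herm_conj h u w); exact: rmorphM. Qed.
Lemma herm0r x (w : fiber L x) : herm h w 0 = 0.
Proof. by rewrite herm_conj herm0l rmorph0. Qed.
Lemma herm_suml x I (r : seq I) (P : pred I) (F : I -> fiber L x) w :
  herm h (\sum_(i <- r | P i) F i) w = \sum_(i <- r | P i) herm h (F i) w.
Proof. by apply: (big_morph (fun u => herm h u w) (fun u v => hermDl u v w) (herm0l w)). Qed.
Lemma herm_sumr x I (r : seq I) (P : pred I) (F : I -> fiber L x) w :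
  herm h w (\sum_(i <- r | P i) F i) = \sum_(i <- r | P i) herm h w (F i).
Proof. by apply: (big_morph (fun u => herm h w u) (fun u v => hermDr u v w) (herm0r w)). Qed.

Lemma cre_hermC x (u v : fiber L x) : cre (herm h u v) = cre (herm h v u).
Proof. by rewrite herm_conj creJ. Qed.

Lemma sqnorm_ge0 x (v : fiber L x) : 0 <= sqnorm h v.
Proof.
rewrite /sqnorm; have [->|v0] := eqVneq v 0; first by rewrite herm0l.
by have [/ltW] := cpos_mkc (herm_positive h v0).
Qed.
Lemma sqnorm0 x : sqnorm h (0 : fiber L x) = 0.
Proof. by rewrite /sqnorm herm0l. Qed.
Lemma sqnormD x (u v : fiber L x) :
  sqnorm h (u + v) = sqnorm h u + sqnorm h v + 2 * cre (herm h u v).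
Proof.
rewrite /sqnorm hermDl !hermDr !creD (cre_hermC v u); ring.
Qed.
Lemma sqnormZ x c (u : fiber L x) : sqnorm h (c *: u) = cmod c ^+ 2 * sqnorm h u.
Proof.
rewrite /sqnorm hermZl hermZr mulrA creM cre_mulJ.
have -> : cim (c * Num.conj c) = 0 by rewrite !cplxE creJ cimJ; ring.
by rewrite mul0r subr0.
Qed.
Lemma sqnormN x (u : fiber L x) : sqnorm h (- u) = sqnorm h u.
Proof. by rewrite -scaleN1r sqnormZ cmodN cmod1 expr1n mul1r. Qed.
Lemma cre_herm_le x (u v : fiber L x) : `|cre (herm h u v)| <= sqnorm h u + sqnorm h v.
Proof.
have h1 := sqnorm_ge0 (u + v); have h2 := sqnorm_ge0 (u - v).
have h3 := sqnorm_ge0 u; have h4 := sqnorm_ge0 v.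
move: h1 h2; rewrite !sqnormD sqnormN -scaleN1r hermZr.
have -> : Num.conj (-1 : cplx R) = -1 by rewrite rmorphN1.
by rewrite mulN1r creN => h1 h2; rewrite ler_norml; apply/andP; split; lra.
Qed.
Lemma cim_herm_le x (u v : fiber L x) : `|cim (herm h u v)| <= sqnorm h u + sqnorm h v.
Proof.
have := cre_herm_le (- ci R *: u) v; rewrite hermZl sqnormZ cmodN.
have -> : cmod (ci R) ^+ 2 = 1 by rewrite sqr_cmod !cplxE expr0n expr1n add0r.
by rewrite mul1r mulNr creN !cplxE mul0r mul1r sub0r opprK.
Qed.
Lemma sqnormD_le x (u v : fiber L x) : sqnorm h (u + v) <= 2 * (sqnorm h u + sqnorm h v).
Proof.
have := cre_herm_le u v; have := sqnorm_ge0 (u - v).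
rewrite !sqnormD sqnormN -scaleN1r hermZr.
have -> : Num.conj (-1 : cplx R) = -1 by rewrite rmorphN1.
by rewrite mulN1r creN; lra.
Qed.

(** The local weight of the metric: by [sqnorm_coord] it converts the modulus of a coordinate into
    the norm on the fiber. *)
Definition hcoef a x : R := cre (herm h (triv_frame a x) (triv_frame a x)).

Lemma hcoef_gt0 a x : triv_dom a x -> 0 < hcoef a x.
Proof.
move=> ax; have f0 : triv_frame a x != 0.
  apply/eqP => f0; have := coord_frame ax 1; rewrite f0 scaler0 coord0// => /eqP.
  by rewrite eq_sym oner_eq0.
by have [] := cpos_mkc (herm_positive h f0).
Qed.

Lemma herm_coord a x (u v : fiber L x) : triv_dom a x ->
  herm h u v = triv_coord a u * Num.conj (triv_coord a v) * mkc (hcoef a x) 0.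
Proof.
move=> ax; rewrite [in LHS](frame_coord ax u) [in LHS](frame_coord ax v) hermZl hermZr mulrA.
congr (_ * _); apply: cplxP => //=; set w := herm _ _ _.
have /(congr1 (@cim R)) : w = Num.conj w by exact: herm_conj.
by rewrite cimJ; lra.
Qed.

Lemma sqnorm_coord a x (v : fiber L x) : triv_dom a x ->
  sqnorm h v = cmod (triv_coord a v) ^+ 2 * hcoef a x.
Proof. by move=> ax; rewrite /sqnorm (herm_coord _ _ ax) creM creK cre_mulJ mulr0 subr0. Qed.

End Fibers.

(** * Transport of topology and measurability through charts *)

Section Charts.
Context (R : realType) (n : nat) (X : ptopologicalType) (M : complex_manifold R n X).
Implicit Types (i : chart_idx M) (x : X).

Lemma chart_open_preimage i (O : set 'rV[cplx R]_n) : open O ->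
  open (chart_dom i `&` chart i @^-1` O).
Proof.
rewrite !openE => oO x [ix Ox].
apply: filterI; first by apply: open_nbhs_nbhs; split => //; exact: chart_dom_open.
by apply: (chart_continuous ix); exact: oO.
Qed.

Lemma chart_open_image i (O : set X) x : open O -> O x -> chart_dom i x ->
  nbhs (chart i x) [set z | exists2 y, chart_dom i y /\ O y & chart i y = z].
Proof.
move=> oO Ox ix.
have iz : (chart i @` chart_dom i) (chart i x) by exists x.
have n1 : nbhs (chart i x) (chart i @` chart_dom i).
  by apply: open_nbhs_nbhs; split => //; exact: chart_image_open.
have n2 : nbhs (chart i x) (chart_inv i @^-1` O).
  apply: (chart_inv_continuous iz); rewrite chartK//.
  by apply: open_nbhs_nbhs.
apply: filterS (filterI n1 n2) => z [[y iy <-]]; rewrite /preimage /= chartK// => Oy.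
by exists y.
Qed.

Lemma continuous_chart i x (T : topologicalType) (f : X -> T) (g : 'rV[cplx R]_n -> T) (O : set X) :
  open O -> O x -> chart_dom i x -> (forall y, O y -> chart_dom i y -> f y = g (chart i y)) ->
  {for chart i x, continuous g} -> {for x, continuous f}.
Proof.
move=> oO Ox ix fg cg.
have nO : nbhs x (O `&` chart_dom i).
  by apply: filterI; apply: open_nbhs_nbhs; split => //; exact: chart_dom_open.
suff : f y @[y --> x] --> f x by [].
rewrite (fg x)//.
have c1 : (g \o chart i) y @[y --> x] --> g (chart i x).
  exact: (@continuous_comp X 'rV[cplx R]_n T (chart i) g x (chart_continuous ix) cg).
apply: cvg_trans c1; apply: near_eq_cvg; apply: filterS nO => y [Oy iy].
by rewrite /= fg.
Qed.

Lemma measurable_borel_open (A : set X) : open A -> measurable (A : set (borel X)).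
Proof. exact: sub_sigma_algebra. Qed.

Lemma measurable_borel (f : X -> R) : continuous f -> measurable_fun setT (f : borel X -> R).
Proof.
move=> cf; apply: (measurability (@RGenOInfty.G R)); first exact: RGenOInfty.measurableE.
move=> _ [_ [a ->] <-]; rewrite setTI; apply: measurable_borel_open.
by apply: open_comp => [y _|]; [exact: cf|exact: interval_open].
Qed.

(** The set is a difference of two open sets. Closedness of [D] alone would not make it closed, as
    [chart i] is continuous on [chart_dom i] only. *)
Lemma chart_measurable i (D : set 'rV[cplx R]_n) : closed D ->
  measurable (chart_dom i `&` chart i @^-1` D : set (borel X)).
Proof.
move=> cD.
have -> : chart_dom i `&` chart i @^-1` D = chart_dom i `\` (chart_dom i `&` chart i @^-1` ~` D).
  apply/seteqP; split=> y [iy Dy]; split=> //; first by case.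
  by apply: contrapT => nD; apply: Dy.
apply: measurableD; apply: measurable_borel_open; first exact: chart_dom_open.
by apply: chart_open_preimage; exact: closed_openC.
Qed.

End Charts.

(** * Positivity and continuity of the volume density, the weights and the pairings *)

Section Densities.
Context (R : realType) (n : nat) (X : ptopologicalType) (M : complex_manifold R n X)
  (Theta : hermitian_form M) (L : line_bundle M) (h : hermitian_metric L).
Implicit Types (i : chart_idx M) (a : triv_idx L) (x : X).

Lemma vol_density_gt0 i z : (chart i @` chart_dom i) z -> 0 < vol_density Theta i z.
Proof.
move=> iz; rewrite /vol_density divr_gt0 ?ltr0n ?fact_gt0//.
apply: wedge_power_gt0.
- by move=> b u u' v; exact: form_linear.
- by move=> u v; exact: form_antisym.
- by move=> u v; exact: form_type11.
- by move=> u; exact: form_positive.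
Qed.

Lemma continuous_sum_at (T : topologicalType) I (r : seq I) (P : pred I) (F : I -> T -> R) (z : T) :
  (forall j, {for z, continuous (F j)}) ->
    \sum_(j <- r | P j) F j w @[w --> z] --> \sum_(j <- r | P j) F j z.
Proof.
move=> cF; elim: r => [|j r IH].
  rewrite big_nil; under eq_fun do rewrite big_nil; exact: cvg_cst.
rewrite big_cons; under eq_fun do rewrite big_cons.
by case: (P j) => //; apply: cvgD => //; exact: cF.
Qed.

Lemma continuous_prod_at (T : topologicalType) I (r : seq I) (P : pred I) (F : I -> T -> R) (z : T) :
  (forall j, {for z, continuous (F j)}) ->
    \prod_(j <- r | P j) F j w @[w --> z] --> \prod_(j <- r | P j) F j z.
Proof.
move=> cF; elim: r => [|j r IH].
  rewrite big_nil; under eq_fun do rewrite big_nil; exact: cvg_cst.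
rewrite big_cons; under eq_fun do rewrite big_cons.
by case: (P j) => //; apply: cvgM => //; exact: cF.
Qed.

Lemma wedge_power_continuous (T : topologicalType) (V : Type) (om : T -> V -> V ->
  R) (e : 'I_n * bool -> V) (c : R) (z : T) :
  (forall u v, {for z, continuous (fun w => om w u v)}) ->
  {for z, continuous (fun w => wedge_power (om w) e / c)}.
Proof.
move=> com; suff : wedge_power (om w) e / c @[w --> z] --> wedge_power (om z) e / c by [].
apply: cvgM; last exact: cvg_cst.
rewrite /wedge_power; apply: cvgM; first exact: cvg_cst.
apply: continuous_sum_at => s; apply: cvgM; first exact: cvg_cst.
by apply: continuous_prod_at => j; exact: com.
Qed.

Lemma vol_density_continuous i z : (chart i @` chart_dom i) z ->
  {for z, continuous (vol_density Theta i)}.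
Proof.
move=> iz.
apply: (@wedge_power_continuous _ _ (local_form Theta i)) => u v.
exact: (form_smooth Theta i u v 0).1.
Qed.

Lemma hcoef_continuous i a x : chart_dom i x -> triv_dom a x ->
  {for chart i x, continuous (fun z => hcoef h a (chart_inv i z))}.
Proof. by move=> ix ax; apply: (herm_smooth h i a 0).1; exists x. Qed.

Lemma coord_continuous (s : bundle_section L) a x : holomorphic_section s -> triv_dom a x ->
  {for x, continuous (fun y => triv_coord a (s y))}.
Proof.
move=> hs ax; have [i ix] := chart_cover M x.
apply: (@continuous_chart _ _ _ M i x _ _ (fun z => triv_coord a (s (chart_inv i z))) (triv_dom a)) => //.
- exact: triv_dom_open.
- by move=> y _ iy; rewrite chartK.
by apply: differentiable_continuous; apply: hs; exists x.
Qed.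

Lemma hcoef_continuousX a x : triv_dom a x -> {for x, continuous (hcoef h a)}.
Proof.
move=> ax; have [i ix] := chart_cover M x.
apply: (@continuous_chart _ _ _ M i x _ _ (fun z => hcoef h a (chart_inv i z)) (triv_dom a)) => //.
- exact: triv_dom_open.
- by move=> y _ iy; rewrite chartK.
exact: hcoef_continuous.
Qed.

Lemma herm_continuous (s t : bundle_section L) : holomorphic_section s -> holomorphic_section t ->
  continuous (fun x => cre (herm h (s x) (t x))) /\ continuous (fun x => cim (herm h (s x) (t x))).
Proof.
move=> hs ht.
pose F a u v x := (u (triv_coord a (s x)) * v (triv_coord a (t x)) : R).
have cF a x (u v : cplx R -> R) : triv_dom a x -> continuous u -> continuous v ->
    {for x, continuous (F a u v)}.
  move=> ax cu cv; apply: cvgM.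
    by apply: continuous_comp; [exact: coord_continuous|exact: cu].
  by apply: continuous_comp; [exact: coord_continuous|exact: cv].
have red (f : X -> R) : (forall a x, triv_dom a x -> exists2 G : X -> R, {for x, continuous G} &
    forall y, triv_dom a y -> f y = G y * hcoef h a y) -> continuous f.
  move=> H x; have [a ax] := triv_cover L x; have [G cG fG] := H _ _ ax.
  have nx : nbhs x (triv_dom a) by apply: open_nbhs_nbhs; split => //; exact: triv_dom_open.
  suff : f y @[y --> x] --> f x by [].
  rewrite (fG x ax).
  have c1 : (fun y => G y * hcoef h a y) @ x --> G x * hcoef h a x.
    by apply: cvgM => //; exact: hcoef_continuousX.
  apply: cvg_trans c1; apply: near_eq_cvg; apply: filterS nx => y ay.
  by rewrite fG.
split; apply: red => a x ax.
  exists (fun x => F a (@cre R) (@cre R) x + F a (@cim R) (@cim R) x).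
    by apply: cvgD; apply: cF => //;
      [exact: continuous_cre|exact: continuous_cre|exact: continuous_cim|exact: continuous_cim].
  by move=> y ay; rewrite (herm_coord _ _ _ ay) !cplxE creJ cimJ mulr0 subr0 mulrN opprK.
exists (fun x => F a (@cim R) (@cre R) x - F a (@cre R) (@cim R) x).
  apply: cvgB; apply: cF => //;
    [exact: continuous_cim|exact: continuous_cre|exact: continuous_cre|exact: continuous_cim].
by move=> y ay; rewrite (herm_coord _ _ _ ay) !cplxE creJ cimJ mulr0 add0r mulrN [X in X * _]addrC.
Qed.

End Densities.

(** * Layer decomposition of integrals over boxes *)

Section Layers.
Variable R : realType.

Lemma rect_compact (a b c d : R) : compact (rect a b c d).
Proof.
pose f (p : R * R) : cplx R := mkc p.1 p.2.
have -> : rect a b c d = f @` (`[a, b] `*` `[c, d]).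
  apply/seteqP; split=> [z [h1 h2]|_ [[x y] [/= h1 h2] <-]].
    by exists (cre z, cim z); rewrite /f /= ?mkcK// !in_itv.
  by move: h1 h2; rewrite !in_itv.
apply: continuous_compact; last by apply: compact_setX; exact: segment_compact.
apply: continuous_subspaceT => -[x y] U /nbhs_vmod[e e0 eU].
exists (ball x (e / 2), ball y (e / 2)) => /=.
  by split; apply: nbhsx_ballx; rewrite divr_gt0.
move=> [x' y'] [/= h1 h2]; apply: eU; rewrite vmod_cmod.
apply: (le_lt_trans (cmod_le _)); rewrite !cplxE (splitr e).
exact: ltrD.
Qed.

Lemma box_compact n (z : 'rV[cplx R]_n) (r : R) : compact (box z r).
Proof.
have := @rV_compact (cplx R) n (fun j => rect (cre (z 0 j) - r) (cre (z 0 j) + r)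
  (cim (z 0 j) - r) (cim (z 0 j) + r)).
move=> /(_ (fun j => @rect_compact _ _ _ _)); congr compact; apply/seteqP; split=> v H j;
  have := H j; rewrite /rect /= !ler_distl.
  by move=> [].
by move=> [].
Qed.

Lemma compact_bounded_above (T : topologicalType) (K : set T) (f : T -> R) :
  compact K -> (forall x, K x -> {for x, continuous f}) -> exists B, forall x, K x -> f x <= B.
Proof.
move=> /compact_near_coveringP cK cf.
have [x Kx|B [_ BP]] := cK _ (+oo)%R (fun B x => f x <= B) _; last first.
  by exists (B + 1) => x Kx; apply: BP => //; rewrite ltrDl.
exists ([set y | f y < f x + 1], [set B | f x + 1 < B]) => /=.
  split; last by exists (f x + 1); split => //; exact: num_real.
  by apply: (cf x Kx [set t | t < f x + 1]); apply: lt_nbhsl; rewrite ltrDl.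
by move=> [y B] /= [h1 h2]; apply: ltW; apply: lt_trans h2.
Qed.

(** The sum is [e] times the number of positive multiples of [e] below [p], among the first [K]: a
    step approximation of [p] from below. With [le_layers] it turns a comparison of the measures of
    superlevel sets into a comparison of integrals. *)
Lemma layers_le (e p : R) K : 0 < e -> 0 <= p ->
  \sum_(k < K) e * ((k.+1%:R * e < p)%R)%:R <= p.
Proof.
move=> e0 p0; elim: K => [|K IH]; first by rewrite big_ord0.
rewrite big_ord_recr /=; case: ltP => [Kp|_]; last by rewrite mulr0 addr0.
apply: le_trans (ltW Kp); rewrite mulr1 -natr1 mulrDl mul1r lerD2r.
rewrite -[K in K%:R]card_ord -sum1_card natr_sum mulr_suml; apply: ler_sum => k _.
by rewrite mul1r ler_piMr ?(ltW e0)// lern1; case: (_ < _).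
Qed.

Lemma le_layers (e p : R) K : 0 < e -> p <= K.+1%:R * e ->
  p <= e + \sum_(k < K) e * ((k.+1%:R * e < p)%R)%:R.
Proof.
move=> e0; elim: K => [|K IH] pK; first by rewrite big_ord0 addr0 -[leRHS]mul1r.
rewrite big_ord_recr /=; case: ltP => [Kp|]; last by move/IH; rewrite mulr0 addr0.
have le1 : K%:R * e <= \sum_(k < K) e * ((k.+1%:R * e < p)%R)%:R.
  rewrite -[K in K%:R]card_ord -sum1_card natr_sum mulr_suml; apply: ler_sum => k _.
  rewrite mul1r ler_peMr// ?(ltW e0)// ler1n lt0b; apply: le_lt_trans Kp.
  by rewrite ler_wpM2r ?(ltW e0)// ler_nat ltnS ltnW.
by move: pK le1; rewrite mulr1 -!natr1 !mulrDl; lra.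
Qed.

Local Open Scope ereal_scope.

Lemma pfun_indic n (A : set 'rV[cplx R]_n) : pset A -> pfun (fun v => (\1_A v)%:E).
Proof.
move=> pA d U Z mZ; apply/measurable_EFinP.
have -> : (fun u => \1_A (Z u)) = \1_(Z @^-1` A) :> (U -> R).
  by apply/funext => u; rewrite !indicE; congr (_%:R); rewrite /preimage; apply/idP/idP; rewrite !inE.
by apply: measurable_indic; exact: pA.
Qed.

Lemma pfunZ n (k : R) (f : 'rV[cplx R]_n -> \bar R) : pfun f -> pfun (fun v => k%:E * f v).
Proof. by move=> pf d U Z mZ; apply: measurable_funeM; exact: pf. Qed.

Lemma pfunD n (f g : 'rV[cplx R]_n -> \bar R) : pfun f -> pfun g -> pfun (fun v => f v + g v).
Proof. by move=> pf pg d U Z mZ; apply: emeasurable_funD; [exact: pf|exact: pg]. Qed.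

Lemma cn0 n : cn_integral (fun _ : 'rV[cplx R]_n => 0) = 0.
Proof.
elim: n => [//|n IH] /=.
by rewrite integral0_eq// => x _; rewrite integral0_eq// => y _; rewrite IH.
Qed.

Lemma cn_sum n K (F : nat -> 'rV[cplx R]_n -> \bar R) : (forall k, pfun (F k)) ->
  (forall k v, 0 <= F k v) ->
  pfun (fun v => \sum_(k < K) F k v) /\
  cn_integral (fun v => \sum_(k < K) F k v) = \sum_(k < K) cn_integral (F k).
Proof.
move=> pF F0; elim: K => [|K [IH1 IH2]].
  rewrite big_ord0; under eq_fun do rewrite big_ord0; split; last exact: cn0.
  by move=> d U Z mZ; exact: measurable_cst.
rewrite big_ord_recr -IH2; under eq_fun do rewrite big_ord_recr /=.
split; first exact: pfunD.
by apply: cnD => // v; exact: sume_ge0.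
Qed.

(** On the compact box [f] is bounded, so finitely many layers of height [e] reach above it; the
    uncovered part is at most [e] times the volume of the box. *)
Lemma cn_layers n (O : set 'rV[cplx R]_n) (z : 'rV[cplx R]_n) (r : R) (f : 'rV[cplx R]_n -> R) :
  (0 <= r)%R -> open O -> box z r `<=` O -> (forall v, O v -> {for v, continuous f}) ->
    (forall v, (0 <= f v)%R) ->
  forall e : R, (0 < e)%R -> exists K : nat,
    cn_integral (fun v => (f v * \1_(box z r) v)%:E) <= (e * (4 * r ^+ 2) ^+ n)%:E +
    \sum_(k < K) e%:E * cn_integral (fun v =>
      (\1_(box z r `&` [set v | O v /\ k.+1%:R * e < f v]%R) v)%:E).
Proof.
move=> r0 oO DO cf f_ge0 e e0; set D := box z r.
have [B BP] := compact_bounded_above (@box_compact _ z r) (fun v Dv => cf v (DO v Dv)).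
have [K KB] : exists K : nat, (B <= K.+1%:R * e)%R.
  exists (Num.truncn (`|B| / e)); rewrite -ler_pdivrMr//.
  apply: (@le_trans _ _ (`|B| / e)%R); first by rewrite ler_pM2r ?invr_gt0// ler_norm.
  by apply/ltW/truncnS_gt.
pose G k := D `&` [set v | O v /\ k.+1%:R * e < f v]%R.
have oG k : open [set v | O v /\ k.+1%:R * e < f v]%R.
  rewrite openE => v [Ov fv]; apply: filterI; first exact: open_nbhs_nbhs.
  by apply: (cf v Ov [set y | k.+1%:R * e < y]%R); exact: lt_nbhsr.
have pG k : pset (G k) by apply: psetI; [exact: pset_box|exact: pset_open].
exists K.
pose F k v := e%:E * (\1_(G k) v)%:E.
have pF k : pfun (F k) by apply: pfunZ; exact: pfun_indic.
have F0 k v : 0 <= F k v by rewrite mule_ge0// ?lee_fin ?(ltW e0).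
have [pS SE] := cn_sum K pF F0.
pose f0 v := e%:E * (\1_D v)%:E.
have pf0 : pfun f0 by apply: pfunZ; apply: pfun_indic; exact: pset_box.
have f00 v : 0 <= f0 v by rewrite mule_ge0// ?lee_fin ?(ltW e0).
apply: (@le_trans _ _ (cn_integral (fun v => f0 v + \sum_(k < K) F k v))).
  apply: cn_le => [||v|v].
  - by apply: pfun_open oO DO _ cf; exact: pset_box.
  - exact: pfunD.
  - by rewrite lee_fin mulr_ge0.
  - rewrite /f0 /F; have [vD|vD] := pselect (D v); last first.
      rewrite {1}indicE memNset// mulr0; apply: adde_ge0; first exact: f00.
      by apply: sume_ge0 => k _; exact: F0.
    rewrite [X in (_ * X)%:E]indicE mem_set// mulr1.
    have := le_layers e0 (le_trans (BP v vD) KB).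
    rewrite -lee_fin EFinD => /le_trans; apply; rewrite -EFinM indicE mem_set// mulr1 leeD2l//.
    rewrite sumEFin lee_fin; apply: ler_sum => k _.
    rewrite ler_wpM2l ?(ltW e0)// indicE ler_nat; case: ltP => //= h.
    by rewrite mem_set//; split=> //; split=> //; exact: DO.
rewrite cnD//; last by move=> v; apply: sume_ge0 => k _.
apply: leeD.
  by apply: (@cn_box_le _ _ z) => //; exact: ltW.
rewrite SE; apply: lee_sum => k _.
by rewrite /F cnZ ?(ltW e0)//; exact: pfun_indic.
Qed.

End Layers.

(** * Comparison with Lebesgue measure and the local sub-mean-value inequality *)

Section LocalEstimate.
Context (R : realType) (n : nat) (X : ptopologicalType) (M : complex_manifold R n X)
  (Theta : hermitian_form M) (dV : {measure set (borel X) -> \bar R})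
  (dV_vol : is_volume_measure Theta dV) (L : line_bundle M) (h : hermitian_metric L).

Lemma sqnorm_measurable (s : bundle_section L) : holomorphic_section s ->
  measurable_fun setT (fun x : borel X => sqnorm h (s x)).
Proof. by move=> hs; apply: measurable_borel; have [] := herm_continuous h hs hs. Qed.

Definition chart_region (i : chart_idx M) (a : triv_idx L) (U : set X) : set 'rV[cplx R]_n :=
  [set z | exists2 y, [/\ chart_dom i y, triv_dom a y & U y] & chart i y = z].

Lemma chart_region_open i a U : open U -> open (chart_region i a U).
Proof.
move=> oU; rewrite openE => _ [y [iy ay Uy] <-].
have := @chart_open_image _ _ _ M i (triv_dom a `&` U) y.
move=> /(_ (openI (triv_dom_open a) oU) (conj ay Uy) iy).
by apply: filterS => z [w [iw [aw Uw]] <-]; exists w.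
Qed.

Lemma continuous_near_gt (T : topologicalType) (f : T -> R) z (k : R) :
  {for z, continuous f} -> k < f z -> \forall w \near z, k < f w.
Proof. by move=> cf kf; apply: (cf [set y | k < y]); exact: lt_nbhsr. Qed.

Lemma continuous_near_lt (T : topologicalType) (f : T -> R) z (k : R) :
  {for z, continuous f} -> f z < k -> \forall w \near z, f w < k.
Proof. by move=> cf kf; apply: (cf [set y | y < k]); exact: lt_nbhsl. Qed.

Lemma cmod2_continuous (T : topologicalType) (g : T -> cplx R) z :
  {for z, continuous g} -> {for z, continuous (fun w => cmod (g w) ^+ 2)}.
Proof.
move=> cg; suff : cmod (g w) ^+ 2 @[w --> z] --> cmod (g z) ^+ 2 by [].
rewrite sqr_cmod; under eq_fun do rewrite sqr_cmod.
have c1 := continuous_comp cg (@continuous_cre R (g z)).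
have c2 := continuous_comp cg (@continuous_cim R (g z)).
by apply: cvgD; apply: cvgM.
Qed.

Lemma local_bounds i a U x : open U -> U x -> chart_dom i x -> triv_dom a x ->
  exists r c C : R, [/\ 0 < r, 0 < c & forall z, box (chart i x) (r + r) z ->
    [/\ chart_region i a U z, c <= vol_density Theta i z <= C &
        c <= hcoef h a (chart_inv i z) <= C]].
Proof.
move=> oU Ux ix ax.
have ri : chart_region i a U (chart i x) by exists x.
have im : (chart i @` chart_dom i) (chart i x) by exists x.
have cv : {for chart i x, continuous (vol_density Theta i)} by exact: vol_density_continuous.
have ch : {for chart i x, continuous (fun z => hcoef h a (chart_inv i z))} by exact: hcoef_continuous.
have v0 : 0 < vol_density Theta i (chart i x) by exact: vol_density_gt0.
have h0 := hcoef_gt0 h ax.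
set vx := vol_density Theta i (chart i x) in v0; set hx := hcoef h a x in h0.
pose c := Num.min vx hx / 2; pose C := Num.max vx hx + 1.
have c0 : 0 < c by rewrite divr_gt0// lt_min v0.
have lt2 (t : R) : 0 < t -> t / 2 < t by move=> t0; rewrite ltr_pdivrMr// ltr_pMr// ltr1n.
have mn : c < Num.min vx hx by rewrite lt2// lt_min v0.
have [cv' ch'] : c < vx /\ c < hx by move: mn; rewrite lt_min => /andP.
have mx : Num.max vx hx < C by rewrite ltrDl.
have [Cv Ch] : vx < C /\ hx < C by move: mx; rewrite gt_max => /andP.
have hxE : hcoef h a (chart_inv i (chart i x)) = hx by rewrite chartK.
have n1 := continuous_near_gt cv cv'; have n2 := continuous_near_lt cv Cv.
have n3 := continuous_near_gt ch (_ : c < _); rewrite hxE in n3; have {}n3 := n3 ch'.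
have n4 := continuous_near_lt ch (_ : _ < C); rewrite hxE in n4; have {}n4 := n4 Ch.
have n5 : nbhs (chart i x) (chart_region i a U).
  by apply: open_nbhs_nbhs; split => //; exact: chart_region_open.
have [r r0 rP] := (nbhs_box (chart i x) _).1 (filterI n5 (filterI (filterI n1 n2) (filterI n3 n4))).
exists (r / 2), c, C; split; [by rewrite divr_gt0|by []|].
move=> z; rewrite -splitr => /rP[rz [[z1 z2] [z3 z4]]]; split => //.
  by rewrite !ltW.
by rewrite !ltW.
Qed.

Local Open Scope ereal_scope.

(** One factor [c] bounds the volume density below, the other the weight. Since [dV] is known in the
    chart through the measures of sets, the coordinate function is replaced by its layers, each of
    which is transported as a Borel set. *)
Lemma local_comparison i a U x (r c C : R) (s : bundle_section L) :
  open U -> chart_dom i x -> (0 < r)%R -> (0 < c)%R ->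
  (forall z, box (chart i x) r z ->
    [/\ chart_region i a U z, (c <= vol_density Theta i z <= C)%R &
        (c <= hcoef h a (chart_inv i z) <= C)%R]) ->
  holomorphic_section s ->
  (c * c)%:E * cn_integral (fun z =>
      (cmod (triv_coord a (s (chart_inv i z))) ^+ 2 * \1_(box (chart i x) r) z)%:E) <=
    \int[dV]_(y in chart_dom i `&` chart i @^-1` box (chart i x) r) (sqnorm h (s y))%:E.
Proof.
move=> oU ix r0 c0 H hs.
set D := box (chart i x) r; set A := chart_dom i `&` chart i @^-1` D.
pose O := chart_region i a setT.
have oO : open O by apply: chart_region_open; exact: openT.
have DO : D `<=` O by move=> z /H[[y [iy ay _] <-] _ _]; exists y.
have OI : O `<=` chart i @` chart_dom i by move=> _ [y [iy ay _] <-]; exists y.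
pose f z := (cmod (triv_coord a (s (chart_inv i z))) ^+ 2)%R.
have cf v : O v -> {for v, continuous f}.
  move=> [y [iy ay _] <-]; apply: cmod2_continuous.
  by apply: differentiable_continuous; apply: hs; exists y.
have cD : closed D by apply: compact_closed; [exact: norm_hausdorff|exact: box_compact].
have mA : measurable (A : set (borel X)) by exact: chart_measurable.
have f_ge0 v : (0 <= f v)%R by rewrite exprn_ge0// cmod_ge0.
have cc0 : (0 < c * c)%R by rewrite mulr_gt0.
apply/lee_addgt0Pr => e e0.
pose V := ((4 * r ^+ 2) ^+ n)%R.
have V0 : (0 <= V)%R by rewrite exprn_ge0// mulr_ge0// sqr_ge0.
(* The part that the layers miss costs [c * c * (e' * V)], which this choice keeps below [e]. *)
pose e' := (e / (c * c * V + 1))%R.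
have e'0 : (0 < e')%R by rewrite divr_gt0// ltr_pwDr// mulr_ge0// ltW.
have [K KP] := cn_layers (ltW r0) oO DO cf f_ge0 e'0.
pose G k := [set v | O v /\ (k.+1%:R * e' < f v)%R].
have oG k : open (G k).
  rewrite openE => v [Ov fv]; apply: filterI; first exact: open_nbhs_nbhs.
  exact: continuous_near_gt (cf v Ov) fv.
pose B k : set X := A `&` (chart_dom i `&` chart i @^-1` G k).
have mB k : measurable (B k : set (borel X)).
  by apply: measurableI => //; apply: measurable_borel_open; exact: chart_open_preimage.
have BE k : chart i @` B k = D `&` G k.
  apply/seteqP; split=> [_ [y [[iy Dy] [_ Gy]] <-] //|z [Dz [Oz fz]]].
  by have [y iy zE] := OI _ Oz; exists y => //; rewrite /B /A /preimage /= zE.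
(* Here [dV] meets Lebesgue measure: [dV_vol] applies to the Borel set [B k], on whose image the
   density is at least [c]. *)
have dB k : c%:E * cn_integral (fun v => (\1_(D `&` G k) v)%:E) <= dV (B k).
  have pD : pset (D `&` G k) by apply: psetI; [exact: pset_box|exact: pset_open].
  have Bi : B k `<=` chart_dom i by move=> y [[]].
  rewrite (dV_vol (mB k) Bi) BE.
  rewrite -cnZ ?(ltW c0)//; last exact: pfun_indic.
  apply: cn_le => [|||v].
  - by apply: pfunZ; exact: pfun_indic.
  - apply: (pfun_open oO) => //; first by move=> v [/DO].
    by move=> v /OI; exact: vol_density_continuous.
  - by move=> v; rewrite -EFinM lee_fin mulr_ge0 ?(ltW c0).
  - rewrite -EFinM lee_fin indicE; case: (boolP (v \in _)); rewrite ?mulr0//.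
    by rewrite inE !mulr1 => -[/H[_ /andP[]]].
apply: (@le_trans _ _ ((c * c)%:E * ((e' * V)%:E +
  \sum_(k < K) e'%:E * cn_integral (fun v => (\1_(D `&` G k) v)%:E)))).
  by apply: lee_wpmul2l => //; rewrite lee_fin ltW.
rewrite ge0_muleDr; first last.
- by apply: sume_ge0 => k _; apply: mule_ge0; [rewrite lee_fin ltW|exact: cn_ge0].
- by rewrite lee_fin mulr_ge0// ltW.
rewrite addeC; apply: leeD; last first.
  rewrite -EFinM lee_fin mulrCA /e' mulrAC -mulrA ger_pMr// ler_pdivrMr ?mul1r ?lerDl//.
  by rewrite ltr_pwDr// mulr_ge0// ltW.
pose F k (y : borel X) : \bar R := ((c * e')%:E * (\1_(B k) y)%:E).
apply: (@le_trans _ _ (\int[dV]_(y in A) \sum_(k < K) F k y)).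
  rewrite ge0_integral_sum//; first last.
  - by move=> k y _; rewrite /F mule_ge0 ?lee_fin// mulr_ge0 ?ltW.
  - by move=> k; apply: measurable_funeM; apply/measurable_EFinP; apply: measurable_indic; exact: mB.
  rewrite ge0_sume_distrr; last first.
    by move=> k _; apply: mule_ge0; [rewrite lee_fin ltW|exact: cn_ge0].
  apply: lee_sum => k _; rewrite ge0_integralZl//; first last.
  - by rewrite lee_fin mulr_ge0 ?ltW.
  - by apply/measurable_EFinP; apply: measurable_indic; exact: mB.
  have -> : \int[dV]_(y in A) (\1_(B k) y)%:E = dV (B k).
    rewrite integral_indic//.
    by congr (dV _); apply: setIidl => y [].
  have -> : (c * c)%:E * (e'%:E * cn_integral (fun v => (\1_(D `&` G k) v)%:E)) =
    (c * e')%:E * (c%:E * cn_integral (fun v => (\1_(D `&` G k) v)%:E)).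
    by rewrite !muleA -!EFinM; congr (_%:E * _); ring.
  by apply: lee_wpmul2l => //; rewrite lee_fin mulr_ge0 ?ltW.
apply: ge0_le_integral => //.
- by move=> y _; apply: sume_ge0 => k _; rewrite /F mule_ge0 ?lee_fin// mulr_ge0 ?ltW.
- by apply: emeasurable_sum => k; apply: measurable_funeM; apply/measurable_EFinP;
    apply: measurable_indic; exact: mB.
- by apply/measurable_EFinP; apply: measurable_funTS; exact: sqnorm_measurable.
move=> y [iy Dy]; have [[y' [iy' ay _] yy] _ /andP[hc _]] := H _ Dy.
have {yy}yy : y' = y by rewrite -(chartK iy) -(chartK iy') yy.
rewrite {}yy {iy'} in ay; rewrite chartK// in hc.
have sE : sqnorm h (s y) = (f (chart i y) * hcoef h a y)%R by rewrite (sqnorm_coord _ _ ay) /f chartK.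
(* The second factor [c] is the lower bound of [hcoef]; the layers of [f] sum to at most [f] by
   [layers_le]. *)
apply: (@le_trans _ _ (c * f (chart i y))%:E); last first.
  by rewrite lee_fin sE mulrC ler_wpM2l.
apply: (@le_trans _ _ (c * \sum_(k < K) e' * ((k.+1%:R * e' < f (chart i y))%R)%:R)%:E); last first.
  by rewrite lee_fin; apply: ler_wpM2l; [exact: ltW|exact: layers_le].
rewrite mulr_sumr -sumEFin; apply: lee_sum => k _.
rewrite /F -EFinM lee_fin [leRHS]mulrA.
apply: ler_wpM2l; first by apply: mulr_ge0; apply: ltW.
rewrite indicE ler_nat; case: (boolP (y \in _)) => //; rewrite inE => -[_ [_ [_ h1]]].
by rewrite h1.
Qed.

(** The bounds hold on a box of radius [r + r], and [A'] keeps to the interior of the one of radius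
    [r], so that about each of its points a whole box of radius [r] is available to [mean_value].
    The constant is the upper bound [C] of the weight, times the mean value factor, divided by the
    two lower bounds. That [A] is small and of finite measure lets the lemma be applied a second
    time inside [A']. *)
Lemma local_estimate x0 (U : set X) : open U -> U x0 ->
  exists (A' : set X) (A : set (borel X)) (C : R),
  [/\ open A', A' x0, measurable A, A `<=` U & dV A < +oo] /\ [/\ A' `<=` A, (0 <= C)%R &
  forall s : bundle_section L, holomorphic_section s -> forall x, A' x ->
    (sqnorm h (s x))%:E <= C%:E * \int[dV]_(y in A) (sqnorm h (s y))%:E].
Proof.
move=> oU Ux0; have [i ix] := chart_cover M x0; have [a ax] := triv_cover L x0.
have [r [c [C [r0 c0 H]]]] := local_bounds oU Ux0 ix ax.
have rr0 : (0 < r + r)%R by rewrite addr_gt0.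
set z0 := chart i x0 in H.
pose A := chart_dom i `&` chart i @^-1` box z0 (r + r).
pose A' := chart_dom i `&` chart i @^-1` (box z0 r)^°.
have bx : box z0 r `<=` box z0 (r + r) by apply: box_le; rewrite lerDl ltW.
have cD : closed (box z0 (r + r)) by apply: compact_closed; [exact: norm_hausdorff|exact: box_compact].
have mA : measurable (A : set (borel X)) by exact: chart_measurable.
have AU y : A y -> U y /\ triv_dom a y.
  move=> [iy /H[[y' [iy' ay' Uy']] yy _ _]].
  by have <- : y' = y by rewrite -(chartK iy) -(chartK iy') yy.
have C0 : (0 <= C)%R.
  have [_ /andP[h1 h2] _] := H z0 (box_refl z0 (ltW rr0)).
  exact: le_trans (ltW c0) (le_trans h1 h2).
have imA : chart i @` A = box z0 (r + r).
  apply/seteqP; split=> [_ [y [_ Ay] <-]//|z zD].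
  by have [[y [iy _ _] yz] _ _] := H _ zD; exists y => //; rewrite /A /preimage /= yz.
have AA : A' `<=` A.
  by move=> y [iy /interior_subset Dy]; split => //; exact: bx.
exists A', A, (C * (16 / r ^+ 2) ^+ n * (c * c)^-1)%R; split; split => //.
- by apply: chart_open_preimage; exact: open_interior.
- by split => //; apply/nbhs_box; exists r.
- by move=> y /AU[].
- have Ai : A `<=` chart_dom i by move=> y [].
  rewrite (dV_vol mA Ai) imA; apply: (@le_lt_trans _ _ (C * (4 * (r + r) ^+ 2) ^+ n)%:E);
    last exact: ltry.
  have DI z : box z0 (r + r) z -> (chart i @` chart_dom i) z.
    by move=> /H[[y [iy _ _] <-] _ _]; exists y.
  have oI : open (chart i @` chart_dom i) by exact: chart_image_open.
  apply: (@cn_box_le _ _ z0) => //; first exact: ltW.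
  + apply: (pfun_open oI) => //; first exact: pset_box.
    by move=> z zI; exact: vol_density_continuous.
  + move=> z; rewrite lee_fin indicE; case: (boolP (z \in _)); rewrite ?mulr0// inE mulr1.
    by move=> /H[_ /andP[h1 _] _]; exact: le_trans (ltW c0) h1.
  + move=> z; rewrite lee_fin indicE; case: (boolP (z \in _)); rewrite ?mulr0// inE !mulr1.
    by move=> /H[_ /andP[]].
- by rewrite !mulr_ge0 ?invr_ge0 ?mulr_ge0 ?(ltW c0)// exprn_ge0// divr_ge0// sqr_ge0.
move=> s hs x A'x; have Ax := AA _ A'x; have [_ ax'] := AU _ Ax.
pose g z := triv_coord a (s (chart_inv i z)).
have comp := local_comparison (r := (r + r)%R) oU ix rr0 c0 H hs.
have sub : box (chart i x) r `<=` box z0 (r + r).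
  by move=> v; apply: box_sub; case: A'x => _ /interior_subset.
pose O := chart_region i a setT.
have oO : open O by apply: chart_region_open; exact: openT.
have DO : box z0 (r + r) `<=` O by move=> z /H[[y [iy ay _] <-] _ _]; exists y.
have hg v : O v -> holo g v by move=> [y [iy ay _] <-]; apply/holoP; apply: hs; exists y.
have cf v : O v -> {for v, continuous (fun v => cmod (g v) ^+ 2)%R}.
  move=> [y [iy ay _] <-]; apply: cmod2_continuous.
  by apply: differentiable_continuous; apply: hs; exists y.
have pf (D : set 'rV[cplx R]_n) : pset D -> D `<=` O -> pfun (fun v => (cmod (g v) ^+ 2 * \1_D v)%:E).
  by move=> pD DO'; apply: pfun_open oO DO' pD cf.
have mv := @mean_value R n g (chart i x) r r0 _ _.
have {}mv := mv (fun v bv => holo_hom_diff (hg v (DO v (sub v bv))))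
  (pf _ (@pset_box _ _ _ _) (subset_trans sub DO)).
have le1 : cn_integral (fun v => (cmod (g v) ^+ 2 * \1_(box (chart i x) r) v)%:E) <=
    cn_integral (fun v => (cmod (g v) ^+ 2 * \1_(box z0 (r + r)) v)%:E).
  apply: cn_le => [||v|v].
  - by apply: pf; [exact: pset_box|exact: subset_trans sub DO].
  - by apply: pf => //; exact: pset_box.
  - by rewrite lee_fin mulr_ge0// exprn_ge0// cmod_ge0.
  - rewrite lee_fin ler_wpM2l ?exprn_ge0 ?cmod_ge0// !indicE ler_nat.
    case: (boolP (v \in _)) => //; rewrite inE => /sub vD; by rewrite mem_set.
have k0 : (0 <= (16 / r ^+ 2) ^+ n)%R by rewrite exprn_ge0// divr_ge0// sqr_ge0.
have cc0 : (0 < c * c)%R by rewrite mulr_gt0.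
have hx : (hcoef h a x <= C)%R.
  have [ix' Dx] := Ax; have [_ _ /andP[_]] := H _ Dx; by rewrite chartK.
have sx : (sqnorm h (s x) <= C * cmod (g (chart i x)) ^+ 2)%R.
  have [ix' Dx] := Ax.
  by rewrite (sqnorm_coord _ _ ax') /g chartK// mulrC ler_wpM2r// exprn_ge0// cmod_ge0.
apply: (@le_trans _ _ (C * cmod (g (chart i x)) ^+ 2)%:E); first by rewrite lee_fin.
set I := integral _ _ _ in comp *.
have E1 : cn_integral (fun v => (cmod (g v) ^+ 2 * \1_(box z0 (r + r)) v)%:E) <= ((c * c)^-1)%:E * I.
  by rewrite lee_pdivlMl.
rewrite -[(C * (16 / r ^+ 2) ^+ n * (c * c)^-1)%R]mulrA EFinM [X in _ <= X * _]EFinM -muleA.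
apply: lee_wpmul2l; first by rewrite lee_fin.
apply: (le_trans mv); rewrite EFinM -muleA; apply: lee_wpmul2l; first by rewrite lee_fin.
exact: le_trans le1 E1.
Qed.

End LocalEstimate.

(** * Gram matrices and the Bergman kernel *)

Section Gram.
Context (R : realType) (n : nat) (X : ptopologicalType) (M : complex_manifold R n X)
  (dV : {measure set (borel X) -> \bar R}) (L : line_bundle M) (h : hermitian_metric L).

Lemma holo_near (f g : 'rV[cplx R]_n -> cplx R) z :
  (\forall w \near z, f w = g w) -> holo f z -> holo g z.
Proof.
move=> fg [a aP]; exists a => e e0; have [r r0 rP] := aP e e0.
have [s s0 sP] := (nbhs_vmod z _).1 fg; exists (Num.min r s); first by rewrite lt_min r0.
move=> v; rewrite lt_min => /andP[/rP H vs]; rewrite -sP; last first.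
  by rewrite opprD addrA subrr sub0r vmodN.
by rewrite -sP ?subrr ?vmod0.
Qed.

Lemma holomorphic_comb (T : nat -> bundle_section L) (P : pred nat) (c : nat -> cplx R) N :
  (forall j, P j -> holomorphic_section (T j)) ->
  holomorphic_section (fun x => \sum_(j < N | P j) c j *: T j x).
Proof.
move=> hT i a _ [x [ix ax] <-]; apply/holoP.
apply: (@holo_near (fun w => \sum_(j < N | P j) c j * triv_coord a (T j (chart_inv i w)))).
  have : nbhs (chart i x) (chart_region i a setT).
    by apply: open_nbhs_nbhs; split; [apply: chart_region_open; exact: openT|exists x].
  apply: filterS => _ [y [iy ay _] <-]; rewrite chartK// coord_sum//.
  by apply: eq_bigr => j _; rewrite coordZ.
apply: (@holo_sum R n N P c (fun j w => triv_coord a (T j (chart_inv i w)))) => j Pj; apply/holoP;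
  apply: hT => //; by exists x.
Qed.

Context (T : nat -> bundle_section L) (D : set (borel X)).
Hypothesis hT : forall j, holomorphic_section (T j).
Hypothesis mD : measurable D.
Hypothesis iT : forall j, (\int[dV]_(x in D) (sqnorm h (T j x))%:E < +oo)%E.

Definition gre j k : R := \int[dV]_(x in D) cre (herm h (T j x) (T k x)).
Definition gim j k : R := \int[dV]_(x in D) cim (herm h (T j x) (T k x)).

Lemma sqnorm_integrable j : dV.-integrable D (fun x => (sqnorm h (T j x))%:E).
Proof.
apply/integrableP; split.
  by apply/measurable_EFinP; apply: measurable_funTS; exact: sqnorm_measurable.
apply: le_lt_trans (iT j); apply: ge0_le_integral => //.
- by apply: measurableT_comp => //; apply/measurable_EFinP; apply: measurable_funTS;
    exact: sqnorm_measurable.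
- by apply/measurable_EFinP; apply: measurable_funTS; exact: sqnorm_measurable.
- by move=> x _; rewrite gee0_abs// lee_fin sqnorm_ge0.
Qed.

Lemma herm_integrable j k :
  dV.-integrable D (fun x => (cre (herm h (T j x) (T k x)))%:E) /\
  dV.-integrable D (fun x => (cim (herm h (T j x) (T k x)))%:E).
Proof.
have [c1 c2] := herm_continuous h (hT j) (hT k).
have H (f : X -> R) : continuous f ->
    (forall x, `|f x| <= sqnorm h (T j x) + sqnorm h (T k x)) ->
    dV.-integrable D (fun x => (f x)%:E).
  move=> cf fle.
  apply: (@le_integrable _ _ _ dV D mD _ (fun x => (sqnorm h (T j x))%:E + (sqnorm h (T k x))%:E)%E).
  - by apply/measurable_EFinP; apply: measurable_funTS; exact: measurable_borel.
  - move=> x _; rewrite -EFinD !abse_EFin lee_fin (le_trans (fle x))//; exact: ler_norm.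
  - by apply: integrableD => //; exact: sqnorm_integrable.
by split; apply: H => // x; [exact: cre_herm_le|exact: cim_herm_le].
Qed.

Lemma sqnorm_comb (c : nat -> cplx R) N x : sqnorm h (\sum_(j < N) c j *: T j x) =
  \sum_(j < N) \sum_(k < N) (cre (c j * Num.conj (c k)) * cre (herm h (T j x) (T k x)) -
     cim (c j * Num.conj (c k)) * cim (herm h (T j x) (T k x))).
Proof.
rewrite /sqnorm herm_suml cre_sum; apply: eq_bigr => j _.
rewrite herm_sumr cre_sum; apply: eq_bigr => k _.
by rewrite hermZl hermZr mulrA [LHS]creM.
Qed.

Lemma integral_sqnorm_comb (c : nat -> cplx R) N :
  (\int[dV]_(x in D) (sqnorm h (\sum_(j < N) c j *: T j x)%R)%:E)%E =
  (\sum_(j < N) \sum_(k < N) (cre (c j * Num.conj (c k)) * gre j k -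
     cim (c j * Num.conj (c k)) * gim j k))%:E.
Proof.
pose a (j k : nat) := cre (c j * Num.conj (c k)); pose b (j k : nat) := cim (c j * Num.conj (c k)).
pose u j k x : R := a j k * cre (herm h (T j x) (T k x)) - b j k * cim (herm h (T j x) (T k x)).
have iu j k : dV.-integrable D (fun x => (u j k x)%:E).
  have [i1 i2] := herm_integrable j k.
  rewrite /u; under eq_fun do rewrite EFinB !EFinM.
  by apply: integrableB => //; exact: integrableZl.
have Iu j k : (\int[dV]_(x in D) (u j k x)%:E = (a j k * gre j k - b j k * gim j k)%:E)%E.
  have [i1 i2] := herm_integrable j k.
  rewrite /u; under eq_integral do rewrite EFinB !EFinM.
  rewrite integralB//; [|exact: integrableZl|exact: integrableZl].
  rewrite !integralZl// EFinB !EFinM /gre /gim /Rintegral !fineK//; exact: integrable_fin_num.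
transitivity (\int[dV]_(x in D) \sum_(j < N) \sum_(k < N) (u j k x)%:E)%E.
  apply: eq_integral => x _; rewrite sqnorm_comb -sumEFin; apply: eq_bigr => j _.
  by rewrite -sumEFin.
rewrite integral_sum//; last by move=> j; apply: integrable_sum.
rewrite -sumEFin; apply: eq_bigr => j _.
rewrite integral_sum// -sumEFin; apply: eq_bigr => k _; exact: Iu.
Qed.

Lemma gre_sym j k : gre j k = gre k j.
Proof. by rewrite /gre; apply: eq_Rintegral => x _; rewrite cre_hermC. Qed.

Lemma integral_sqnorm_real (x : nat -> R) N :
  (\int[dV]_(p in D) (sqnorm h (\sum_(j < N) mkc (x j) 0 *: T j p)%R)%:E)%E =
  (\sum_(j < N) \sum_(k < N) x j * x k * gre j k)%:E.
Proof.
rewrite (integral_sqnorm_comb (fun j => mkc (x j) 0)); congr (_%:E); apply: eq_bigr => j _;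
  apply: eq_bigr => k _.
by rewrite creM cimM creJ cimJ !cplxE; ring.
Qed.

(** The form is the integral of a squared norm. Kolmogorov's argument rests on this: it makes the
    stopped form nonnegative, and the diagonal entries with it. *)
Lemma gre_pos (x : nat -> R) N : 0 <= \sum_(j < N) \sum_(k < N) x j * x k * gre j k.
Proof.
rewrite -lee_fin -integral_sqnorm_real; apply: integral_ge0 => p _.
by rewrite lee_fin sqnorm_ge0.
Qed.

End Gram.

(** * Bessel's inequality and the Bergman kernel *)

Section Bergman.
Context (R : realType) (n : nat) (X : ptopologicalType) (M : complex_manifold R n X)
  (dV : {measure set (borel X) -> \bar R}) (L : line_bundle M) (h : hermitian_metric L).
Variables (d : option nat) (S : nat -> bundle_section L).
Hypothesis S_hol : forall j, in_range d j -> l2_holomorphic h dV (S j).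
Hypothesis S_on : forall j k, in_range d j -> in_range d k ->
  l2_inner h dV (S j) (S k) = (j == k)%:R.

(** Zero sections replace the arbitrary values of [S] beyond the dimension, so that finite and
    infinite dimensions share the same sums over all [j < N]. *)
Definition cutoff j : bundle_section L := fun x => if in_range d j then S j x else 0.

Lemma holomorphic0 : holomorphic_section (fun x => 0 : fiber L x).
Proof.
move=> i a _ [x [ix ax] <-]; apply/holoP; apply: (@holo_near _ _ (fun=> 0)); last exact: holo_cst.
have : nbhs (chart i x) (chart_region i a setT).
  by apply: open_nbhs_nbhs; split; [apply: chart_region_open; exact: openT|exists x].
by apply: filterS => _ [y [iy ay _] <-]; rewrite chartK// coord0.
Qed.

Lemma cutoff_hol j : holomorphic_section (cutoff j).
Proof.
rewrite /cutoff; have [/S_hol[]//|_] := boolP (in_range d j); exact: holomorphic0.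
Qed.

Lemma cutoff_l2 j : (l2_sqnorm h dV (cutoff j) < +oo)%E.
Proof.
rewrite /cutoff /l2_sqnorm; have [/S_hol[]//|_] := boolP (in_range d j).
by under eq_integral do rewrite sqnorm0; rewrite integral0.
Qed.

Lemma cutoff_gram j k : in_range d j -> in_range d k ->
  gre dV h cutoff setT j k = (j == k)%:R /\ gim dV h cutoff setT j k = 0.
Proof.
move=> dj dk; have E := S_on dj dk; rewrite /gre /gim /cutoff dj dk.
by split; [move/(congr1 (@cre R)): E|move/(congr1 (@cim R)): E]; case: (j == k).
Qed.

(** Over the whole manifold the Gram matrix of [cutoff] is the identity on the indices in range and
    zero elsewhere; coefficients out of range account for the inequality. *)
Lemma bessel (c : nat -> cplx R) N :
  (\int[dV]_x (sqnorm h (\sum_(j < N) c j *: cutoff j x)%R)%:E <= (\sum_(j < N) cmod (c j) ^+ 2)%:E)%E.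
Proof.
rewrite (integral_sqnorm_comb cutoff_hol)//; last exact: cutoff_l2.
rewrite lee_fin; apply: ler_sum => j _.
have [dj|dj] := boolP (in_range d j); last first.
  have g0 k : gre dV h cutoff setT j k = 0 /\ gim dV h cutoff setT j k = 0.
    rewrite /gre /gim /Rintegral /cutoff (negbTE dj).
    by split; (under eq_integral do rewrite herm0l); rewrite integral0.
  rewrite big1 ?sqr_ge0// => k _; have [-> ->] := g0 k; by rewrite !mulr0 subr0.
rewrite (bigD1 j)//= big1 ?addr0 => [|k kj].
  by have [-> ->] := cutoff_gram dj dj; rewrite eqxx mulr1 mulr0 subr0 cre_mulJ.
have [dk|dk] := boolP (in_range d k).
  have [-> ->] := cutoff_gram dj dk; rewrite -[_ == _]/(j == k) eq_sym (negbTE kj).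
  by rewrite !mulr0 subr0.
rewrite /gre /gim /Rintegral /cutoff (negbTE dk).
under eq_integral do rewrite herm0r; rewrite integral0.
under eq_integral do rewrite herm0r; rewrite integral0.
by rewrite !mulr0 subr0.
Qed.

(* Test the estimate on the extremal section of the Bergman kernel at x, whose
   coefficients are the conjugates of the S_j x. *)
Lemma bergman_bound (A : set (borel X)) (C : R) x : measurable A -> 0 <= C ->
  (forall s : bundle_section L, holomorphic_section s ->
    (sqnorm h (s x))%:E <= C%:E * \int[dV]_(y in A) (sqnorm h (s y))%:E)%E ->
  forall N, \sum_(j < N) sqnorm h (cutoff j x) <= C.
Proof.
move=> mA C0 H N; have [a ax] := triv_cover L x.
pose u j := triv_coord a (cutoff j x).
pose c j := Num.conj (u j).
pose s := fun y => \sum_(j < N) c j *: cutoff j y : fiber L y.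
have hs : holomorphic_section s.
  by apply: (@holomorphic_comb _ _ _ _ _ cutoff (fun=> true)) => j _; exact: cutoff_hol.
have := H s hs.
pose B := \sum_(j < N) cmod (u j) ^+ 2.
have B0 : 0 <= B by apply: sumr_ge0 => j _; exact: sqr_ge0.
have cu j : cmod (c j) = cmod (u j) by rewrite /cmod creJ cimJ sqrrN.
have sx : sqnorm h (s x) = B ^+ 2 * hcoef h a x.
  rewrite (sqnorm_coord _ _ ax); congr (_ ^+ 2 * _).
  rewrite /s coord_sum// -[RHS](ger0_norm B0) -cmod_real; congr cmod.
  apply: cplxP; rewrite ?creK ?cimK ?cre_sum ?cim_sum /B.
    by apply: eq_bigr => j _; rewrite coordZ// mulrC cre_mulJ.
  rewrite big1// => j _; rewrite coordZ// !cplxE /c creJ cimJ; ring.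
have le1 : (\int[dV]_(y in A) (sqnorm h (s y))%:E <= B%:E)%E.
  apply: (@le_trans _ _ (\int[dV]_y (sqnorm h (s y))%:E)%E).
    apply: ge0_subset_integral => //.
      by apply/measurable_EFinP; exact: sqnorm_measurable.
    by move=> y _; rewrite lee_fin sqnorm_ge0.
  apply: (le_trans (bessel c N)); rewrite lee_fin /B.
  by apply: ler_sum => j _; rewrite cu.
move=> /le_trans /(_ (lee_wpmul2l _ le1)); rewrite lee_fin => /(_ C0).
rewrite -EFinM lee_fin sx => E.
have -> : \sum_(j < N) sqnorm h (cutoff j x) = B * hcoef h a x.
  by rewrite /B mulr_suml; apply: eq_bigr => j _; rewrite (sqnorm_coord _ _ ax).
(* By [bessel] the estimate has become [B ^+ 2 * hcoef h a x <= C * B]; one factor [B] is divided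
   out when it is not zero. *)
have [B00|B00] := eqVneq B 0; first by rewrite B00 mul0r.
have {}B00 : 0 < B by rewrite lt_def B00.
by rewrite -(ler_pM2l B00) mulrA -expr2 [leRHS]mulrC.
Qed.

End Bergman.

(** * Kolmogorov's maximal inequality for random quadratic forms *)

Section Independence.
Context (R : realType) (d : measure_display) (Omega : measurableType d)
  (P : probability Omega R).
Local Open Scope ereal_scope.

(** The joint law of [Y] and [V] agrees with the product of their laws on rectangles, hence as a
    measure. Fubini then integrates [V] first; it applies because the product [Y V] is integrable,
    without integrability of [Y]. *)
Lemma indep_expectation0 (Y V : Omega -> R) :
  measurable_fun setT Y -> measurable_fun setT V ->
  (forall A B : set R, measurable A -> measurable B ->
     P (Y @^-1` A `&` V @^-1` B) = P (Y @^-1` A) * P (V @^-1` B)) ->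
  P.-integrable setT (fun w => (Y w * V w)%:E) ->
  P.-integrable setT (fun w => (V w)%:E) ->
  \int[P]_w (V w)%:E = 0 -> \int[P]_w (Y w * V w)%:E = 0.
Proof.
move=> mY mV ind iYV iV EV.
pose Y' : {mfun Omega >-> R} := HB.pack Y (isMeasurableFun.Build _ _ _ _ Y mY).
pose V' : {mfun Omega >-> R} := HB.pack V (isMeasurableFun.Build _ _ _ _ V mV).
pose YV w := (Y w, V w).
have mYV : measurable_fun setT YV by exact: measurable_fun_pair.
pose YV' : {mfun Omega >-> (R * R)%type} := HB.pack YV (isMeasurableFun.Build _ _ _ _ YV mYV).
pose mu1 := distribution P Y'; pose mu2 := distribution P V'; pose mu := distribution P YV'.
pose h (p : R * R) := (p.1 * p.2)%:E.
have mh : measurable_fun setT h.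
  by apply/measurable_EFinP; apply: measurable_funM.
have E m : measurable m -> (mu1 \x mu2) m = mu m.
  move=> mm; apply: (@product_measure_unique _ _ _ _ R mu1 mu2 mu _ _ mm) => A B mA mB.
  exact: ind.
have ih : (mu1 \x mu2).-integrable setT h.
  apply/integrableP; split => //.
  rewrite (@eq_measure_integral _ _ _ _ mu); last by move=> A mA _; exact: E.
  rewrite ge0_integral_distribution//; last exact: measurableT_comp.
  by case/integrableP: iYV.
transitivity (\int[mu]_p h p).
  by rewrite (integral_pushforward mYV mh).
rewrite -(@eq_measure_integral _ _ _ _ mu (mu1 \x mu2)); last by move=> A mA _; exact: E.
rewrite -(integral12_prod_meas1 ih).
have iv2 : mu2.-integrable setT (fun v : R => v%:E).
  apply: (integrable_pushforward mV) => //.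
  by apply/measurable_EFinP; exact: measurable_id.
apply: integral0_eq => x _; rewrite /fubini_F /h /=.
under eq_integral do rewrite EFinM.
rewrite integralZl//.
have -> : \int[mu2]_y y%:E = 0.
  rewrite -EV; apply: (@integral_pushforward _ _ _ _ R V mV P setT (fun v : R => v%:E)) => //.
  by apply/measurable_EFinP; exact: measurable_id.
by rewrite mule0.
Qed.

Variable xi : nat -> Omega -> R.
Hypothesis mxi : forall j, measurable_fun setT (xi j).
Hypothesis ixi : forall (J : seq nat) (A : nat -> set R), uniq J ->
  (forall j, measurable (A j)) ->
  P (\bigcap_(j in [set` J]) (xi j @^-1` A j)) = \prod_(j <- J) P (xi j @^-1` A j).

Definition cylinders n : set (set Omega) :=
  [set C | exists2 A : nat -> set R, (forall j, measurable (A j)) &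
    C = \bigcap_(j in [set` iota 0 n]) (xi j @^-1` A j)].

(** The sigma-algebra of [xi 0], ..., [xi n.-1] as a second measurable structure on [Omega]: to
    depend on the past only is to be measurable on this type. *)
Definition past n := g_sigma_algebraType (cylinders n).

Lemma xi_preimage_measurable j (A : set R) : measurable A -> measurable (xi j @^-1` A).
Proof. by move=> mA; rewrite -[X in measurable X]setTI; exact: mxi. Qed.

(** For fixed [B], both sides are finite measures in [C]; they agree on the cylinders, which are
    stable under intersection and include [Omega], hence on the sigma-algebra they generate. *)
Lemma past_indep n k (C : set Omega) (B : set R) : (n <= k)%N -> measurable B ->
  <<s cylinders n >> C -> P (C `&` xi k @^-1` B) = P C * P (xi k @^-1` B).
Proof.
move=> nk mB; set E := xi k @^-1` B.
have mE : measurable E by exact: xi_preimage_measurable.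
have cm : cylinders n `<=` measurable.
  move=> _ [A mA ->].
  have -> : \bigcap_(j in [set` iota 0 n]) (xi j @^-1` A j) =
      \big[setI/setT]_(j <- iota 0 n) (xi j @^-1` A j).
    by rewrite bigcap_seq.
  by apply: bigsetI_measurable => j _; exact: xi_preimage_measurable.
have E0 : (0 <= fine (P E))%R by exact: fine_ge0.
pose m1 := mrestr P mE; pose m2 := mscale (NngNum E0) P.
have m2E X : m2 X = P X * P E.
  by rewrite /m2 /mscale /= fineK ?fin_num_measure// muleC.
move=> sC; rewrite -m2E.
have := @g_sigma_algebra_measure_unique _ R Omega (cylinders n) cm (fun=> setT) _ _ m1 m2 _ _ _ C sC.
apply => //.
- by move=> _; exists (fun=> setT) => //; rewrite bigcap_set_type //; apply/seteqP.
- by rewrite bigcup_const//; exists 0%N.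
- move=> _ _ [A mA ->] [A' mA' ->]; exists (fun j => A j `&` A' j).
    by move=> j; exact: measurableI.
  by rewrite -bigcapI; apply: eq_bigcapr => j _; rewrite preimage_setI.
- move=> _ [A mA ->]; apply: etrans (esym (m2E _)); rewrite /m1 /mrestr.
  (* Joins [B] at index [k] to the constraints of the cylinder, so that independence over
     [k :: iota 0 n] gives the product formula. *)
  pose A' j := if j == k then B else A j.
  have kn : k \notin iota 0 n by rewrite mem_iota add0n /= -leqNgt.
  have AA' j : j \in iota 0 n -> A' j = A j.
    by move=> jn; rewrite /A'; case: eqVneq => // jk; rewrite -jk jn in kn.
  have uk : uniq (k :: iota 0 n) by rewrite /= kn iota_uniq.
  have mA'' j : measurable (A' j) by rewrite /A'; case: ifP.
  have := ixi uk mA''; rewrite big_cons.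
  have -> : A' k = B by rewrite /A' eqxx.
  have -> : \prod_(j <- iota 0 n) P (xi j @^-1` A' j) =
      \prod_(j <- iota 0 n) P (xi j @^-1` A j).
    by apply: eq_big_seq => j jn; rewrite AA'.
  rewrite -(ixi (iota_uniq 0 n) mA) muleC => <-; congr (P _).
  apply/seteqP; split=> w.
    move=> [h1 h2] j /=; rewrite inE => /predU1P[->|jn]; first by rewrite /A' eqxx.
    by rewrite AA'//; exact: h1.
  move=> h; split.
    by move=> j jn; have := h j; rewrite /= inE jn orbT AA'//; apply.
  by have := h k; rewrite /= inE eqxx /A' eqxx; apply.
- move=> _; apply: le_lt_trans (probability_le1 P _) (ltry 1).
  by apply: measurableI.
Qed.

Lemma past_xi n j : (j < n)%N -> measurable_fun setT (xi j : past n -> R).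
Proof.
move=> jn _ B mB; rewrite setTI; apply: sub_sigma_algebra.
exists (fun i => if i == j then B else setT); first by move=> i; case: ifP.
apply/seteqP; split=> w.
  by move=> h i _ /=; case: eqVneq => [->|].
by move=> h; have := h j; rewrite /= mem_iota add0n jn eqxx; apply.
Qed.

Lemma past_expectation0 n k (Y : past n -> R) : (n <= k)%N -> measurable_fun setT Y ->
  measurable_fun setT (Y : Omega -> R) ->
  P.-integrable setT (fun w => (Y w * xi k w)%:E) ->
  P.-integrable setT (fun w => (xi k w)%:E) ->
  \int[P]_w (xi k w)%:E = 0 -> \int[P]_w (Y w * xi k w)%:E = 0.
Proof.
move=> nk mY mY' iYx ix Ex; apply: indep_expectation0 => // A B mA mB.
by apply: (past_indep nk mB); have := mY measurableT A mA; rewrite setTI.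
Qed.

End Independence.

(** * Square integrable random variables *)

Section SquareIntegrable.
Context (R : realType) (d : measure_display) (Omega : measurableType d)
  (P : probability Omega R).

Definition sqi (f : Omega -> R) :=
  measurable_fun setT f /\ P.-integrable setT (fun w => (f w ^+ 2)%:E).

Lemma sqi_mul f g : sqi f -> sqi g -> P.-integrable setT (fun w => (f w * g w)%:E).
Proof.
move=> [mf jf] [mg jg].
have := integrableD measurableT jf jg; apply: le_integrable => //.
  by apply/measurable_EFinP; exact: measurable_funM.
move=> w _; rewrite /= lee_fin [leRHS]ger0_norm ?addr_ge0 ?sqr_ge0//.
have h1 := sqr_ge0 (f w - g w); have h2 := sqr_ge0 (f w + g w).
rewrite ler_norml; apply/andP; split.
  by have h3 := sqr_ge0 (f w); have h4 := sqr_ge0 (g w); rewrite sqrrD in h2; lra.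
by have h3 := sqr_ge0 (f w); have h4 := sqr_ge0 (g w); rewrite sqrrB in h1; lra.
Qed.

Lemma sqi_cst (k : R) : sqi (fun=> k).
Proof.
split; first exact: measurable_cst.
by apply: finite_measure_integrable_cst.
Qed.

Lemma sqi_integrable f : sqi f -> P.-integrable setT (fun w => (f w)%:E).
Proof.
move=> sf; have := sqi_mul sf (sqi_cst 1).
by under eq_fun do rewrite mulr1.
Qed.

Lemma sqiD f g : sqi f -> sqi g -> sqi (fun w => f w + g w).
Proof.
move=> sf sg; split; first by apply: measurable_funD; [case: sf|case: sg].
have -> : (fun w => ((f w + g w) ^+ 2)%:E) =
    (fun w => (f w * f w)%:E + (f w * g w)%:E + ((f w * g w)%:E + (g w * g w)%:E))%E.
  by apply/funext => w; rewrite -!EFinD; congr (_%:E); ring.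
by apply: integrableD => //; apply: integrableD => //; exact: sqi_mul.
Qed.

Lemma sqiZ (k : R) f : sqi f -> sqi (fun w => k * f w).
Proof.
move=> [mf jf]; split; first by apply: measurable_funM => //; exact: measurable_cst.
under eq_fun do rewrite exprMn EFinM.
exact: integrableZl.
Qed.

Lemma sqi_if f (b : Omega -> bool) : measurable_fun setT b -> sqi f ->
  sqi (fun w => if b w then f w else 0).
Proof.
move=> mb [mf jf]; split; first exact: measurable_fun_ifT.
apply: le_integrable jf => //.
  by apply/measurable_EFinP; apply: measurable_funX; exact: measurable_fun_ifT.
by move=> w _; case: (b w); rewrite // expr0n /= normr0 lee_fin.
Qed.

Lemma sqi_sum I (s : seq I) (f : I -> Omega -> R) : (forall i, sqi (f i)) ->
  sqi (fun w => \sum_(i <- s) f i w).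
Proof.
move=> H; elim: s => [|i s IH]; first by under eq_fun do rewrite big_nil; exact: sqi_cst.
by under eq_fun do rewrite big_cons; exact: sqiD.
Qed.

End SquareIntegrable.

(** * Optional stopping and the maximal inequality *)

Section Kolmogorov.
Context (R : realType) (d : measure_display) (Omega : measurableType d)
  (P : probability Omega R).
Variables (xi : nat -> Omega -> R) (s2 : R) (g : nat -> nat -> R).
Hypothesis ixi : forall (J : seq nat) (A : nat -> set R), uniq J ->
  (forall j, measurable (A j)) ->
  (P (\bigcap_(j in [set` J]) (xi j @^-1` A j)) = \prod_(j <- J) P (xi j @^-1` A j))%E.
Hypothesis sxi : forall j, sqi P (xi j).
Hypothesis exi : forall j, (\int[P]_w (xi j w)%:E = 0)%E.
Hypothesis vxi : forall j, (\int[P]_w (xi j w ^+ 2)%:E <= s2%:E)%E.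
Hypothesis gsym : forall i j, g i j = g j i.
Hypothesis gpos : forall n (x : nat -> R),
  0 <= \sum_(i < n) \sum_(j < n) x i * x j * g i j.

Definition qform n w : R := \sum_(i < n) \sum_(j < n) xi i w * xi j w * g i j.
Definition lform n w : R := \sum_(i < n) g i n * xi i w.

Lemma qformS n w :
  qform n.+1 w = qform n w + (2 * (lform n w * xi n w) + xi n w ^+ 2 * g n n).
Proof.
rewrite /qform /lform big_ord_recr /= big_ord_recr /=.
under eq_bigr do rewrite big_ord_recr /=.
rewrite big_split /= -!addrA; congr (_ + _).
rewrite (eq_bigr (fun i : 'I_n => (g i n * xi i w) * xi n w)); last by move=> i _; ring.
rewrite [X in _ + (X + _)](eq_bigr (fun i : 'I_n => (g i n * xi i w) * xi n w)); last first.
  by move=> i _; rewrite gsym; ring.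
by rewrite -mulr_suml; ring.
Qed.

Lemma gdiag_ge0 n : 0 <= g n n.
Proof.
have := gpos n.+1 (fun i => (i == n)%:R).
rewrite big_ord_recr /= big_ord_recr /= eqxx !mul1r.
rewrite big1 ?add0r; last first.
  by move=> i _; rewrite big1// => j _; rewrite (ltn_eqF (ltn_ord i)) !mul0r.
by rewrite big1 ?add0r// => j _; rewrite (ltn_eqF (ltn_ord j)) mulr0 mul0r.
Qed.

Lemma qform_ge0 n w : 0 <= qform n w. Proof. exact: (gpos n (fun i => xi i w)). Qed.

Variable eps : R.
Hypothesis eps0 : 0 < eps.

Fixpoint alive n w : bool :=
  if n is n'.+1 then alive n' w && (qform n w <= eps) else true.

(** The quadratic form frozen at its first value above [eps], written as a sum of increments:
    whether the increment from [n'] to [n'.+1] is added depends on [xi 0], ..., [xi n'.-1] only. *)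
Fixpoint stopped n w : R :=
  if n is n'.+1 then
    stopped n' w + (if alive n' w then qform n w - qform n' w else 0)
  else 0.

Lemma stoppedP n w :
  (alive n w -> stopped n w = qform n w) /\ (~~ alive n w -> eps < stopped n w).
Proof.
elim: n => [|n [IH1 IH2]] /=; first by rewrite /qform big_ord0.
have [a|na] /= := boolP (alive n w).
  by rewrite (IH1 a) subrKC; split => //; rewrite -ltNge.
by split => // _; rewrite addr0; exact: IH2.
Qed.

Lemma stopped_ge0 n w : 0 <= stopped n w.
Proof.
have [h1 h2] := stoppedP n w; have [a|na] := boolP (alive n w).
  by rewrite h1// qform_ge0.
exact: ltW (lt_trans eps0 (h2 na)).
Qed.

Lemma alive_le n m w : (n <= m)%N -> alive m w -> alive n w.
Proof.
move=> /subnKC <-; elim: (m - n)%N => [|k IH]; first by rewrite addn0.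
by rewrite addnS /= => /andP[/IH].
Qed.

Let mxi j : measurable_fun setT (xi j). Proof. by case: (sxi j). Qed.

Lemma past_lform n m : (m <= n)%N -> measurable_fun setT (qform m : past xi n -> R) /\
  (forall k, measurable_fun setT ((fun w => \sum_(i < m) g i k * xi i w) : past xi n -> R)).
Proof.
move=> mn; have pxi (i : 'I_m) : measurable_fun setT (xi i : past xi n -> R).
  by apply: past_xi; exact: leq_trans (ltn_ord i) mn.
split.
  apply: measurable_sum => i; apply: measurable_sum => j.
  by apply: measurable_funM => //; apply: measurable_funM.
by move=> k; apply: measurable_sum => i; apply: measurable_funM.
Qed.

Lemma past_alive n m : (m <= n)%N -> measurable_fun setT (alive m : past xi n -> bool).
Proof.
elim: m => [|m IH] mn /=; first exact: measurable_cst.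
apply: measurable_and; first exact: (IH (ltnW mn)).
by apply: measurable_fun_ler => //; case: (past_lform mn).
Qed.

Lemma qform_measurable n : measurable_fun setT (qform n).
Proof.
apply: measurable_sum => i; apply: measurable_sum => j.
by apply: measurable_funM => //; apply: measurable_funM.
Qed.

Lemma alive_measurable n : measurable_fun setT (alive n).
Proof.
elim: n => [|m IH] /=; first exact: measurable_cst.
by apply: measurable_and => //; apply: measurable_fun_ler => //; exact: qform_measurable.
Qed.

Let Y n w := if alive n w then lform n w else 0.
Let V n w := if alive n w then xi n w else 0.

Let sqiY n : sqi P (Y n).
Proof.
apply: sqi_if; first exact: alive_measurable.
by apply: sqi_sum => i; exact: sqiZ.
Qed.
Let sqiV n : sqi P (V n).
Proof. by apply: sqi_if => //; exact: alive_measurable. Qed.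

Lemma stoppedS n w : stopped n.+1 w = stopped n w +
  (2 * (Y n w * xi n w) + g n n * V n w ^+ 2).
Proof.
rewrite /= /Y /V; case: (alive n w); last by rewrite !(mul0r, mulr0, addr0, expr0n).
by rewrite qformS; ring.
Qed.

(** In the increment the cross term [Y n * xi n] has mean zero, since [Y n] depends on the past and
    [xi n] is centered and independent of it. The square term contributes at most [s2 * g n n],
    which adds up to the trace. *)
Lemma stopped_expectation n : P.-integrable setT (fun w => (stopped n w)%:E) /\
  (\int[P]_w (stopped n w)%:E <= (s2 * \sum_(j < n) g j j)%:E)%E.
Proof.
elim: n => [|n [IH1 IH2]].
  split; first exact: integrable0.
  by rewrite big_ord0 mulr0 integral0.
have iY : P.-integrable setT (fun w => (Y n w * xi n w)%:E) by exact: sqi_mul.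
have [_ iV] := sqiV n.
have E : (fun w => (stopped n.+1 w)%:E) = (fun w => (stopped n w)%:E +
    (2%:E * (Y n w * xi n w)%:E + (g n n)%:E * (V n w ^+ 2)%:E))%E.
  by apply/funext => w; rewrite stoppedS !EFinD !EFinM.
have i1 : P.-integrable setT (fun w => 2%:E * (Y n w * xi n w)%:E)%E.
  exact: integrableZl.
have i2 : P.-integrable setT (fun w => (g n n)%:E * (V n w ^+ 2)%:E)%E.
  exact: integrableZl.
rewrite E; split; first by apply: integrableD => //; exact: integrableD.
rewrite integralD//; last exact: integrableD.
rewrite (integralD measurableT i1 i2) !integralZl//.
have -> : (\int[P]_w (Y n w * xi n w)%:E = 0)%E.
  apply: (past_expectation0 mxi ixi (leqnn n)) => //.
  - apply: measurable_fun_ifT; first exact: past_alive.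
      by case: (past_lform (leqnn n)) => _; exact.
    exact: measurable_cst.
  - by case: (sqiY n).
  - exact: sqi_integrable.
rewrite mule0 add0e big_ord_recr /= mulrDr EFinD; apply: leeD => //.
rewrite mulrC EFinM; apply: lee_wpmul2l; first by rewrite lee_fin gdiag_ge0.
apply: le_trans (vxi n); apply: ge0_le_integral => //.
- by move=> w _; rewrite lee_fin sqr_ge0.
- by case/integrableP: iV.
- by case: (sxi n) => _ /integrableP[].
- by move=> w _; rewrite lee_fin /V; case: (alive n w) => //; rewrite expr0n sqr_ge0.
Qed.

(** Markov's inequality for the stopped form: once [alive] fails, it is frozen at a value above
    [eps]. *)
Lemma kolmogorov_maximal N :
  (eps%:E * P [set w | ~~ alive N w] <= (s2 * \sum_(j < N) g j j)%:E)%E.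
Proof.
have [iS leS] := stopped_expectation N; apply: le_trans leS.
set A := [set w | ~~ alive N w].
have mA : measurable A.
  have := measurable_neg (alive_measurable N).
  by move=> /(_ measurableT [set true] I); rewrite setTI.
have -> : (P A = \int[P]_w (\1_A w)%:E)%E by rewrite integral_indic// setIT.
rewrite -ge0_integralZl//; first last.
- by rewrite lee_fin ltW.
- by apply/measurable_EFinP.
apply: ge0_le_integral => //.
- by move=> w _; rewrite -EFinM lee_fin mulr_ge0 ?(ltW eps0)// indicE.
- by apply: measurable_funeM; apply/measurable_EFinP.
- by case/integrableP: iS.
move=> w _; rewrite -EFinM lee_fin indicE.
have [wA|wA] := boolP (w \in A); last by rewrite mulr0 stopped_ge0.
rewrite mulr1 ltW//; apply: (stoppedP N w).2.
by move: wA; rewrite inE.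
Qed.

End Kolmogorov.

(** * Almost sure smallness of the tails *)

Section KolmogorovSeries.
Context (R : realType) (d : measure_display) (Omega : measurableType d)
  (P : probability Omega R).
Variables (xi : nat -> Omega -> R) (s2 : R) (g : nat -> nat -> R).
Hypothesis ixi : forall (J : seq nat) (A : nat -> set R), uniq J ->
  (forall j, measurable (A j)) ->
  (P (\bigcap_(j in [set` J]) (xi j @^-1` A j)) = \prod_(j <- J) P (xi j @^-1` A j))%E.
Hypothesis sxi : forall j, sqi P (xi j).
Hypothesis exi : forall j, (\int[P]_w (xi j w)%:E = 0)%E.
Hypothesis vxi : forall j, (\int[P]_w (xi j w ^+ 2)%:E <= s2%:E)%E.
Hypothesis gsym : forall i j, g i j = g j i.
Hypothesis gpos : forall m n (x : nat -> R),
  0 <= \sum_(i < n) \sum_(j < n) x i * x j * g (m + i)%N (m + j)%N.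
Variable C : R.
Hypothesis gC : forall n, \sum_(j < n) g j j <= C.

Let q m := qform (fun j => xi (m + j)%N) (fun i j => g (m + i)%N (m + j)%N).
Let al m eps := alive (fun j => xi (m + j)%N) (fun i j => g (m + i)%N (m + j)%N) eps.

Let s20 : 0 <= s2.
Proof.
rewrite -lee_fin; apply: le_trans (vxi 0%N); apply: integral_ge0 => w _.
by rewrite lee_fin sqr_ge0.
Qed.

Let al_measurable m eps N : measurable [set w | ~~ al m eps N w].
Proof.
have ma : measurable_fun setT (al m eps N).
  by apply: alive_measurable => j; exact: sxi.
have := measurable_neg ma.
by move=> /(_ measurableT [set true] I); rewrite setTI.
Qed.

Let bad m eps := \bigcup_N [set w | ~~ al m eps N w].

Let ixi_shift m (J : seq nat) (A : nat -> set R) : uniq J ->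
  (forall j, measurable (A j)) ->
  (P (\bigcap_(j in [set` J]) (xi (m + j) @^-1` A j)) =
   \prod_(j <- J) P (xi (m + j) @^-1` A j))%E.
Proof.
move=> uJ mA; have := @ixi (map (addn m) J) (fun j => A (j - m)%N).
rewrite map_inj_uniq; last exact: addnI.
move=> /(_ uJ (fun j => mA _)); rewrite big_map.
under [in RHS]eq_bigr do rewrite addKn.
move=> <-; congr (P _); apply/seteqP; split=> w h j /=.
  by move=> /mapP[i iJ ->]; rewrite addKn; exact: h.
by move=> jJ; have := h (m + j)%N; rewrite /= addKn; apply; exact: map_f.
Qed.

(** The failure events increase with [N], so the maximal inequality passes to their union by
    continuity of [P] from below. *)
Let bad_le m (eps b : R) : 0 < eps ->
  (forall N, \sum_(j < N) g (m + j)%N (m + j)%N <= b) ->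
  (eps%:E * P (bad m eps) <= (s2 * b)%:E)%E.
Proof.
move=> eps0 H.
have mono : {homo (fun N => [set w | ~~ al m eps N w]) : n p / (n <= p)%N >-> (n <= p)%O}.
  move=> n p np; apply/subsetPset => w /=; apply: contra.
  exact: alive_le.
have mb : measurable (bad m eps) by exact: bigcupT_measurable.
have cv := @nondecreasing_cvg_mu _ Omega R P _ (al_measurable m eps) mb mono.
rewrite -lee_pdivlMl// -EFinM.
apply: (cvge_le _ cv) => //; near=> N.
rewrite /= EFinM lee_pdivlMl//.
apply: le_trans (@kolmogorov_maximal _ _ _ P (fun j => xi (m + j)%N) s2 _ _ _ _ _ _ _ _ eps0 N) _ => //.
- exact: ixi_shift.
- by rewrite lee_fin ler_wpM2l.
Unshelve. all: by end_near.
Qed.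

(** The partial traces are bounded, so the trace of the tail from a suitable [m] on is arbitrarily
    small, and with it the probability that the tail form ever exceeds [eps]. Hence it is a null
    event that this happens for every [m]; the values [k.+1%:R^-1] of [eps] suffice. *)
Lemma kolmogorov_series : {ae P, forall w, forall eps : R, 0 < eps ->
  exists m, forall n, q m n w <= eps}.
Proof.
have null (eps : R) : 0 < eps -> P (\bigcap_m bad m eps) = 0%E.
  move=> eps0; apply/eqP; rewrite eq_le measure_ge0 andbT.
  have mb m : measurable (bad m eps) by apply: bigcupT_measurable => N; exact: al_measurable.
  have mcap : measurable (\bigcap_m bad m eps) by exact: bigcapT_measurable.
  apply/lee_addgt0Pr => delta delta0; rewrite add0e.
  pose S := range (fun n => \sum_(j < n) g j j).
  have hS : has_sup S.
    by split; [exists (\sum_(j < 0) g j j); exists 0%N|exists C => _ [n _ <-]].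
  (* With a tail trace below this value, [bad_le] gives probability at most [delta * s2 / (s2 + 1)];
     the [1] covers [s2 = 0]. *)
  have e0 : 0 < delta * eps / (s2 + 1).
    by rewrite divr_gt0 ?mulr_gt0// ltr_pwDr.
  have [_ [m _ <-] mP] := sup_adherent e0 hS.
  have tail N : \sum_(j < N) g (m + j)%N (m + j)%N <= delta * eps / (s2 + 1).
    have : \sum_(j < m + N) g j j <= sup S.
      by apply: ub_le_sup; [case: hS|exists (m + N)%N].
    by rewrite big_split_ord /=; move: mP; set A := \sum_(j < m) _; lra.
  have bl := bad_le eps0 tail.
  have le1 : (P (\bigcap_m bad m eps) <= P (bad m eps))%E.
    by apply: le_measure; rewrite ?inE//; exact: bigcap_inf.
  apply: (le_trans le1); rewrite -(@lee_pmul2l _ eps%:E)//.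
  apply: (le_trans bl); rewrite -EFinM lee_fin.
  have -> : s2 * (delta * eps / (s2 + 1)) = eps * delta * (s2 / (s2 + 1)) by ring.
  rewrite ler_piMr ?mulr_ge0 ?(ltW eps0) ?(ltW delta0)//.
  by rewrite ler_pdivrMr ?ltr_pwDr// mul1r lerDl.
have neg k : P.-negligible (\bigcap_m bad m k.+1%:R^-1).
  exists (\bigcap_m bad m k.+1%:R^-1); split => //; last by rewrite null.
  apply: bigcapT_measurable => m; apply: bigcupT_measurable => N; exact: al_measurable.
apply: negligibleS (negligible_bigcup neg) => w /= H.
apply: contrapT => nb; apply: H => eps eps0.
have [k hk] := ltr_add_invr eps0; rewrite add0r in hk.
have : ~ (\bigcap_m bad m k.+1%:R^-1) w by move=> h; apply: nb; exists k.
move=> /existsNP[m /not_implyP[_ nbad]]; exists m => n.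
have : al m k.+1%:R^-1 n w by apply/negPn/negP => h; apply: nbad; exists n.
(* [alive] says nothing about index [0], where the form is an empty sum. *)
have [->|n0] := posnP n; first by rewrite /q /qform big_ord0 => _; exact: ltW.
by rewrite -(prednK n0) /= => /andP[_ /le_trans]; apply; exact: ltW.
Qed.

End KolmogorovSeries.

(** * Gaussian moments *)

Section NormalMoments.
Context (R : realType).
Local Notation mu := (@lebesgue_measure R).
Local Open Scope ereal_scope.

(** The Radon-Nikodym derivative of [normal_prob] agrees almost everywhere with [normal_pdf],
    because both have the same integral over every measurable set. *)
Lemma ge0_integral_normal_prob (m s : R) (f : measurableTypeR R -> \bar R) :
  measurable_fun setT f -> (forall x, 0 <= f x) ->
  \int[normal_prob m s]_x f x = \int[mu]_x (f x * (normal_pdf m s x)%:E).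
Proof.
move=> mf f0; have dom := @normal_prob_dominates R m s.
pose nu : {finite_measure set (measurableTypeR R) -> \bar R} := normal_prob m s.
pose g := Radon_Nikodym_SigmaFinite.f nu mu.
have gi : mu.-integrable setT g by exact: Radon_Nikodym_SigmaFinite.f_integrable.
have mg : measurable_fun setT g by case/integrableP: gi.
have mp : measurable_fun setT (fun x : measurableTypeR R => (normal_pdf m s x)%:E).
  by apply/measurable_EFinP; exact: measurable_normal_pdf.
rewrite -(@Radon_Nikodym_SigmaFinite.change_of_variables _ _ R nu mu dom f setT)//.
apply: ae_eq_integral => //; [exact: emeasurable_funM|exact: emeasurable_funM|].
apply: ae_eqe_mul2l; apply: integral_ae_eq => // E _ mE.
by rewrite -(Radon_Nikodym_SigmaFinite.f_integral dom).
Qed.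

(** With [u = x ^+ 2 / (4 * s ^+ 2)], the density of variance [s ^+ 2] is a multiple of
    [expR (- u) * expR (- u)]. One factor absorbs [x ^+ 2] through [u * expR (- u) <= 1]; the other
    is, up to a constant, the density of variance [2 * s ^+ 2], which is integrable. *)
Lemma normal_sqr_fin (s : R) : (s != 0)%R ->
  \int[normal_prob 0 s]_x (x ^+ 2)%:E < +oo.
Proof.
move=> s0; rewrite ge0_integral_normal_prob; first last.
- by move=> x; rewrite lee_fin sqr_ge0.
- by apply/measurable_EFinP; exact: measurable_funX.
pose t : R := (Num.sqrt 2 * s)%R.
have t2 : (t ^+ 2 = 2 * s ^+ 2)%R by rewrite exprMn sqr_sqrtr.
have t0 : (t != 0)%R by rewrite mulf_neq0// gt_eqF// sqrtr_gt0.
have pk := normal_peak_gt0 t0.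
pose K := (4 * s ^+ 2 * normal_peak s / normal_peak t)%R.
have ip : mu.-integrable setT (fun x : measurableTypeR R => K%:E * (normal_pdf 0 t x)%:E).
  by apply: integrableZl => //; exact: integrable_normal_pdf.
have mf : measurable_fun setT (fun x : measurableTypeR R => (x ^+ 2)%:E * (normal_pdf 0 s x)%:E).
  apply: emeasurable_funM; apply/measurable_EFinP; first exact: measurable_funX.
  exact: measurable_normal_pdf.
have s20 : (0 < s ^+ 2)%R by rewrite exprn_even_gt0.
have key (x : R) : (x ^+ 2 * normal_pdf 0 s x <= K * normal_pdf 0 t x)%R.
  rewrite !normal_pdfE// /normal_fun !subr0 t2.
  set u := (x ^+ 2 / (4 * s ^+ 2))%R.
  have -> : (- x ^+ 2 / (s ^+ 2 *+ 2) = - u + - u)%R.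
    by rewrite /u; field.
  have -> : (- x ^+ 2 / ((2 * s ^+ 2) *+ 2) = - u)%R.
    by rewrite /u; field.
  have -> : (x ^+ 2 = 4 * s ^+ 2 * u)%R by rewrite /u; field.
  have -> : (K * (normal_peak t * expR (- u)) = 4 * s ^+ 2 * normal_peak s * expR (- u))%R.
    by rewrite /K; field; rewrite gt_eqF.
  rewrite expRD.
  have -> : (4 * s ^+ 2 * u * (normal_peak s * (expR (- u) * expR (- u))) =
    4 * s ^+ 2 * normal_peak s * expR (- u) * (u * expR (- u)))%R by ring.
  have C0 : (0 <= 4 * s ^+ 2 * normal_peak s * expR (- u))%R.
    apply: mulr_ge0 (expR_ge0 _); apply: mulr_ge0 (normal_peak_ge0 _).
    by apply: mulr_ge0 (ltW s20).
  rewrite ler_piMr//.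
  rewrite expRN ler_pdivrMr ?expR_gt0// mul1r.
  by apply: le_trans (expR_ge1Dx u); rewrite lerDr.
case/integrableP: ip => _; apply: le_lt_trans.
apply: ge0_le_integral => //.
- by move=> x _; rewrite -EFinM lee_fin mulr_ge0 ?sqr_ge0// normal_pdf_ge0.
- apply: measurableT_comp => //; apply: measurable_funeM.
  by apply/measurable_EFinP; exact: measurable_normal_pdf.
by move=> x _; rewrite -!EFinM; apply: le_trans (lee_abs _); rewrite lee_fin.
Qed.

Lemma normal_symmetric (s : R) : (s != 0)%R ->
  \int[normal_prob 0 s]_x (Num.max x 0)%:E = \int[normal_prob 0 s]_x (Num.max (- x)%R 0)%:E.
Proof.
move=> s0.
have mI : measurable_fun setT (fun x : measurableTypeR R => x) by exact: measurable_id.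
have mN : measurable_fun setT (fun x : measurableTypeR R => - x)%R.
  by apply: measurableT_comp => //; exact: oppr_measurable.
have m1 : measurable_fun setT (fun x : measurableTypeR R => (Num.max x 0)%:E).
  by apply/measurable_EFinP; apply: measurable_maxr => //; exact: measurable_cst.
have m2 : measurable_fun setT (fun x : measurableTypeR R => (Num.max (- x)%R 0)%:E).
  by apply/measurable_EFinP; apply: measurable_maxr => //; exact: measurable_cst.
rewrite !ge0_integral_normal_prob//; last 2 first.
- by move=> x; rewrite lee_fin le_max lexx orbT.
- by move=> x; rewrite lee_fin le_max lexx orbT.
pose G (x : R) := (Num.max (- x) 0 * normal_pdf 0 s x)%R.
have sym (x : R) : (normal_pdf 0 s (- x) = normal_pdf 0 s x)%R.
  by rewrite !normal_pdfE// /normal_fun !subr0 sqrrN.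
have := @ge0_integration_by_substitutionNy R G 0.
rewrite oppr0 => H.
have {}H : \int[mu]_(x in `]-oo, 0%R]) (G x)%:E = \int[mu]_(x in `[0%R, +oo[) ((G \o -%R) x)%:E.
  apply: H.
    apply: continuous_subspaceT => x; apply: cvgM; last exact: continuous_normal_pdf.
    have -> : (fun x : R => Num.max (- x)%R 0%R) = (fun x => (`|x| - x) / 2)%R.
      apply/funext => y; have [y0|y0] := leP 0%R y.
        by rewrite max_r ?oppr_le0// ger0_norm// subrr mul0r.
      by rewrite max_l ?oppr_ge0 ?(ltW y0)// ltr0_norm//; field.
    have -> : Num.max (- x)%R 0%R = ((`|x| - x) / 2)%R.
      have [y0|y0] := leP 0%R x.
        by rewrite max_r ?oppr_le0// ger0_norm// subrr mul0r.
      by rewrite max_l ?oppr_ge0 ?(ltW y0)// ltr0_norm//; field.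
    apply: cvgM; last exact: cvg_cst.
    by apply: cvgB; [exact: cvg_norm|exact: cvg_id].
  by move=> x _; rewrite mulr_ge0 ?normal_pdf_ge0// le_max lexx orbT.
transitivity (\int[mu]_(x in `[0%R, +oo[) ((G \o -%R) x)%:E); last rewrite -H.
  rewrite [RHS]integral_mkcond; apply: eq_integral => x _.
  rewrite patchE -EFinM /G /= opprK sym; case: ifPn => //.
  rewrite notin_setE /= in_itv /= andbT => /negP; rewrite -ltNge => x0.
  by rewrite max_r ?mul0r// ltW.
rewrite [LHS]integral_mkcond; apply: eq_integral => x _.
rewrite patchE -EFinM /G /=; case: ifPn => //.
rewrite notin_setE /= in_itv /= => /negP; rewrite -ltNge => x0.
by rewrite max_r ?mul0r// oppr_le0 ltW.
Qed.

(** The law [nu] is the Dirac mass or a normal law according to the two cases of [centered_normal].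
    Two facts about it suffice: a finite second moment, and equal integrals of the positive and
    negative parts, whose difference is the mean. *)
Lemma centered_normal_moments (d : measure_display) (Omega : measurableType d)
    (P : probability Omega R) (Z : Omega -> R) :
  measurable_fun setT Z -> centered_normal P Z ->
  sqi P Z /\ \int[P]_w (Z w)%:E = 0.
Proof.
move=> mZ [s sP].
have mZ' : measurable_fun setT (Z : Omega -> measurableTypeR R) by exact: mZ.
pose Z' : {mfun Omega >-> measurableTypeR R} :=
  HB.pack (Z : Omega -> measurableTypeR R) (isMeasurableFun.Build _ _ _ _ (Z : Omega ->
    measurableTypeR R) mZ').
have [nu [nuP nu2 nus]] : exists nu : {measure set (measurableTypeR R) -> \bar R},
  [/\ (forall A : set (measurableTypeR R), measurable A -> P (Z @^-1` A) = nu A),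
      \int[nu]_x (x ^+ 2)%:E < +oo &
      \int[nu]_x (Num.max x 0)%:E = \int[nu]_x (Num.max (- x)%R 0)%:E].
  have [s0|s0] := eqVneq s 0%R.
    exists (dirac (0%R : measurableTypeR R)); split; first by move=> A mA; rewrite sP// s0 eqxx.
      rewrite integral_dirac//; last by apply/measurable_EFinP; exact: measurable_funX.
      by rewrite expr0n mule0.
    rewrite !integral_dirac// ?oppr0//; apply/measurable_EFinP;
      apply: measurable_maxr => //; exact: measurable_cst.
  exists (normal_prob 0 s); split; [|exact: normal_sqr_fin|exact: normal_symmetric].
  by move=> A mA; rewrite sP// (negbTE s0).
have law (h : measurableTypeR R -> R) : measurable_fun setT h -> (forall x, (0 <= h x)%R) ->
    \int[P]_w (h (Z w))%:E = \int[nu]_x (h x)%:E.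
  move=> mh h0; rewrite -(@eq_measure_integral _ _ _ _ nu (distribution P Z')).
    rewrite ge0_integral_distribution//; first exact/measurable_EFinP.
  by move=> A mA _; exact: nuP.
have sZ : sqi P Z.
  split => //; apply/integrableP; split.
    by apply/measurable_EFinP; exact: measurable_funX.
  apply: le_lt_trans nu2.
  rewrite -(law (fun x => x ^+ 2)%R); first last.
  - by move=> x; exact: sqr_ge0.
  - exact: measurable_funX.
  apply: ge0_le_integral => //.
  - apply: measurableT_comp => //; apply/measurable_EFinP; exact: measurable_funX.
  - by apply/measurable_EFinP; exact: measurable_funX.
  by move=> w _; rewrite gee0_abs// lee_fin sqr_ge0.
split => //; have iZ := sqi_integrable sZ.
have E1 : \int[P]_w (fun w => (Z w)%:E)^\+ w = \int[nu]_x (Num.max x 0)%:E.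
  rewrite -(law (fun x => Num.max x 0%R)).
  - by apply: eq_integral => w _; rewrite funeposE EFin_max.
  - by apply: measurable_maxr => //; exact: measurable_cst.
  - by move=> x; rewrite le_max lexx orbT.
have E2 : \int[P]_w (fun w => (Z w)%:E)^\- w = \int[nu]_x (Num.max (- x)%R 0)%:E.
  rewrite -(law (fun x => Num.max (- x)%R 0%R)).
  - by apply: eq_integral => w _; rewrite funenegE -EFinN EFin_max.
  - by apply: measurable_maxr => //; exact: measurable_cst.
  - by move=> x; rewrite le_max lexx orbT.
rewrite integralE E1 E2 nus subee// -E2.
by apply: integrable_fin_num => //; exact: integrable_funeneg.
Qed.

End NormalMoments.

(** * White noise from Gaussian sequences, and countable covers *)

Section WhiteNoise.
Context (R : realType) (dO : measure_display) (Omega : measurableType dO)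
  (P : probability Omega R).

Definition white_noise (xi : nat -> Omega -> R) := exists s2 : R,
  [/\ forall (J : seq nat) (A : nat -> set R), uniq J -> (forall j, measurable (A j)) ->
        P (\bigcap_(j in [set` J]) (xi j @^-1` A j)) = (\prod_(j <- J) P (xi j @^-1` A j))%E,
      forall j, sqi P (xi j),
      forall j, (\int[P]_w (xi j w)%:E = 0)%E &
      forall j, (\int[P]_w (xi j w ^+ 2)%:E <= s2%:E)%E].

Lemma centered_normal0 : centered_normal P (fun=> 0).
Proof.
exists 0 => A mA; rewrite eqxx diracE; case: (boolP (_ \in A)) => [|]; rewrite ?inE ?notin_setE => A0.
  rewrite (_ : _ @^-1` A = setT) ?probability_setT//.
  by apply/seteqP; split.
rewrite (_ : _ @^-1` A = set0) ?measure0//.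
by apply/seteqP; split.
Qed.

Lemma gaussian_parts (eta : nat -> Omega -> cplx R) :
  (forall j, centered_real_gaussian P (eta j)) \/ (forall j, centered_complex_gaussian P (eta j)) ->
  forall j, centered_normal P (fun w => cre (eta j w)) /\ centered_normal P (fun w => cim (eta j w)).
Proof.
move=> [H j|H j].
  have [h1 h2] := H j; split => //.
  have -> : (fun w => cim (eta j w)) = fun=> 0 by apply/funext.
  exact: centered_normal0.
have h1 := H j 1 0; have h2 := H j 0 1.
split; [move: h1|move: h2]; congr (centered_normal P _); apply/funext => w.
  by rewrite mul1r mul0r addr0.
by rewrite mul1r mul0r add0r.
Qed.

(** [centered_normal] allows a different variance for each [j]; equality of the laws is what
    provides the common bound, namely the second moment at index [0]. *)
Lemma iid_white_noise (eta : nat -> Omega -> cplx R) (u : cplx R -> R) : iid P eta -> continuous u ->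
  (forall j, centered_normal P (fun w => u (eta j w))) ->
  white_noise (fun j w => u (eta j w)).
Proof.
move=> [meta same ind] cu cn.
have mu : measurable_fun setT (u : borel (cplx R) -> R) by exact: measurable_borel.
have pre (A : set R) : measurable A -> measurable (u @^-1` A : set (borel (cplx R))).
  by move=> mA; rewrite -[X in measurable X]setTI; exact: mu.
have mxi j : measurable_fun setT (fun w => u (eta j w)).
  exact: (measurableT_comp mu (meta j)).
have mom j := centered_normal_moments (mxi j) (cn j).
have law j : (\int[P]_w (u (eta j w) ^+ 2)%:E = \int[P]_w (u (eta 0%N w) ^+ 2)%:E)%E.
  pose Z k : {mfun Omega >-> measurableTypeR R} :=
    HB.pack ((fun w => u (eta k w)) : Omega -> measurableTypeR R)
      (isMeasurableFun.Build _ _ _ _ ((fun w => u (eta k w)) : Omega -> measurableTypeR R) (mxi k)).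
  have E k : (\int[P]_w (u (eta k w) ^+ 2)%:E = \int[distribution P (Z k)]_x (x ^+ 2)%:E)%E.
    rewrite ge0_integral_distribution//.
      by apply/measurable_EFinP; exact: measurable_funX.
    by move=> x; rewrite lee_fin sqr_ge0.
  rewrite !E; apply: eq_measure_integral => A mA _.
  exact: (same j (u @^-1` A) (pre A mA)).
exists (fine (\int[P]_w (u (eta 0%N w) ^+ 2)%:E)%E); split.
- move=> J A uJ mA; exact: (ind J (fun j => u @^-1` A j) uJ (fun j => pre _ (mA j))).
- by move=> j; have [] := mom j.
- by move=> j; have [] := mom j.
- move=> j; rewrite law fineK//; have [[_ h] _] := mom 0%N; exact: integrable_fin_num.
Qed.

Lemma ae_cover (X : ptopologicalType) (Q : Omega -> set X -> Prop) : @second_countable X ->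
  (forall w (A B : set X), A `<=` B -> Q w B -> Q w A) ->
  (forall x, exists A : set X, [/\ open A, A x & {ae P, forall w, Q w A}]) ->
  {ae P, forall w, forall x, exists A : set X, [/\ open A, A x & Q w A]}.
Proof.
move=> [B /countable_injP[f finj] [Bopen Bx]] mono H.
pose good b := exists2 A : set X, b `<=` A & {ae P, forall w, Q w A}.
have : {ae P, forall w, forall k : nat, forall b, B b -> f b = k -> good b -> Q w b}.
  apply: ae_foralln => k.
  have [[b0 [Bb0 fb0 [A bA QA]]]|no] := pselect (exists b, [/\ B b, f b = k & good b]); last first.
    by apply: aeW => w b Bb fb gb; exfalso; apply: no; exists b.
  apply: filterS QA => w Qw b Bb fb _; apply: mono Qw.
  suff -> : b = b0 by [].
  by apply: finj; rewrite ?inE// fb.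
apply: filterS => w Hw x; have [A [oA Ax QA]] := H x.
have [U [BU Ux] UA] := Bx x A (open_nbhs_nbhs (conj oA Ax)).
by exists U; split => //; [exact: Bopen|apply: Hw BU erefl _; exists A].
Qed.

End WhiteNoise.

(** * Almost sure convergence *)

Section SectionSeries.
Context (R : realType) (n : nat) (X : ptopologicalType) (M : complex_manifold R n X)
  (L : line_bundle M) (h : hermitian_metric L).
Variable T : nat -> bundle_section L.

Definition partial (c : nat -> cplx R) N : bundle_section L := fun x => \sum_(j < N) c j *: T j x.

Definition uniformly_cauchy (c : nat -> cplx R) (A : set X) := forall eps : R, 0 < eps ->
  exists m, forall k l x, (m <= k)%N -> (m <= l)%N -> A x ->
    sqnorm h (partial c k x - partial c l x) <= eps.

Lemma uniformly_cauchyS c (A B : set X) : A `<=` B -> uniformly_cauchy c B -> uniformly_cauchy c A.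
Proof. by move=> AB cB e /cB[m mP]; exists m => k l x mk ml /AB; exact: mP. Qed.

Lemma tails_cauchy c (A : set X) :
  (forall eps : R, 0 < eps -> exists m, forall N x, A x ->
     sqnorm h (\sum_(j < N) c (m + j)%N *: T (m + j)%N x) <= eps) ->
  uniformly_cauchy c A.
Proof.
(* Both partial sums are compared with the [m]-th one; [sqnormD_le] doubles the sum of the two
   errors, hence [e / 4]. *)
move=> H e e0; have [m mP] := H _ (divr_gt0 e0 (ltr0Sn _ 3)); exists m => k l x mk ml Ax.
have E p : (m <= p)%N -> partial c p x - partial c m x =
    \sum_(j < p - m) c (m + j)%N *: T (m + j)%N x.
  move=> mp; move: (p - m)%N (subnKC mp) => q <-.
  by rewrite /partial big_split_ord /= addrAC subrr add0r.
have -> : partial c k x - partial c l x =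
    (partial c k x - partial c m x) + - (partial c l x - partial c m x).
  by rewrite opprB addrA subrK.
apply: (le_trans (sqnormD_le _ _ _)); rewrite sqnormN !E//.
have h1 := mP (k - m)%N x Ax; have h2 := mP (l - m)%N x Ax.
by move: h1 h2; lra.
Qed.

Lemma cauchy_re_im c (A : set X) :
  uniformly_cauchy (fun j => mkc (cre (c j)) 0) A ->
  uniformly_cauchy (fun j => mkc (cim (c j)) 0) A -> uniformly_cauchy c A.
Proof.
move=> c1 c2 e e0; have e4 : 0 < e / 4 by rewrite divr_gt0.
have [m1 h1] := c1 _ e4; have [m2 h2] := c2 _ e4.
exists (maxn m1 m2) => k l x; rewrite !geq_max => /andP[mk1 mk2] /andP[ml1 ml2] Ax.
have E p : partial c p x = partial (fun j => mkc (cre (c j)) 0) p x +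
    ci R *: partial (fun j => mkc (cim (c j)) 0) p x.
  rewrite /partial scaler_sumr -big_split; apply: eq_bigr => j _ /=.
  rewrite scalerA -scalerDl; congr (_ *: _); apply: cplxP; rewrite !cplxE; ring.
rewrite !E opprD addrACA -scalerBr; apply: (le_trans (sqnormD_le _ _ _)).
rewrite sqnormZ; have -> : cmod (ci R) ^+ 2 = 1 by rewrite sqr_cmod !cplxE expr0n expr1n add0r.
have h3 := h1 k l x mk1 ml1 Ax; have h4 := h2 k l x mk2 ml2 Ax.
by move: h3 h4; lra.
Qed.

Lemma cmod_le_sq (z : cplx R) (e : R) : 0 <= e -> cmod z ^+ 2 <= e ^+ 2 -> cmod z <= e.
Proof. by move=> e0; rewrite ler_pXn2r// nnegrE// cmod_ge0. Qed.

Lemma pointwise_limit c x (A : set X) : A x -> uniformly_cauchy c A ->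
  exists v : fiber L x, forall eps : R, 0 < eps ->
    exists m, forall k, (m <= k)%N -> sqnorm h (partial c k x - v) <= eps.
Proof.
move=> Ax cc; have [a ax] := triv_cover L x.
have h0 := hcoef_gt0 h ax.
have sE (v : fiber L x) : sqnorm h v = cmod (triv_coord a v) ^+ 2 * hcoef h a x by exact: sqnorm_coord.
have [|l lP] := @cplx_cauchy R (fun k => triv_coord a (partial c k x)).
  move=> e e0; have [m mP] := cc (e ^+ 2 * hcoef h a x) (mulr_gt0 (exprn_gt0 2 e0) h0).
  exists m => k j mk mj; apply: cmod_le_sq; first exact: ltW.
  by rewrite -(ler_pM2r h0) -coordB// -sE; exact: mP.
exists (l *: triv_frame a x) => e e0.
have h1 : 0 < hcoef h a x + 1 by rewrite addr_gt0.
have d0 : 0 < Num.min 1 (e / (hcoef h a x + 1)) by rewrite lt_min ltr01 divr_gt0.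
have [m mP] := lP _ d0; exists m => k mk; rewrite sE coordB// coord_frame//.
have := mP k mk; set z := cmod _; rewrite le_min => /andP[z1 z2].
have z0 : 0 <= z by exact: cmod_ge0.
apply: (@le_trans _ _ (z * (hcoef h a x + 1))); last by rewrite -ler_pdivlMr.
rewrite expr2 -mulrA ler_wpM2l// -[leRHS]mul1r ler_pM// ?mulr_ge0 ?(ltW h0)//.
by rewrite ?mul1r lerDl.
Qed.

(** The limit is chosen pointwise in the fibers. The uniform Cauchy property makes the convergence
    uniform on each [A], which is the input of [holo_limit] once it is read in a trivialization. *)
Lemma uniform_limit c : (forall j, holomorphic_section (T j)) ->
  (forall x, exists A : set X, [/\ open A, A x & uniformly_cauchy c A]) ->
  exists psi : bundle_section L,
    (forall x, (fun N => Num.sqrt (sqnorm h (partial c N x - psi x))) @ \oo --> (0 : R)) /\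
    holomorphic_section psi.
Proof.
move=> hT H.
have ex x : exists v : fiber L x, forall eps : R, 0 < eps ->
    exists m, forall k, (m <= k)%N -> sqnorm h (partial c k x - v) <= eps.
  by have [A [_ Ax cA]] := H x; exact: pointwise_limit Ax cA.
pose psi x := sval (cid (ex x)).
have psiP x := svalP (cid (ex x)).
have unif (A : set X) : uniformly_cauchy c A -> forall e : R, 0 < e -> exists m, forall k x,
    (m <= k)%N -> A x -> sqnorm h (partial c k x - psi x) <= e.
  move=> cA e e0; have e4 : 0 < e / 4 by rewrite divr_gt0.
  have [m mP] := cA _ e4; exists m => k x mk Ax.
  have [m' m'P] := psiP x _ e4; pose l := maxn m m'.
  have -> : partial c k x - psi x = (partial c k x - partial c l x) + (partial c l x - psi x).
    by rewrite addrA subrK.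
  apply: (le_trans (sqnormD_le _ _ _)).
  have h1 := mP k l x mk (leq_maxl _ _) Ax; have h2 := m'P l (leq_maxr _ _).
  by move: h1 h2; rewrite -/(psi x); lra.
exists psi; split.
  move=> x; apply/cvgrPdist_le => e e0; have [m mP] := psiP x _ (exprn_gt0 2 e0).
  exists m => // k /= mk; rewrite sub0r normrN ger0_norm ?sqrtr_ge0//.
  rewrite -(ger0_norm (ltW e0)) -sqrtr_sqr ler_wsqrtr//.
  exact: mP.
move=> i a _ [x [ix ax] <-]; apply/holoP.
have [A [oA Ax cA]] := H x.
(* Half the weight at [x] is a lower bound for the weight nearby, so that uniform smallness of
   [sqnorm] becomes uniform smallness of coordinates. *)
have h0 := hcoef_gt0 h ax; pose b := hcoef h a x / 2.
have b0 : 0 < b by rewrite divr_gt0.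
have ch : {for chart i x, continuous (fun z => hcoef h a (chart_inv i z))} by exact: hcoef_continuous.
have n1 : \forall w \near chart i x, b < hcoef h a (chart_inv i w).
  by apply: (continuous_near_gt ch); rewrite chartK// /b ltr_pdivrMr// ltr_pMr// ltr1n.
have n2 : nbhs (chart i x) (chart_region i a A).
  by apply: open_nbhs_nbhs; split; [exact: chart_region_open|exists x].
have [r r0 rP] := (nbhs_box (chart i x) _).1 (filterI n1 n2).
apply: (@holo_limit _ _ (fun k z => triv_coord a (partial c k (chart_inv i z))) _ _ r r0).
  move=> k v /rP[_ [y [iy ay _] <-]]; apply/holoP.
  have hp : holomorphic_section (partial c k).
    exact: (@holomorphic_comb _ _ _ _ _ T (fun=> true) c k (fun j _ => hT j)).
  by apply: hp; exists y.
move=> e e0; have [m mP] := unif A cA _ (mulr_gt0 (exprn_gt0 2 e0) b0).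
exists m => k v mk /rP[bv [y [iy ay Ay] yv]].
rewrite -yv chartK// in bv *.
have := mP k y mk Ay; rewrite (sqnorm_coord _ _ ay) coordB//.
set z := _ - _ => zle; apply: cmod_le_sq; first exact: ltW.
rewrite -(ler_pM2r b0); apply: le_trans zle.
by rewrite ler_wpM2l ?exprn_ge0 ?cmod_ge0 ?(ltW bv).
Qed.

End SectionSeries.

(** * Local uniform convergence of the random series *)

Section Assembly.
Context (R : realType) (n : nat) (X : ptopologicalType) (M : complex_manifold R n X)
  (Theta : hermitian_form M) (dV : {measure set (borel X) -> \bar R})
  (dV_vol : is_volume_measure Theta dV) (L : line_bundle M) (h : hermitian_metric L)
  (d : option nat) (S : nat -> bundle_section L)
  (S_hol : forall j, in_range d j -> l2_holomorphic h dV (S j))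
  (S_on : forall j k, in_range d j -> in_range d k -> l2_inner h dV (S j) (S k) = (j == k)%:R)
  (dO : measure_display) (Omega : measurableType dO) (P : probability Omega R).

(** The local estimate is used twice. The outer one bounds the Bergman kernel by [C1] on [A1]; the
    inner one is taken inside [A1], so that the Gram matrix over [B] has trace at most [C1 * dV B],
    and it turns smallness in [L^2(B)] into uniform smallness on [A]. The set [A] is chosen before
    [xi]. *)
Lemma local_series x0 : exists A' : set X, [/\ open A', A' x0 &
  forall xi : nat -> Omega -> R, white_noise P xi ->
    {ae P, forall w, uniformly_cauchy h (cutoff d S) (fun j => mkc (xi j w) 0) A'}].
Proof.
set T := cutoff d S.
have [A1 [B1 [C1 [[oA1 A1x mB1 _ _] [_ C10 est1]]]]] := local_estimate dV_vol h openT (I : setT x0).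
have [A [B [C [[oA Ax mB BA1 dB] [_ C0 est]]]]] := local_estimate dV_vol h oA1 A1x.
exists A; split => // xi [s2 [ixi sxi exi vxi]].
have hT j : holomorphic_section (T j) by exact: cutoff_hol S_hol j.
have iT j : (\int[dV]_(x in B) (sqnorm h (T j x))%:E < +oo)%E.
  apply: le_lt_trans (cutoff_l2 S_hol j); apply: ge0_subset_integral => //.
    by apply/measurable_EFinP; exact: sqnorm_measurable.
  by move=> y _; rewrite lee_fin sqnorm_ge0.
pose g := gre dV h T B.
have gC N : \sum_(j < N) g j j <= fine (C1%:E * dV B)%E.
  rewrite -lee_fin fineK; last first.
    by rewrite fin_numM// ge0_fin_numE.
  have -> : (\sum_(j < N) g j j)%:E = (\int[dV]_(x in B) (\sum_(j < N) sqnorm h (T j x))%:E)%E.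
    under eq_integral do rewrite -sumEFin.
    rewrite integral_sum//; last by move=> j; exact: sqnorm_integrable.
    rewrite -sumEFin; apply: eq_bigr => j _; rewrite /g /gre /Rintegral fineK//.
    by have [i1 _] := herm_integrable hT mB iT j j; exact: integrable_fin_num.
  rewrite -integral_cst//; apply: ge0_le_integral => //.
  - by move=> x _; rewrite lee_fin sumr_ge0// => j _; exact: sqnorm_ge0.
  - apply/measurable_EFinP; apply: measurable_sum => j; apply: measurable_funTS.
    exact: sqnorm_measurable.
  - move=> x Bx; rewrite lee_fin.
    exact: (bergman_bound S_hol S_on mB1 C10 (fun s hs => est1 s hs x (BA1 _ Bx))).
have gpos m N (x : nat -> R) : 0 <= \sum_(i < N) \sum_(j < N) x i * x j * g (m + i)%N (m + j)%N.
  exact: (gre_pos (T := fun j => T (m + j)%N) (fun j => hT (m + j)%N) mB (fun j => iT (m + j)%N)).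
have K := kolmogorov_series ixi sxi exi vxi (gre_sym dV h T B) gpos gC.
apply: filterS K => w Kw; apply: tails_cauchy => e e0.
have C1' : 0 < C + 1 by rewrite ltr_pwDr.
(* The inner estimate multiplies the quadratic form by [C]; dividing by [C + 1] also covers
   [C = 0]. *)
have [m mP] := Kw _ (divr_gt0 e0 C1'); exists m => N x Axx.
have hs : holomorphic_section (fun y => \sum_(j < N) mkc (xi (m + j)%N w) 0 *: T (m + j)%N y).
  exact: (@holomorphic_comb _ _ _ _ _ (fun j => T (m + j)%N) (fun=> true)
    (fun j => mkc (xi (m + j)%N w) 0) N (fun j _ => hT (m + j)%N)).
have := est _ hs x Axx.
rewrite (integral_sqnorm_real (T := fun j => T (m + j)%N) (fun j => hT (m + j)%N) mB
  (fun j => iT (m + j)%N) (fun j => xi (m + j)%N w) N).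
rewrite -EFinM lee_fin => /le_trans; apply.
have := mP N; rewrite /qform /g /gre /= => q.
apply: (le_trans (ler_wpM2l C0 q)).
by rewrite mulrA ler_pdivrMr// mulrC ler_wpM2l ?(ltW e0)// lerDl.
Qed.

End Assembly.
Theorem proposition2p1 (R : realType) (n : nat) (X : ptopologicalType)
    (M : complex_manifold R n X) (Xconn : connected [set: X])
    (Theta : hermitian_form M) (dV : {measure set (borel X) -> \bar R})
    (dV_vol : is_volume_measure Theta dV)
    (L : line_bundle M) (h : hermitian_metric L)
    (d : option nat) (d_dim : l2_dimension h dV d) (d_ge1 : d <> Some 0%N)
    (S : nat -> bundle_section L) (S_basis : l2_orthonormal_basis h dV d S)
    (dO : measure_display) (Omega : measurableType dO)
    (P : probability Omega R) (eta : nat -> Omega -> cplx R)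
    (eta_iid : iid P eta)
    (eta_gauss : (forall j, centered_real_gaussian P (eta j)) \/
                 (forall j, centered_complex_gaussian P (eta j))) :
  {ae P, forall w, exists psi : bundle_section L,
     (forall x : X, series_converges_at h d (fun j => eta j w) S psi x) /\
     holomorphic_section psi}.
Proof.
have [S_hol S_on _] := S_basis.
have cn := gaussian_parts eta_gauss.
have wre := iid_white_noise eta_iid (@continuous_cre R) (fun j => (cn j).1).
have wim := iid_white_noise eta_iid (@continuous_cim R) (fun j => (cn j).2).
pose T := cutoff d S.
have : {ae P, forall w, forall x, exists A : set X,
    [/\ open A, A x & uniformly_cauchy h T (fun j => eta j w) A]}.
  apply: (ae_cover (Q := fun w A => uniformly_cauchy h T (fun j => eta j w) A)).
  - exact: mfd_second_countable M.
  - by move=> w A B AB; exact: uniformly_cauchyS.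
  move=> x; have [A [oA Ax AP]] := local_series dV_vol S_hol S_on P x.
  exists A; split => //.
  (* The same [A] serves both parts, as it does not depend on the noise; intersecting the two almost
     sure events requires no independence between them. *)
  apply: filterS2 (AP _ wre) (AP _ wim) => w; exact: cauchy_re_im.
apply: filterS => w Hw.
have [psi [psiS psi_hol]] := uniform_limit (cutoff_hol S_hol) Hw.
exists psi; split => // x; rewrite /series_converges_at.
have E N : \sum_(j < N | in_range d j) eta j w *: S j x = partial T (fun j => eta j w) N x.
  rewrite /partial big_mkcond; apply: eq_bigr => j _; rewrite /T /cutoff.
  by case: ifP => // _; rewrite scaler0.
under eq_fun do rewrite E; exact: psiS.
Qed.
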